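(* Let $R$ be a commutative Noetherian local ring of depth $t\ge 1$, and let $M$ be a finitely generated $R$-module such that $\operatorname{G-dim}_R(M^\ast)<\infty$, where $M^\ast=\operatorname{Hom}_R(M,R)$. Suppose that $M$ is locally free on the punctured spectrum of $R$. If $\operatorname{depth}_R(M)\ge t$ and $\operatorname{Ext}_R^{t-1}(M,M)=0$, then $M$ is free.
   Context: A finitely generated module $G$ is totally reflexive if it is reflexive and $\operatorname{Ext}_R^i(G,R)=\operatorname{Ext}_R^i(G^\ast,R)=0$ for all $i>0$. $\operatorname{G-dim}_R(N)$ is the infimum of the non-negative integers $m$ for which there is an exact sequence $0\to G_m\to\cdots\to G_0\to N\to 0$ with every $G_i$ totally reflexive. $M$ is locally free on the punctured spectrum if $M_\mathfrak{p}$ is a free $R_\mathfrak{p}$-module for every non-maximal prime $\mathfrak{p}$ of $R$. *)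

(* Defs.v *)
From HB Require Import structures.
From mathcomp Require Import all_boot all_algebra.
From mathcomp Require Import boolp classical_sets functions.
From mathcomp Require Import ring.

Set Implicit Arguments.
Unset Strict Implicit.
Unset Printing Implicit Defensive.

Import GRing.Theory.
Local Open Scope ring_scope.
Local Open Scope quotient_scope.

Section Span.
Variables (A : pzRingType) (M : lmodType A).

Definition in_span (B : set M) (v : M) : Prop :=
  exists (s : seq M) (c : M -> A),
    (forall b, b \in s -> B b) /\ v = \sum_(b <- s) c b *: b.

Definition lin_indep (B : set M) : Prop :=
  forall (s : seq M) (c : M -> A),
    uniq s -> (forall b, b \in s -> B b) ->
    \sum_(b <- s) c b *: b = 0 -> forall b, b \in s -> c b = 0.

End Span.

Definition fin_gen (A : pzRingType) (M : lmodType A) : Prop :=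
  exists s : seq M, forall v : M, in_span [set b | b \in s] v.

Definition free_module (A : pzRingType) (M : lmodType A) : Prop :=
  exists B : set M, lin_indep B /\ forall v : M, in_span B v.

(* The ideals of R are the submodules of R^o; unlike [idealr R], whose elements
   are proper, this includes the unit ideal. *)
Definition noetherian (R : comNzRingType) : Prop :=
  forall I : {pred R^o}, submod_closed I ->
    exists s : seq R^o, forall x : R^o, x \in I <-> in_span [set b | b \in s] x.

Definition maximal_ideal (R : comNzRingType) (I : idealr R) : Prop :=
  forall J : idealr R, {subset I <= J} -> {subset J <= I}.

Definition local_ring (R : comNzRingType) (m : idealr R) : Prop :=
  maximal_ideal m /\ forall n : idealr R, maximal_ideal n -> n =i m.

Section Depth.
Variables (R : comNzRingType) (m : idealr R) (M : lmodType R).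

(* membership in the submodule (s_0, ..., s_(k-1)) M *)
Definition in_seq_mul (s : seq R) (v : M) : Prop :=
  exists w : nat -> M, v = \sum_(0 <= i < size s) s`_i *: w i.

Definition regular_seq (s : seq R) : Prop :=
  [/\ forall x, x \in s -> x \in m,
      forall i, (i < size s)%N -> forall v : M,
        in_seq_mul (take i s) (s`_i *: v) -> in_seq_mul (take i s) v
    & exists v : M, ~ in_seq_mul s v].

(* Depth is the supremum of the lengths of the regular sequences contained in
   m, the zero module having infinite depth. *)
Definition depth_ge (n : nat) : Prop :=
  (forall v : M, v = 0) \/
  exists s : seq R, regular_seq s /\ (n <= size s)%N.

Definition depth_eq (n : nat) : Prop := depth_ge n /\ ~ depth_ge n.+1.

End Depth.

Section Hom.
Variables (R : comNzRingType) (M N : lmodType R).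

Definition homset : {pred M -> N} := fun f => `[< linear f >].

Lemma homset_submod_closed : submod_closed homset.
Proof.
split=> [|a f g /asboolP fL /asboolP gL]; apply/asboolP => b u v.
  by rewrite /= scaler0 addr0.
have E x : (a *: f + g) x = a *: f x + g x by [].
by rewrite !E fL gL !scalerDr !scalerA mulrC addrACA.
Qed.

HB.instance Definition _ :=
  GRing.isSubmodClosed.Build R (M -> N) homset homset_submod_closed.

Record homR := HomR { homR_fun :> M -> N; _ : homR_fun \in homset }.

HB.instance Definition _ := [isSub for homR_fun].
HB.instance Definition _ := [Choice of homR by <:].
HB.instance Definition _ := [SubChoice_isSubLmodule of homR by <:].

Lemma homR_linear (f : homR) : linear f.
Proof. by apply/asboolP; case: f. Qed.

HB.instance Definition _ (f : homR) :=
  GRing.isLinear.Build R M N *:%R f (homR_linear f).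

End Hom.

Definition dual (R : comNzRingType) (M : lmodType R) : lmodType R :=
  homR M R^o.

Section Bidual.
Variables (R : comNzRingType) (M : lmodType R).

Lemma eval_homset (x : M) : (fun f : homR M R^o => f x) \in @homset R (dual M) R^o.
Proof. by apply/asboolP. Qed.

Definition bidual_map (x : M) : dual (dual M) := HomR (eval_homset x).

Definition reflexive_module : Prop := bijective bidual_map.

End Bidual.

Record resolution (R : comNzRingType) (M : lmodType R) := Resolution {
  res_mod :> nat -> lmodType R;
  res_diff : forall i, {linear res_mod i.+1 -> res_mod i};
  res_aug : {linear res_mod 0%N -> M};
  res_aug_surj : forall x, exists y, res_aug y = x;
  res_exact0 : forall y, res_aug y = 0 <-> exists z, res_diff 0%N z = y;
  res_exact : forall i y,
    res_diff i y = 0 <-> exists z, res_diff i.+1 z = y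
}.

Definition projective (R : comNzRingType) (P : lmodType R) : Prop :=
  forall (A B : lmodType R) (g : {linear A -> B}) (f : {linear P -> B}),
    (forall b, exists a, g a = b) ->
    exists h : {linear P -> A}, forall x, g (h x) = f x.

Section Ext.
Variables (R : comNzRingType) (M N : lmodType R).

Definition cocycle (P : resolution M) i (f : {linear P i -> N}) : Prop :=
  forall x, f (res_diff P i x) = 0.

Definition coboundary (P : resolution M) i : {linear P i -> N} -> Prop :=
  match i with
  | 0%N => fun f => forall x, f x = 0
  | j.+1 => fun f =>
      exists g : {linear P j -> N}, forall x, f x = g (res_diff P j x)
  end.

(* Ext^i(M, N) is the i-th cohomology of Hom(P, N) for a projective resolution
   P of M; its vanishing does not depend on the choice of P. *)
Definition Ext_eq0 (i : nat) : Prop :=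
  exists P : resolution M, (forall j, projective (P j)) /\
    forall f : {linear P i -> N}, cocycle f -> coboundary f.

End Ext.

Definition totally_reflexive (R : comNzRingType) (G : lmodType R) : Prop :=
  [/\ fin_gen G,
      reflexive_module G,
      forall i, (0 < i)%N -> Ext_eq0 G R^o i
    & forall i, (0 < i)%N -> Ext_eq0 (dual G) R^o i].

(* An exact sequence 0 -> G_n -> ... -> G_0 -> M -> 0 is encoded as a
   resolution of M that is zero above degree n. *)
Definition Gdim_le (R : comNzRingType) (M : lmodType R) (n : nat) : Prop :=
  exists G : resolution M,
    (forall i, (i <= n)%N -> totally_reflexive (G i)) /\
    (forall i, (n < i)%N -> forall x : G i, x = 0).

Definition Gdim_finite (R : comNzRingType) (M : lmodType R) : Prop :=
  exists n, Gdim_le M n.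

Section LocModule.
Variables (R : comNzRingType) (p : prime_idealr R).

Record denom := Denom { den :> R; _ : den \notin (p : {pred R}) }.

HB.instance Definition _ := [isSub for den].
HB.instance Definition _ := [Choice of denom by <:].

Implicit Types s t u : denom.

Lemma denom1_proof : 1 \notin (p : {pred R}).
Proof. by rewrite idealr1. Qed.

Definition denom1 : denom := Denom denom1_proof.

Lemma denomM_proof s t : den s * den t \notin (p : {pred R}).
Proof. by rewrite prime_idealrM negb_or (valP s) (valP t). Qed.

Definition denomM s t : denom := Denom (denomM_proof s t).

Variable M : lmodType R.

Definition frac_eq (x y : M * denom) : bool :=
  `[< exists u : denom,
        den u *: (den y.2 *: x.1) = den u *: (den x.2 *: y.1) >].

Lemma frac_eq_refl : reflexive frac_eq.
Proof. by move=> x; apply/asboolP; exists denom1. Qed.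

Lemma frac_eq_sym : symmetric frac_eq.
Proof.
by move=> x y; apply/asboolP/asboolP => -[u e]; exists u; rewrite e.
Qed.

Lemma frac_eq_trans : transitive frac_eq.
Proof.
move=> [y t] [x s] [z r] /asboolP [u /= e1] /asboolP [v /= e2].
apply/asboolP; exists (denomM (denomM u v) t) => /=.
transitivity ((den v * den r) *: (den u *: (den t *: x))).
  by rewrite !scalerA; congr (_ *: _); ring.
rewrite e1.
transitivity ((den u * den s) *: (den v *: (den r *: y))).
  by rewrite !scalerA; congr (_ *: _); ring.
by rewrite e2 !scalerA; congr (_ *: _); ring.
Qed.

Canonical frac_equiv :=
  EquivRel frac_eq frac_eq_refl frac_eq_sym frac_eq_trans.

Definition loc := {eq_quot frac_eq}.

HB.instance Definition _ : EqQuotient _ frac_eq loc := EqQuotient.on loc.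
HB.instance Definition _ := Choice.on loc.

Lemma locP (x y : M * denom) :
  reflect (exists u : denom,
      den u *: (den y.2 *: x.1) = den u *: (den x.2 *: y.1))
    (\pi_loc x == \pi_loc y).
Proof. by rewrite eqmodE; exact: asboolP. Qed.

Lemma loc_ind (P : loc -> Prop) :
  (forall x : M * denom, P (\pi_loc x)) -> forall a, P a.
Proof. by move=> H a; rewrite -(reprK a); apply: H. Qed.

Definition frac_add (x y : M * denom) : M * denom :=
  (den y.2 *: x.1 + den x.2 *: y.1, denomM x.2 y.2).

Definition frac_opp (x : M * denom) : M * denom := (- x.1, x.2).

Definition loc0 : loc := \pi_loc (0, denom1).
Definition loc_add (a b : loc) : loc := \pi_loc (frac_add (repr a) (repr b)).
Definition loc_opp (a : loc) : loc := \pi_loc (frac_opp (repr a)).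

Lemma frac_repr x : exists u : denom,
  den u *: (den x.2 *: (repr (\pi_loc x)).1)
    = den u *: (den (repr (\pi_loc x)).2 *: x.1).
Proof. by apply/locP; rewrite reprK. Qed.

Lemma pi_loc_add x y :
  loc_add (\pi_loc x) (\pi_loc y) = \pi_loc (frac_add x y).
Proof.
have [u e] := frac_repr x; have [v f] := frac_repr y.
move: e f; rewrite /loc_add.
move: (repr _) (repr _) => [y' t'] [x' s'].
case: x y => [x s] [y t] /= e f.
apply/eqP/locP; exists (denomM u v) => /=.
rewrite !scalerDr !scalerA; congr (_ + _).
  transitivity ((den v * den t * den t') *: (den u *: (den s *: x'))).
    by rewrite !scalerA; congr (_ *: _); ring.
  by rewrite e !scalerA; congr (_ *: _); ring.
transitivity ((den u * den s * den s') *: (den v *: (den t *: y'))).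
  by rewrite !scalerA; congr (_ *: _); ring.
by rewrite f !scalerA; congr (_ *: _); ring.
Qed.

Lemma pi_loc_opp x : loc_opp (\pi_loc x) = \pi_loc (frac_opp x).
Proof.
have [u e] := frac_repr x; apply/eqP/locP; exists u => /=.
by rewrite !scalerN e.
Qed.

Lemma loc_addA : associative loc_add.
Proof.
elim/loc_ind=> -[x s]; elim/loc_ind=> -[y t]; elim/loc_ind=> -[z r].
rewrite !pi_loc_add; apply/eqP/locP; exists denom1 => /=.
rewrite !scalerDr !scalerA !addrA.
by congr (_ *: _ + _ *: _ + _ *: _); ring.
Qed.

Lemma loc_addC : commutative loc_add.
Proof.
elim/loc_ind=> -[x s]; elim/loc_ind=> -[y t].
rewrite !pi_loc_add; apply/eqP/locP; exists denom1 => /=.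
rewrite !scalerDr !scalerA addrC.
by congr (_ *: _ + _ *: _); ring.
Qed.

Lemma loc_add0 : left_id loc0 loc_add.
Proof.
elim/loc_ind=> -[x s]; rewrite pi_loc_add.
apply/eqP/locP; exists denom1 => /=.
by rewrite scaler0 add0r !scale1r mul1r.
Qed.

Lemma loc_addN : left_inverse loc0 loc_opp loc_add.
Proof.
elim/loc_ind=> -[x s]; rewrite pi_loc_opp pi_loc_add.
apply/eqP/locP; exists denom1 => /=.
by rewrite scalerN addNr !scaler0.
Qed.

HB.instance Definition _ :=
  GRing.isZmodule.Build loc loc_addA loc_addC loc_add0 loc_addN.

Lemma pi_locD x y : \pi_loc x + \pi_loc y = \pi_loc (frac_add x y).
Proof. exact: pi_loc_add. Qed.

End LocModule.

Section LocRing.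
Variables (R : comNzRingType) (p : prime_idealr R).

Definition locR := loc p R^o.

HB.instance Definition _ := GRing.Zmodule.on locR.

Lemma pi_locRD (x y : R^o * denom p) :
  \pi_(loc p R^o) x + \pi_(loc p R^o) y
    = \pi_(loc p R^o) (frac_add x y) :> locR.
Proof. exact: pi_loc_add. Qed.

Local Notation frac M := (M * denom p)%type.

Definition frac_scale (M : lmodType R) (a : frac R) (x : frac M) : frac M :=
  (a.1 *: x.1, denomM a.2 x.2).

Definition loc_scale (M : lmodType R) (a : locR) (b : loc p M) : loc p M :=
  \pi_(loc p M) (frac_scale (repr a : frac R) (repr b)).

Lemma pi_loc_scale (M : lmodType R) (a : frac R^o) (x : frac M) :
  loc_scale (\pi_(loc p R^o) a) (\pi_(loc p M) x)
    = \pi_(loc p M) (frac_scale (a : frac R) x).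
Proof.
have [u e] := frac_repr a; have [v f] := frac_repr x.
move: e f; rewrite /loc_scale.
move: (repr _) (repr _) => [x' t'] [a' s'].
case: a x => [a s] [x t] /= e f.
apply/eqP/locP; exists (denomM u v) => /=.
rewrite !scalerA.
transitivity ((den u * (den s * a')) *: (den v *: (den t *: x'))).
  by rewrite !scalerA; congr (_ *: _); ring.
rewrite -[den u * _]/(den u *: (den s *: (a' : R^o))) e f !scalerA.
by congr (_ *: _); rewrite /GRing.scale /=; ring.
Qed.

Definition locR1 : locR := \pi_(loc p R^o) (1, denom1 p).

Lemma loc_scaleA (M : lmodType R) (a b : locR) (x : loc p M) :
  loc_scale a (loc_scale b x) = loc_scale (loc_scale a b : locR) x.
Proof.
elim/loc_ind: a => -[a s]; elim/loc_ind: b => -[b t].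
elim/loc_ind: x => -[x r]; rewrite !pi_loc_scale.
apply/eqP/locP; exists (denom1 p) => /=.
by rewrite !scalerA /GRing.scale /=; congr (_ *: _); ring.
Qed.

Lemma loc_scale1 (M : lmodType R) : left_id locR1 (@loc_scale M).
Proof.
elim/loc_ind=> -[x s]; rewrite !pi_loc_scale.
apply/eqP/locP; exists (denom1 p) => /=.
by rewrite !scale1r mul1r.
Qed.

Lemma loc_scaleDr (M : lmodType R) : right_distributive (@loc_scale M) +%R.
Proof.
elim/loc_ind=> -[a s]; elim/loc_ind=> -[x t]; elim/loc_ind=> -[y r].
rewrite !(pi_loc_scale, pi_locD, pi_locRD).
apply/eqP/locP; exists (denom1 p) => /=.
by rewrite !(scalerDr, scalerA); congr (_ *: _ + _ *: _); ring.
Qed.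

Lemma loc_scaleDl (M : lmodType R) (x : loc p M) :
  {morph (@loc_scale M)^~ x : a b / a + b}.
Proof.
elim/loc_ind: x => -[x r].
elim/loc_ind=> -[a s]; elim/loc_ind=> -[b t].
rewrite /= pi_locRD !pi_loc_scale pi_locD.
apply/eqP/locP; exists (denom1 p) => /=.
have E (c : R) (d : R^o) : c *: d = c * d by [].
rewrite !E !(scalerDr, scalerDl, scalerA) mulrDr scalerDl.
by congr (_ *: _ + _ *: _); ring.
Qed.

Definition locR_mul (a b : locR) : locR := loc_scale a b.

Lemma locR_mulA : associative locR_mul.
Proof. exact: loc_scaleA. Qed.

Lemma locR_mulC : commutative locR_mul.
Proof.
elim/loc_ind=> -[a s]; elim/loc_ind=> -[b t].
rewrite /locR_mul !pi_loc_scale; apply/eqP/locP; exists (denom1 p) => /=.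
by rewrite /GRing.scale /=; ring.
Qed.

Lemma locR_mul1 : left_id locR1 locR_mul.
Proof. exact: loc_scale1. Qed.

Lemma locR_mulDl : left_distributive locR_mul +%R.
Proof. by move=> a b c; exact: loc_scaleDl. Qed.

Lemma locR_1neq0 : locR1 != 0.
Proof.
apply/negP=> /locP[[u up] /=].
rewrite !scale1r /GRing.scale /= mulr1 mulr0 => u0.
by rewrite u0 idealr0 in up.
Qed.

HB.instance Definition _ := GRing.Zmodule_isComNzRing.Build locR
  locR_mulA locR_mulC locR_mul1 locR_mulDl locR_1neq0.

HB.instance Definition _ (M : lmodType R) :=
  GRing.Zmodule_isLmodule.Build locR (loc p M)
    (@loc_scaleA M) (@loc_scale1 M) (@loc_scaleDr M) (@loc_scaleDl M).

End LocRing.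

Definition free_at (R : comNzRingType) (M : lmodType R) (p : prime_idealr R) :
  Prop := free_module (loc p M : lmodType (locR p)).

Definition punctured_free (R : comNzRingType) (M : lmodType R) : Prop :=
  forall p : prime_idealr R, ~ maximal_ideal p -> free_at M p.

(* Main.v *)
Require Import Defs.
From HB Require Import structures.
From mathcomp Require Import all_boot all_algebra.
From mathcomp Require Import boolp classical_sets functions.
From mathcomp Require Import ring.

Set Implicit Arguments.
Unset Strict Implicit.
Unset Printing Implicit Defensive.

Import GRing.Theory.
Local Open Scope ring_scope.
Local Open Scope quotient_scope.

(* Let N = M^*, let t >= 2 (for t = 1 the hypothesis says Hom(M, M) = 0), and let K
   be the ideal of those a in the maximal ideal m for which a * id_M factors through
   a finite free module, say a * id_M = sum_i h_i(-) e_i; local freeness says that K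
   lies in no non-maximal prime.  Put L_0 = R, C_j = the product of the localizations
   of L_j at the non-maximal primes, and L_(j+1) = C_j / L_j.  Depth is read off from
   Ext(R/m, -), which vanishes on each C_j; hence L_j embeds in C_j for j < t, while
   L_t has a nonzero element s with m s = 0.  As elements of K act invertibly on the
   factors of C_j, Ext^i(X, C_j) = 0 for i > 0 and X in {M, N, syzygies of N}, so
   Ext^(i+j)(X, R) can be computed as Ext^i(X, L_j).

   The depth of M makes M reflexive and kills Ext^i(N, R) for 1 <= i <= t - 2.  High
   syzygies of N are totally reflexive; if T is such a syzygy, 0 -> T -> F -> Z -> 0
   is exact and depth Z >= t, then F^* -> T^* is onto: otherwise some nonzero
   T^* -> R/m -> L_t vanishes on F^*, and shifting along the C_j this contradicts the
   injectivity of Ext^t(R/m, T) -> Ext^t(R/m, F).  Descending to the (t-2)-nd syzygy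
   gives Ext^i(N, R) = 0 for all i > 0.

   If N were not free, there would be f0 in N outside m N with f0(M) inside m.  Choose
   gamma : N -> L_t killing m N with gamma(f0) = s and lift it to g : N -> C_(t-1).
   Then (y, f) |-> f0(y) g(f) takes values in L_(t-1), and since Ext^(t-1)(M, M) = 0
   becomes Ext^1(M, Hom(N, L_(t-2))) = 0 it lifts to B : M -> Hom(N, C_(t-2)).  The
   sums sum_i B(e_i)(h_i) are a times a common "trace" in C_(t-2), whose image in
   L_(t-1) must be g(f0); so gamma(f0) = 0, a contradiction. *)

(** * Submodules, quotients, products and localizations *)

Section Linear.
Variable R : comNzRingType.
Implicit Types A B D X : lmodType R.

(** A bilinear form M x N -> A can be evaluated at the identity of M only where id_M comes from an
    element of the tensor product of M and N, that is, where M is locally free; over R only the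
    multiples a * id_M with a in K do. Traces are therefore taken in some C_j, where division by
    elements of K is possible factor by factor. The trace of f0(y) g(f) is g(f0), because sum_i
    f0(e_i) h_i = a f0. The condition f0(M) in m puts the form into L_(t-1), while g(f0) itself
    stays outside; lifting the form to C_(t-2) forces its trace into L_(t-1). One level of the tower
    is spent on lifting gamma and one on lifting the form, hence t >= 2.

    The number t - 2 of syzygies has this source: N is a dual, so its depth is controlled only up to
    2, and each syzygy gains one until t is reached.

    The product over all non-maximal primes needs no choice of parameters. In return no single
    element of K need be invertible on all of C_j, so every argument about C_j runs on the factors
    separately. *)

Definition lin A B (f : A -> B) (fL : linear f) : {linear A -> B} :=
  HB.pack f (GRing.isLinear.Build R A B *:%R f fL).

(** Lets a map be specified by a property of its values; uniqueness and compatibility of that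
    property replace a linearity proof for chosen values. *)
Lemma lin_rel A B (S : A -> B -> Prop) :
  (forall x, exists y, S x y) -> (forall x y z, S x y -> S x z -> y = z) ->
  (forall a x y u v, S x u -> S y v -> S (a *: x + y) (a *: u + v)) ->
  exists f : {linear A -> B}, forall x, S x (f x).
Proof.
move=> /choice[f Sf] uniqS SL.
have fL : linear f by move=> a x y; apply: uniqS (Sf _) (SL _ _ _ _ _ (Sf _) (Sf _)).
by exists (lin fL).
Qed.

Lemma lin_factor A B X (i : {linear A -> B}) (f : {linear X -> B}) :
  (forall a, i a = 0 -> a = 0) -> (forall x, exists a, i a = f x) ->
  exists g : {linear X -> A}, forall x, i (g x) = f x.
Proof.
move=> i0 fi; apply: (lin_rel (S := fun x a => i a = f x)) => //.
  by move=> x y z iy iz; apply/subr0_eq/i0; rewrite linearB iy iz subrr.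
by move=> a x y u v iu iv; rewrite !linearP iu iv.
Qed.

Lemma lin_quot A B X (p : {linear A -> B}) (f : {linear A -> X}) :
  (forall b, exists a, p a = b) -> (forall a, p a = 0 -> f a = 0) ->
  exists g : {linear B -> X}, forall a, g (p a) = f a.
Proof.
move=> ps f0.
have [|||g gE] := @lin_rel B X (fun b x => forall a, p a = b -> f a = x).
- move=> b; have [a ab] := ps b; exists (f a) => a' a'b.
  by apply: subr0_eq; rewrite -linearB; apply: f0; rewrite linearB ab a'b subrr.
- by move=> b y z by_ bz; have [a ab] := ps b; rewrite -(by_ a) // (bz a).
- move=> c x y u v xu yv a pa; have [a1 a1x] := ps x; have [a2 a2y] := ps y.
  rewrite -(xu _ a1x) -(yv _ a2y) -linearP; apply: subr0_eq.
  by rewrite -linearB; apply: f0; rewrite linearB pa linearP a1x a2y subrr.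
by exists g => a; rewrite -(gE (p a) a).
Qed.

Definition lin0 A B : {linear A -> B} := \0%R.
End Linear.

Section Submodule.
Variables (R : comNzRingType) (A : lmodType R).

Definition submodule (S : set A) : Prop :=
  S 0 /\ forall a x y, S x -> S y -> S (a *: x + y).

Variables (S : set A) (Ssub : submodule S).

Lemma submoduleZ a x : S x -> S (a *: x).
Proof. by case: Ssub => S0 SL Sx; rewrite -[_ *: _]addr0; apply: SL. Qed.
Lemma submoduleD x y : S x -> S y -> S (x + y).
Proof. by case: Ssub => S0 SL Sx Sy; rewrite -[x]scale1r; apply: SL. Qed.
Lemma submoduleN x : S x -> S (- x).
Proof. by rewrite -scaleN1r; apply: submoduleZ. Qed.
Lemma submoduleB x y : S x -> S y -> S (x - y).
Proof. by move=> Sx Sy; apply/submoduleD/submoduleN. Qed.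
Lemma submodule_sum (I : eqType) (r : seq I) (F : I -> A) :
  (forall i, i \in r -> S (F i)) -> S (\sum_(i <- r) F i).
Proof.
by move=> SF; rewrite big_seq; elim/big_ind: _ => //; [case: Ssub | apply: submoduleD].
Qed.
End Submodule.

Section SubmoduleType.
Variables (R : comNzRingType) (A : lmodType R) (S : set A) (Ssub : submodule S).

(** The proof is an argument so that the closure instance can be found from the predicate itself;
    [quot_eq] is indexed in the same way. *)
Definition sub_pred of submodule S : {pred A} := fun x => `[< S x >].

Lemma sub_pred_closed : submod_closed (sub_pred Ssub).
Proof.
case: Ssub => S0 SL; split=> [|a x y /asboolP Sx /asboolP Sy]; apply/asboolP => //.
exact: SL.
Qed.

HB.instance Definition _ :=
  GRing.isSubmodClosed.Build R A (sub_pred Ssub) sub_pred_closed.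

Record subm := Subm { subm_val :> A; _ : subm_val \in sub_pred Ssub }.

HB.instance Definition _ := [isSub for subm_val].
HB.instance Definition _ := [Choice of subm by <:].
HB.instance Definition _ := [SubChoice_isSubLmodule of subm by <:].

Definition subm_inc : {linear subm -> A} := val.

Lemma subm_incP (z : subm) : S (subm_inc z).
Proof. by apply/asboolP; case: z. Qed.

Lemma subm_inc_inj z : subm_inc z = 0 -> z = 0.
Proof. by move=> z0; apply: val_inj. Qed.

Lemma subm_incS x : S x <-> exists z, subm_inc z = x.
Proof.
split=> [Sx|[z <-]]; last exact: subm_incP.
have Px : x \in sub_pred Ssub by apply/asboolP.
by exists (Subm Px).
Qed.

End SubmoduleType.

Section QuotientModule.
Variables (R : comNzRingType) (A : lmodType R) (S : set A) (Ssub : submodule S).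

Definition quot_eq of submodule S := fun x y : A => `[< S (x - y) >].

Lemma quot_eq_refl : reflexive (quot_eq Ssub).
Proof. by move=> x; apply/asboolP; rewrite subrr; case: Ssub. Qed.
Lemma quot_eq_sym : symmetric (quot_eq Ssub).
Proof.
by move=> x y; apply/asboolP/asboolP => h; rewrite -opprB; apply: submoduleN.
Qed.
Lemma quot_eq_trans : transitive (quot_eq Ssub).
Proof.
move=> y x z /asboolP h1 /asboolP h2; apply/asboolP.
by rewrite -[x](subrK y) -addrA; apply: submoduleD.
Qed.
Canonical quot_equiv :=
  EquivRel (quot_eq Ssub) quot_eq_refl quot_eq_sym quot_eq_trans.

Definition quotm := {eq_quot quot_eq Ssub}.
HB.instance Definition _ : EqQuotient _ (quot_eq Ssub) quotm := EqQuotient.on quotm.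
HB.instance Definition _ := Choice.on quotm.

Lemma quotmP x y : \pi_quotm x = \pi_quotm y <-> S (x - y).
Proof.
split; first by move/eqP; rewrite eqmodE => /asboolP.
by move=> h; apply/eqP; rewrite eqmodE; apply/asboolP.
Qed.

Lemma quotm_repr x : S (repr (\pi_quotm x) - x).
Proof. by apply/quotmP; rewrite reprK. Qed.

Lemma quotm_ind (P : quotm -> Prop) : (forall x, P (\pi_quotm x)) -> forall u, P u.
Proof. by move=> H u; rewrite -(reprK u). Qed.

Definition quotm_add (u v : quotm) : quotm := \pi_quotm (repr u + repr v).
Definition quotm_opp (u : quotm) : quotm := \pi_quotm (- repr u).
Definition quotm_scale (a : R) (u : quotm) : quotm := \pi_quotm (a *: repr u).

Lemma quotm_addE x y : quotm_add (\pi_quotm x) (\pi_quotm y) = \pi_quotm (x + y).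
Proof.
by apply/quotmP; rewrite opprD addrACA; apply: (submoduleD Ssub); apply: quotm_repr.
Qed.
Lemma quotm_oppE x : quotm_opp (\pi_quotm x) = \pi_quotm (- x).
Proof. by apply/quotmP; rewrite -opprD; apply/(submoduleN Ssub)/quotm_repr. Qed.
Lemma quotm_scaleE a x : quotm_scale a (\pi_quotm x) = \pi_quotm (a *: x).
Proof. by apply/quotmP; rewrite -scalerBr; apply/(submoduleZ Ssub)/quotm_repr. Qed.

Lemma quotm_addA : associative quotm_add.
Proof.
elim/quotm_ind=> x; elim/quotm_ind=> y; elim/quotm_ind=> z.
by rewrite !quotm_addE addrA.
Qed.
Lemma quotm_addC : commutative quotm_add.
Proof. by elim/quotm_ind=> x; elim/quotm_ind=> y; rewrite !quotm_addE addrC. Qed.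
Lemma quotm_add0 : left_id (\pi_quotm 0) quotm_add.
Proof. by elim/quotm_ind=> x; rewrite !quotm_addE add0r. Qed.
Lemma quotm_addN : left_inverse (\pi_quotm 0) quotm_opp quotm_add.
Proof. by elim/quotm_ind=> x; rewrite quotm_oppE !quotm_addE addNr. Qed.

HB.instance Definition _ :=
  GRing.isZmodule.Build quotm quotm_addA quotm_addC quotm_add0 quotm_addN.

Lemma quotm_scaleA a b u : quotm_scale a (quotm_scale b u) = quotm_scale (a * b) u.
Proof. by elim/quotm_ind: u => x; rewrite !quotm_scaleE scalerA. Qed.
Lemma quotm_scale1 : left_id 1 quotm_scale.
Proof. by elim/quotm_ind=> x; rewrite !quotm_scaleE scale1r. Qed.
Lemma quotm_scaleDr : right_distributive quotm_scale +%R.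
Proof.
move=> a; elim/quotm_ind=> x; elim/quotm_ind=> y.
by rewrite ![_ + _]quotm_addE !quotm_scaleE [RHS]quotm_addE scalerDr.
Qed.
Lemma quotm_scaleDl u : {morph quotm_scale^~ u : a b / a + b}.
Proof.
by elim/quotm_ind: u => x a b; rewrite !quotm_scaleE [RHS]quotm_addE scalerDl.
Qed.

HB.instance Definition _ := GRing.Zmodule_isLmodule.Build R quotm
  quotm_scaleA quotm_scale1 quotm_scaleDr quotm_scaleDl.

Lemma quotm_pi_linear : linear (fun x : A => \pi_quotm x).
Proof.
by move=> a x y; rewrite -quotm_addE -quotm_scaleE.
Qed.

Definition qpi : {linear A -> quotm} := lin quotm_pi_linear.

Lemma qpi_surj u : exists x, qpi x = u.
Proof. by exists (repr u); rewrite -[RHS]reprK. Qed.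
Lemma qpi_eq0 x : qpi x = 0 <-> S x.
Proof. by rewrite -{2}[x]subr0; apply: quotmP. Qed.

End QuotientModule.

Section ProductModule.
Variables (R : comNzRingType) (J : Type) (D : J -> lmodType R).

Definition dprod := forall j, D j.
HB.instance Definition _ := gen_eqMixin dprod.
HB.instance Definition _ := gen_choiceMixin dprod.

Lemma dprod_addA : associative (fun u v : dprod => (fun j => u j + v j) : dprod).
Proof. by move=> u v w; apply: functional_extensionality_dep => j; rewrite addrA. Qed.
Lemma dprod_addC : commutative (fun u v : dprod => (fun j => u j + v j) : dprod).
Proof. by move=> u v; apply: functional_extensionality_dep => j; rewrite addrC. Qed.
Lemma dprod_add0 :
  left_id ((fun j => 0) : dprod) (fun u v : dprod => (fun j => u j + v j) : dprod).
Proof. by move=> u; apply: functional_extensionality_dep => j; rewrite add0r. Qed.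
Lemma dprod_addN : left_inverse ((fun j => 0) : dprod)
  (fun u : dprod => (fun j => - u j) : dprod)
  (fun u v : dprod => (fun j => u j + v j) : dprod).
Proof. by move=> u; apply: functional_extensionality_dep => j; rewrite addNr. Qed.
HB.instance Definition _ :=
  GRing.isZmodule.Build dprod dprod_addA dprod_addC dprod_add0 dprod_addN.

Definition dprod_scale (a : R) (u : dprod) : dprod := fun j => a *: u j.
Lemma dprod_scaleA a b u : dprod_scale a (dprod_scale b u) = dprod_scale (a * b) u.
Proof. by apply: functional_extensionality_dep => j; rewrite /dprod_scale scalerA. Qed.
Lemma dprod_scale1 : left_id 1 dprod_scale.
Proof. by move=> u; apply: functional_extensionality_dep => j; rewrite /dprod_scale scale1r. Qed.
Lemma dprod_scaleDr : right_distributive dprod_scale +%R.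
Proof. by move=> a u v; apply: functional_extensionality_dep => j; apply: scalerDr. Qed.
Lemma dprod_scaleDl u : {morph dprod_scale^~ u : a b / a + b}.
Proof. by move=> a b; apply: functional_extensionality_dep => j; apply: scalerDl. Qed.
HB.instance Definition _ := GRing.Zmodule_isLmodule.Build R dprod
  dprod_scaleA dprod_scale1 dprod_scaleDr dprod_scaleDl.

Lemma dprod_proj_linear j : linear (fun u : dprod => u j).
Proof. by []. Qed.
Definition dproj j : {linear dprod -> D j} := lin (dprod_proj_linear j).

Lemma dprod_ext (u : dprod) : (forall j, dproj j u = 0) -> u = 0.
Proof. by move=> h; apply: functional_extensionality_dep. Qed.

End ProductModule.

Section LocalizedModule.
Variables (R : comNzRingType) (p : prime_idealr R) (A : lmodType R).

(* [loc p A] already carries a module structure over [locR p]; this copy carries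
   the one over [R]. *)
Definition locm := loc p A.
HB.instance Definition _ := GRing.Zmodule.on locm.

Lemma locm_ind (P : locm -> Prop) :
  (forall x (s : denom p), P (\pi_(loc p A) (x, s))) -> forall u, P u.
Proof. by move=> H; elim/loc_ind=> -[x s]. Qed.

Definition locm_scale (a : R) (u : locm) : locm :=
  loc_scale (\pi_(loc p R^o) (a : R^o, denom1 p)) u.

Lemma locm_scaleE a x s :
  locm_scale a (\pi_(loc p A) (x, s)) = \pi_(loc p A) (a *: x, denomM (denom1 p) s).
Proof. by rewrite /locm_scale pi_loc_scale. Qed.

Lemma locm_scaleA a b u : locm_scale a (locm_scale b u) = locm_scale (a * b) u.
Proof.
elim/locm_ind: u => x s; rewrite !locm_scaleE; apply/eqP/locP.
by exists (denom1 p); rewrite /= !scalerA; congr (_ *: _); ring.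
Qed.
Lemma locm_scale1 : left_id 1 locm_scale.
Proof. by move=> u; rewrite /locm_scale; apply: loc_scale1. Qed.
Lemma locm_scaleDr : right_distributive locm_scale +%R.
Proof. by move=> a u v; apply: loc_scaleDr. Qed.
Lemma locm_scaleDl u : {morph locm_scale^~ u : a b / a + b}.
Proof.
elim/locm_ind: u => x s a b /=; rewrite !locm_scaleE pi_locD; apply/eqP/locP.
by exists (denom1 p); rewrite /= !scalerDl !scalerDr !scalerA; congr (_ *: _ + _ *: _); ring.
Qed.
HB.instance Definition _ := GRing.Zmodule_isLmodule.Build R locm
  locm_scaleA locm_scale1 locm_scaleDr locm_scaleDl.

Lemma locm_inc_linear : linear (fun x : A => \pi_(loc p A) (x, denom1 p) : locm).
Proof.
move=> a x y.
transitivity (loc_add (\pi_(loc p A) (a *: x, denomM (denom1 p) (denom1 p)))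
                      (\pi_(loc p A) (y, denom1 p))).
  rewrite pi_loc_add; apply/eqP/locP; exists (denom1 p).
  by rewrite /= !(scalerDr, scalerA, mulr1, mul1r, scale1r).
by rewrite -locm_scaleE.
Qed.

Definition locm_inc : {linear A -> locm} := lin locm_inc_linear.

Lemma locm_inc_eq0 x : locm_inc x = 0 <-> exists2 s : R, s \notin p & s *: x = 0.
Proof.
split=> [/eqP/locP[u]|[s ps sx]].
  by rewrite /= scale1r !scaler0 => ux; exists u; first by case: (u).
apply/eqP/locP; exists (Denom ps).
by rewrite /= scale1r !scaler0.
Qed.

Lemma locm_num (u : locm) : exists2 s : R, s \notin p & exists x, s *: u = locm_inc x.
Proof.
elim/locm_ind: u => x s; exists s; first by case: (s).
exists x; transitivity (locm_scale s (\pi_(loc p A) (x, s))) => //.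
rewrite locm_scaleE; apply/eqP/locP; exists (denom1 p).
by rewrite /= !scale1r mul1r.
Qed.

Lemma locm_mul_inj s (u : locm) : s \notin p -> s *: u = 0 -> u = 0.
Proof.
move=> ps; elim/locm_ind: u => x r su0.
have : locm_scale s (\pi_(loc p A) (x, r)) = 0 by [].
rewrite locm_scaleE => /eqP/locP[u /= e]; apply/eqP/locP.
exists (denomM u (Denom ps)); move: e; rewrite /= !scale1r !scaler0 => e.
by rewrite -scalerA.
Qed.

Lemma locm_mul_surj s (u : locm) : s \notin p -> exists v, s *: v = u.
Proof.
move=> ps; elim/locm_ind: u => x r.
exists (\pi_(loc p A) (x, denomM (Denom ps) r) : locm).
transitivity (locm_scale s (\pi_(loc p A) (x, denomM (Denom ps) r))) => //.
rewrite locm_scaleE; apply/eqP/locP; exists (denom1 p).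
by rewrite /= !scale1r !scalerA; congr (_ *: _); ring.
Qed.

End LocalizedModule.

(* The product of the localizations at the non-maximal primes plays the role of
   the Cech complex: it embeds every module without socle. *)
Section PuncturedModule.
Variables (R : comNzRingType) (A : lmodType R).

(* The index set consists of the underlying predicates: the universe of
   [prime_idealr R] is too large for an index set of a product. *)
Definition punct_primes := {q : R -> bool |
  exists p : prime_idealr R, ~ maximal_ideal p /\ (p : R -> bool) = q}.
Definition punct_prime (q : punct_primes) : prime_idealr R := sval (cid (svalP q)).
Lemma punct_primeP q : ~ maximal_ideal (punct_prime q).
Proof. by case: (svalP (cid (svalP q))). Qed.

Definition punctm := dprod (fun q : punct_primes => locm (punct_prime q) A).
HB.instance Definition _ := GRing.Lmodule.on punctm.

Lemma punct_inc_linear :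
  linear (fun (x : A) => (fun q => locm_inc (punct_prime q) A x) : punctm).
Proof.
move=> a x y; apply: functional_extensionality_dep => q.
by rewrite linearP.
Qed.
Definition punct_inc : {linear A -> punctm} := lin punct_inc_linear.

Lemma punct_inc_eq0 x : punct_inc x = 0 ->
  forall p : prime_idealr R, ~ maximal_ideal p -> exists2 s : R, s \notin p & s *: x = 0.
Proof.
move=> x0 p pm.
have pq : exists p' : prime_idealr R, ~ maximal_ideal p' /\ (p' : R -> bool) = p.
  by exists p.
pose q : punct_primes := exist _ (p : R -> bool) pq.
(* The prime chosen for the index [q] may differ from [p] as a structure; only the underlying
   predicates agree. *)
have qE : (punct_prime q : R -> bool) = p by case: (svalP (cid (svalP q))).
have /locm_inc_eq0[s sq sx] : locm_inc (punct_prime q) A x = 0.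
  by have := congr1 (fun u : punctm => u q) x0.
by exists s => //; move: sq; rewrite -!topredE /= qE.
Qed.

End PuncturedModule.

(** The maps [pr] exhibit C as a product up to isomorphism. The element of K that is invertible on a
    factor may vary with the factor. This form is stable under Hom(X, -). *)
Definition split_local (R : comNzRingType) (K : set R) (C : lmodType R) : Prop :=
  exists (J : Type) (D : J -> lmodType R) (pr : forall j, {linear C -> D j}),
    [/\ forall d : (forall j, D j), exists c, forall j, pr j c = d j,
        forall c, (forall j, pr j c = 0) -> c = 0
      & forall j, exists a, [/\ K a, forall u : D j, a *: u = 0 -> u = 0
                              & forall u : D j, exists v, a *: v = u]].

Lemma split_local_punctm (R : comNzRingType) (K : set R) (A : lmodType R) :
  (forall p : prime_idealr R, ~ maximal_ideal p -> exists2 a, K a & a \notin p) ->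
  split_local K (punctm A).
Proof.
move=> Kp; exists (punct_primes R), (fun q => locm (punct_prime q) A), (@dproj _ _ _).
split=> [d|c|q]; [by exists d | exact: dprod_ext |].
have [a Ka ap] := Kp _ (punct_primeP (q := q)); exists a; split=> //= u.
  exact: locm_mul_inj.
exact: locm_mul_surj.
Qed.

(** * Exact sequences and vanishing of Ext *)

Section Sequences.
Variable R : comNzRingType.
Implicit Types A B C D N X Y Z : lmodType R.

Definition ses A B D (i : {linear A -> B}) (p : {linear B -> D}) : Prop :=
  [/\ forall a, i a = 0 -> a = 0, forall d, exists b, p b = d
    & forall b, p b = 0 <-> exists a, i a = b].

Lemma ses_comp0 A B D (i : {linear A -> B}) (p : {linear B -> D}) :
  ses i p -> forall a, p (i a) = 0.
Proof. by case=> _ _ ip a; apply/ip; exists a. Qed.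

Lemma ker_submodule A B (f : {linear A -> B}) : submodule (fun x => f x = 0).
Proof.
split=> [|a x y fx fy]; first exact: linear0.
by rewrite linearP fx fy scaler0 addr0.
Qed.

Lemma im_submodule A B (f : {linear A -> B}) : submodule (fun y => exists x, f x = y).
Proof.
split=> [|a _ _ [x <-] [y <-]]; first by exists 0; exact: linear0.
by exists (a *: x + y); rewrite linearP.
Qed.

Lemma ses_ker A B (f : {linear A -> B}) : (forall b, exists a, f a = b) ->
  ses (subm_inc (ker_submodule f)) f.
Proof.
move=> fs; split=> // [a|b]; first exact: subm_inc_inj.
exact: (subm_incS (ker_submodule f)).
Qed.

Lemma ses_qpi A (S : set A) (Ssub : submodule S) : ses (subm_inc Ssub) (qpi Ssub).
Proof.
split=> [a|u|b]; [exact: subm_inc_inj | exact: qpi_surj|].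
by rewrite qpi_eq0; exact: (subm_incS Ssub).
Qed.

Lemma ses_coker A B (f : {linear A -> B}) : (forall a, f a = 0 -> a = 0) ->
  ses f (qpi (im_submodule f)).
Proof. by move=> f0; split=> // [u|b]; [exact: qpi_surj | exact: qpi_eq0]. Qed.

(** [projective] lifts along surjections only, so both maps are first corestricted to the image of
    [d]. *)
Lemma proj_lift X A B (d : {linear A -> B}) (g : {linear X -> B}) :
  projective X -> (forall x, exists y, d y = g x) ->
  exists h : {linear X -> A}, forall x, d (h x) = g x.
Proof.
move=> Xproj gd; pose Ssub := im_submodule d.
have [g' gE] := lin_factor (@subm_inc_inj _ _ _ Ssub) (fun x => (subm_incS Ssub _).1 (gd x)).
have [d' dE] := lin_factor (@subm_inc_inj _ _ _ Ssub)
  (fun y => (subm_incS Ssub (d y)).1 (ex_intro _ y erefl)).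
have [|h hE] := Xproj _ _ d' g'.
  move=> z; have [y dy] := subm_incP z; exists y.
  by apply: subr0_eq; apply: (@subm_inc_inj _ _ _ Ssub); rewrite linearB dE dy subrr.
by exists h => x; rewrite -dE hE gE.
Qed.

Lemma dependent_choice_nat (T : nat -> Type) (x0 : T 0%N)
    (S : forall i, T i -> T i.+1 -> Prop) :
  (forall i x, exists y, S i x y) ->
  exists f : forall i, T i, f 0%N = x0 /\ forall i, S i (f i) (f i.+1).
Proof.
move=> Sex; pose f := nat_rect T x0 (fun i x => sval (cid (Sex i x))).
by exists f; split=> // i; exact: (svalP (cid (Sex i (f i)))).
Qed.

End Sequences.

(** * Long exact sequences and homotopies for Ext *)

Section ExtVanishing.
Variable R : comNzRingType.
Implicit Types A B C D N X Y Z : lmodType R.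

(** Unlike [Ext_eq0], the resolution is fixed, so that cochains with different coefficients can be
    combined; [Ext_van_indep] passes between the two. In degree 0 it says Hom(X, A) = 0. *)
Definition Ext_van X (P : resolution X) A i : Prop :=
  forall f : {linear P i -> A}, cocycle f -> coboundary f.

Definition projective_resolution X (P : resolution X) : Prop :=
  forall i, projective (P i).

Lemma res_dd X (P : resolution X) i x : res_diff P i (res_diff P i.+1 x) = 0.
Proof. by apply/res_exact; exists x. Qed.

Lemma res_augd X (P : resolution X) x : res_aug P (res_diff P 0%N x) = 0.
Proof. by apply/res_exact0; exists x. Qed.

Lemma coboundary_ext X (P : resolution X) A i (f g : {linear P i -> A}) :
  f =1 g -> coboundary f -> coboundary g.
Proof.
move=> fg; case: i f g fg => [|i] f g fg /=; first by move=> f0 x; rewrite -fg.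
by case=> h hE; exists h => x; rewrite -fg.
Qed.

Lemma coboundary_comp X (P : resolution X) A B i (f : {linear P i -> A})
  (u : {linear A -> B}) : coboundary f -> coboundary (u \o f : {linear P i -> B}).
Proof.
case: i f => [|i] f /=; first by move=> f0 x; rewrite /= f0 linear0.
by case=> h hE; exists (u \o h) => x /=; rewrite hE.
Qed.

Lemma Ext_van_ses_third X (P : resolution X) A B D (i : {linear A -> B})
    (p : {linear B -> D}) j : projective_resolution P -> ses i p ->
  Ext_van P B j -> Ext_van P A j.+1 -> Ext_van P D j.
Proof.
move=> Pp ip EB EA f fc; have [i0 ps ex] := ip.
have [f' f'E] := Pp j _ _ p f ps.
have [|c cE] := lin_factor (f := f' \o res_diff P j) i0.
  by move=> x; apply/ex; rewrite /= f'E fc.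
have /EA[g gE] : cocycle c.
  by move=> x; apply: i0; rewrite cE /= res_dd linear0.
pose e : {linear P j -> B} := f' \- (i \o g).
have /EB/(coboundary_comp p) : cocycle e by move=> x; rewrite /e /= -gE cE subrr.
apply: coboundary_ext => x.
by rewrite /e /= linearB f'E (ses_comp0 ip) subr0.
Qed.

(** Exactness at Ext^(j+1)(X, A): the bounding cochain [g] becomes a cocycle in D, hence a
    coboundary, and subtracting a lift of the latter moves [g] into the kernel of [p]. In degree 0 a
    coboundary is zero and no correction takes place. *)
Lemma ses_coboundary X (P : resolution X) A B D (i : {linear A -> B})
    (p : {linear B -> D}) j (f : {linear P j.+1 -> A}) :
  projective_resolution P -> ses i p -> Ext_van P D j ->
  coboundary (i \o f : {linear P j.+1 -> B}) -> coboundary f.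
Proof.
move=> Pp ip ED [g gE]; have [i0 ps ex] := ip.
have pgc : cocycle (p \o g : {linear P j -> D}).
  by move=> x; rewrite /= -gE /= (ses_comp0 ip).
have [g' g'd pg'] : exists2 g' : {linear P j -> B},
    forall x, g' (res_diff P j x) = g (res_diff P j x) & forall x, p (g' x) = 0.
  have := ED _ pgc; case: j f g gE ED pgc => [|j] f g gE ED pgc /=.
    by move=> pg; exists g.
  case=> h hE; have [h' h'E] := Pp j _ _ p h ps.
  exists (g \- (h' \o res_diff P j)) => x /=; first by rewrite res_dd linear0 subr0.
  by rewrite linearB h'E -hE subrr.
have [|k kE] := lin_factor (f := g') i0; first by move=> x; apply/ex.
exists k => x; apply: subr0_eq; apply: i0.
by rewrite linearB kE g'd -gE subrr.
Qed.

Lemma Ext_van_ses_first X (P : resolution X) A B D (i : {linear A -> B})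
    (p : {linear B -> D}) j : projective_resolution P -> ses i p ->
  Ext_van P D j -> Ext_van P B j.+1 -> Ext_van P A j.+1.
Proof.
move=> Pp ip ED EB f fc; apply: (ses_coboundary Pp ip ED); apply: EB => x.
by rewrite /= fc linear0.
Qed.

Lemma Ext_van0_sub X (P : resolution X) A B (i : {linear A -> B}) :
  (forall a, i a = 0 -> a = 0) -> Ext_van P B 0 -> Ext_van P A 0.
Proof.
move=> i0 EB f fc x; apply: i0; apply: (EB (i \o f)) => y.
by rewrite /= fc linear0.
Qed.

Lemma Ext_van_iso X (P : resolution X) A B (i : {linear A -> B}) j :
  (forall a, i a = 0 -> a = 0) -> (forall b, exists a, i a = b) ->
  Ext_van P B j -> Ext_van P A j.
Proof.
move=> i0 isurj EB f fc.
have [k kE] := lin_factor (f := (idfun : {linear B -> B})) i0 isurj.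
have /EB/(coboundary_comp k) : cocycle (i \o f : {linear P j -> B}).
  by move=> x; rewrite /= fc linear0.
apply: coboundary_ext => x /=.
by apply: subr0_eq; apply: i0; rewrite linearB kE subrr.
Qed.

(* Naturality of the connecting map, in the form needed to climb along a tower
   of exact sequences: injectivity on Ext^(j+1) descends to Ext^j. *)
Lemma coboundary_shift X (P : resolution X) A C A' B D B'
    (iA : {linear A -> C}) (pA : {linear C -> A'})
    (iB : {linear B -> D}) (pB : {linear D -> B'})
    (u : {linear A -> B}) (v : {linear C -> D}) (w : {linear A' -> B'}) j :
  projective_resolution P -> ses iA pA -> ses iB pB ->
  (forall a, v (iA a) = iB (u a)) -> (forall c, w (pA c) = pB (v c)) ->
  Ext_van P C j ->
  (forall f : {linear P j.+1 -> A}, cocycle f ->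
     coboundary (u \o f : {linear P j.+1 -> B}) -> coboundary f) ->
  forall f : {linear P j -> A'}, cocycle f ->
     coboundary (w \o f : {linear P j -> B'}) -> coboundary f.
Proof.
move=> Pp sA sB uv vw EC inj f fc wf; have [iA0 pAs exA] := sA; have [iB0 pBs exB] := sB.
have [f' f'E] := Pp j _ _ pA f pAs.
have [|c cE] := lin_factor (f := f' \o res_diff P j) iA0.
  by move=> x; apply/exA; rewrite /= f'E fc.
have cc : cocycle c by move=> x; apply: iA0; rewrite cE /= res_dd linear0.
have [g' g'd pg'] : exists2 g' : {linear P j -> D},
    forall x, g' (res_diff P j x) = v (f' (res_diff P j x)) & forall x, pB (g' x) = 0.
  case: j f f' c wf f'E {fc EC inj cc cE} => [|j] f f' c /= wf f'E.
    by exists (v \o f') => // x /=; rewrite -vw f'E wf.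
  case: wf => h hE; have [h' h'E] := Pp j _ _ pB h pBs.
  exists ((v \o f') \- (h' \o res_diff P j)) => x /=; first by rewrite res_dd linear0 subr0.
  by rewrite linearB h'E -hE /= -vw f'E subrr.
have [|k kE] := lin_factor (f := g') iB0; first by move=> x; apply/exB.
have [|g gE] := inj c cc.
  exists k => x; apply: subr0_eq; apply: iB0.
  by rewrite linearB kE g'd /= -uv cE subrr.
pose e : {linear P j -> C} := f' \- (iA \o g).
have /EC/(coboundary_comp pA) : cocycle e by move=> x; rewrite /e /= -gE cE subrr.
apply: coboundary_ext => x.
by rewrite /e /= linearB f'E (ses_comp0 sA) subr0.
Qed.

Lemma chain_lift X Y (P : resolution X) (Q : resolution Y) (h : {linear X -> Y}) :
  projective_resolution P ->
  exists phi : forall i, {linear P i -> Q i},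
    (forall x, res_aug Q (phi 0%N x) = h (res_aug P x)) /\
    forall i x, res_diff Q i (phi i.+1 x) = phi i (res_diff P i x).
Proof.
move=> Pp; have [phi0 phi0E] := Pp 0%N _ _ (res_aug Q) (h \o res_aug P) (@res_aug_surj _ _ Q).
(* Each stage carries the condition that its composite with the differential lands in the image of
   the differential of [Q], which is what the next lift requires. *)
pose T i := {phi : {linear P i -> Q i} |
  forall z, exists w, res_diff Q i w = phi (res_diff P i z)}.
have t0 z : exists w, res_diff Q 0%N w = phi0 (res_diff P 0%N z).
  by apply/res_exact0; rewrite phi0E /= res_augd linear0.
have step i (x : T i) : exists y : T i.+1,
    forall z, res_diff Q i (sval y z) = sval x (res_diff P i z).
  case: x => phi phiP; have [psi psiE] := proj_lift (g := phi \o res_diff P i) (Pp i.+1) phiP.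
  suff psiP z : exists w, res_diff Q i.+1 w = psi (res_diff P i.+1 z) by exists (exist _ psi psiP).
  by apply/res_exact; rewrite psiE /= res_dd linear0.
have [phi [phi0' phiS]] := dependent_choice_nat (exist _ phi0 t0 : T 0%N) step.
by exists (fun i => sval (phi i)); split=> // x; rewrite phi0' phi0E.
Qed.

(** With s = 0 this is uniqueness of lifts up to homotopy. A general [s] covers maps that factor
    through the projective in degree 0: they are null-homotopic in positive degrees, with [s] as the
    only defect in degree 0. *)
Lemma null_homotopy X Y (P : resolution X) (Q : resolution Y)
    (phi : forall i, {linear P i -> Q i}) (s : {linear X -> Q 0%N}) :
  projective_resolution P ->
  (forall x, res_aug Q (phi 0%N x) = res_aug Q (s (res_aug P x))) ->
  (forall i x, res_diff Q i (phi i.+1 x) = phi i (res_diff P i x)) ->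
  exists sg : forall i, {linear P i -> Q i.+1},
    (forall x, phi 0%N x = res_diff Q 0%N (sg 0%N x) + s (res_aug P x)) /\
    forall i x, phi i.+1 x = res_diff Q i.+1 (sg i.+1 x) + sg i (res_diff P i x).
Proof.
move=> Pp phi0 phiS.
pose T i := {sg : {linear P i -> Q i.+1} |
  forall z, res_diff Q i (phi i.+1 z - sg (res_diff P i z)) = 0}.
have [|sg0 sg0E] := proj_lift (d := res_diff Q 0%N) (g := phi 0%N \- (s \o res_aug P)) (Pp 0%N).
  by move=> x; apply/res_exact0; rewrite /= linearB phi0 subrr.
have t0 z : res_diff Q 0%N (phi 1%N z - sg0 (res_diff P 0%N z)) = 0.
  by rewrite linearB phiS sg0E /= res_augd linear0 subr0 subrr.
have step i (x : T i) : exists y : T i.+1,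
    forall z, phi i.+1 z = res_diff Q i.+1 (sval y z) + sval x (res_diff P i z).
  case: x => sg sgP; have [|sg' sg'E] := proj_lift (d := res_diff Q i.+1)
      (g := phi i.+1 \- (sg \o res_diff P i)) (Pp i.+1).
    by move=> x; apply/res_exact; exact: sgP.
  suff sgP' z : res_diff Q i.+1 (phi i.+2 z - sg' (res_diff P i.+1 z)) = 0.
    by exists (exist _ sg' sgP') => z; rewrite sg'E /= subrK.
  by rewrite linearB phiS sg'E /= res_dd linear0 subr0 subrr.
have [sg [sg0' sgS]] := dependent_choice_nat (exist _ sg0 t0 : T 0%N) step.
exists (fun i => sval (sg i)); split=> // x.
by rewrite sg0' sg0E subrK.
Qed.

Lemma Ext_van_indep X (P Q : resolution X) A i :
  projective_resolution P -> projective_resolution Q -> Ext_van Q A i -> Ext_van P A i.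
Proof.
move=> Pp Qp EQ f fc.
have [al [al0 alS]] := chain_lift Q (idfun : {linear X -> X}) Pp.
have [be [be0 beS]] := chain_lift P (idfun : {linear X -> X}) Qp.
pose phi j : {linear P j -> P j} := idfun \- (be j \o al j).
have [||sg [sg0 sgS]] := null_homotopy (phi := phi) (s := lin0 X (P 0%N)) Pp.
- by move=> x; rewrite /phi /= linearB be0 al0 /= subrr linear0.
- by move=> j x; rewrite /phi /= linearB beS alS.
have /EQ : cocycle (f \o be i : {linear Q i -> A}).
  by move=> x; rewrite /= -beS fc.
have fE x : f x = f (phi i x) + f (be i (al i x)) by rewrite -linearD /phi /= subrK.
case: i f fc fE {EQ} => [|i] f fc fE /=.
  by move=> f0 x; rewrite fE [X in _ + X]f0 addr0 sg0 /= addr0 fc.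
case=> g gE; exists ((f \o sg i) \+ (g \o al i)) => x.
by rewrite fE [X in _ + X]gE sgS linearD fc add0r alS.
Qed.

Lemma Ext_van_of_eq0 X (P : resolution X) A i :
  projective_resolution P -> Ext_eq0 X A i -> Ext_van P A i.
Proof. by move=> Pp [Q [Qp EQ]]; apply: (Ext_van_indep Pp Qp). Qed.

Definition scal (a : R) A : {linear A -> A} := a \*: idfun.

Lemma scalE a A (x : A) : scal a A x = a *: x.
Proof. by []. Qed.

Lemma htpy_scal X (P : resolution X) a (s : {linear X -> P 0%N}) :
  projective_resolution P -> (forall x, res_aug P (s x) = a *: x) ->
  exists sg : forall i, {linear P i -> P i.+1},
    (forall x, a *: x = res_diff P 0%N (sg 0%N x) + s (res_aug P x)) /\
    forall i x, a *: x = res_diff P i.+1 (sg i.+1 x) + sg i (res_diff P i x).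
Proof.
move=> Pp sa; apply: (null_homotopy (phi := fun i => scal a (P i))) => // [x|i x].
  by rewrite sa linearZ.
by rewrite linearZ.
Qed.

Lemma scal_inv A (a : R) : (forall u : A, a *: u = 0 -> u = 0) ->
  (forall u : A, exists v, a *: v = u) ->
  exists k : {linear A -> A}, forall u, a *: k u = u.
Proof. exact: (lin_factor (i := scal a A) (f := idfun)). Qed.

Lemma coboundary_components X (P : resolution X) (C : lmodType R) (J : Type)
    (D : J -> lmodType R) (pr : forall j, {linear C -> D j}) i (f : {linear P i -> C}) :
  (forall d : (forall j, D j), exists c, forall j, pr j c = d j) ->
  (forall c, (forall j, pr j c = 0) -> c = 0) ->
  (forall j, coboundary (pr j \o f : {linear P i -> D j})) -> coboundary f.
Proof.
move=> prs pr0; case: i f => [|i] f /= fcob.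
  by move=> x; apply: pr0 => j; exact: fcob.
pose g j := sval (cid (fcob j)); have gE j := svalP (cid (fcob j)).
have [|||h hE] := lin_rel (S := fun x c => forall j, pr j c = g j x).
- by move=> x; exact: prs.
- by move=> x y z yE zE; apply/subr0_eq/pr0 => j; rewrite linearB yE zE subrr.
- by move=> a x y u v uE vE j; rewrite !linearP uE vE.
exists h => x; apply/subr0_eq/pr0 => j.
by rewrite linearB hE -gE subrr.
Qed.

(** Multiplication by [a] is null-homotopic in positive degrees, hence zero on Ext, but it is
    bijective on the factor where [a] is invertible. *)
Lemma Ext_van_split X (P : resolution X) (K : set R) C i :
  projective_resolution P -> split_local K C ->
  (forall a, K a -> exists s : {linear X -> P 0%N}, forall x, res_aug P (s x) = a *: x) ->
  Ext_van P C i.+1.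
Proof.
move=> Pp [J [D [pr [prs pr0 Ka]]]] Ks f fc; apply: (coboundary_components prs pr0) => j.
have [a [Kj aI aS]] := Ka j; have [s sE] := Ks a Kj.
have [sg [_ sgS]] := htpy_scal Pp sE; have [k kE] := scal_inv aI aS.
exists (k \o (pr j \o (f \o sg i))) => x /=.
apply/subr0_eq/aI; rewrite scalerBr kE -!linearZ sgS linearD fc add0r.
by rewrite subrr.
Qed.

(** If K kills X, the lift of [a] is s = 0, so the homotopy has no defect and degree 0 is
    included. *)
Lemma Ext_van_split0 X (P : resolution X) (K : set R) C i :
  projective_resolution P -> split_local K C ->
  (forall a, K a -> forall x : X, a *: x = 0) -> Ext_van P C i.
Proof.
case: i => [|i] Pp CK K0; last first.
  by apply: (Ext_van_split Pp CK) => a Ka; exists (lin0 _ _) => x; rewrite linear0 K0.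
case: CK => J [D [pr [prs pr0 Ka]]] f fc x; apply: pr0 => j.
have [a [Kj aI aS]] := Ka j; apply: aI; rewrite -!linearZ.
have [|sg [sg0 _]] := htpy_scal (s := lin0 X (P 0%N)) Pp (a := a).
  by move=> y; rewrite linear0 K0.
by rewrite sg0 addr0 fc linear0.
Qed.

(** As [y] kills X, it acts as zero on Ext^i(X, A); as Ext^(i-1)(X, D) = 0, it acts injectively. *)
Lemma Ext_van_regular X (P : resolution X) A D (y : R) (p : {linear A -> D}) d :
  projective_resolution P -> (forall x : X, y *: x = 0) -> ses (scal y A) p ->
  (forall i, (i < d)%N -> Ext_van P D i) -> forall i, (i <= d)%N -> Ext_van P A i.
Proof.
move=> Pp yX sy ED i id_ f fc; have [y0 ps ex] := sy.
have [|sg [sg0 sgS]] := htpy_scal (s := lin0 X (P 0%N)) Pp (a := y).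
  by move=> x; rewrite linear0 yX.
case: i f fc id_ => [|i] f fc id_.
  by move=> x; apply: y0; rewrite /scal /= -linearZ sg0 addr0 fc.
apply: (ses_coboundary Pp sy (ED i id_)).
exists (f \o sg i) => x.
by rewrite /scal /= -linearZ sgS linearD fc add0r.
Qed.

Lemma Ext1_lift X (P : resolution X) A B D (i : {linear A -> B}) (p : {linear B -> D}) :
  projective_resolution P -> ses i p -> Ext_van P A 1 ->
  forall f : {linear X -> D}, exists g : {linear X -> B}, forall x, p (g x) = f x.
Proof.
move=> Pp ip EA f; have [i0 ps ex] := ip.
have [f' f'E] := Pp 0%N _ _ p (f \o res_aug P) ps.
have [|c cE] := lin_factor (f := f' \o res_diff P 0%N) i0.
  by move=> x; apply/ex; rewrite /= f'E /= res_augd linear0.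
have /EA[g gE] : cocycle c by move=> x; apply: i0; rewrite cE /= res_dd linear0.
have [|h hE] := lin_quot (f := f' \- (i \o g)) (@res_aug_surj _ _ P).
  by move=> x /res_exact0[z <-]; rewrite /= -gE cE subrr.
exists h => x; have [y <-] := res_aug_surj P x.
by rewrite hE /= linearB f'E (ses_comp0 ip) subr0.
Qed.

Lemma Ext1_extend A B D (i : {linear A -> B}) (p : {linear B -> D})
    (P : resolution D) N : projective_resolution P -> ses i p -> Ext_van P N 1 ->
  forall f : {linear A -> N}, exists g : {linear B -> N}, forall a, g (i a) = f a.
Proof.
move=> Pp ip EN f; have [i0 ps ex] := ip.
have [b bE] := Pp 0%N _ _ p (res_aug P) ps.
have [|c cE] := lin_factor (f := b \o res_diff P 0%N) i0.
  by move=> x; apply/ex; rewrite /= bE res_augd.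
have [|g gE] := EN (f \o c).
  move=> x /=; suff -> : c (res_diff P 1%N x) = 0 by rewrite linear0.
  by apply: i0; rewrite cE /= res_dd linear0.
(* B is the quotient of A + P_0 under [q]; the pair [k] = (f, g) descends because the kernel of [q]
   consists of the pairs (- c z, d z). *)
pose q : {linear (A * P 0%N)%type -> B} := (i \o fst) \+ (b \o snd).
pose k : {linear (A * P 0%N)%type -> N} := (f \o fst) \+ (g \o snd).
have [||h hE] := @lin_quot R _ B N q k.
- move=> y; have [x xE] := res_aug_surj P (p y).
  have [|a aE] := (ex (y - b x)).1; first by rewrite linearB bE xE subrr.
  by exists (a, x); rewrite /q /= aE subrK.
- case=> a x; rewrite /q /k /= => ax.
  have bx : b x = i (- a) by apply/eqP; rewrite linearN -addr_eq0 addrC ax.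
  have /res_exact0[z zE] : res_aug P x = 0 by rewrite -bE bx (ses_comp0 ip).
  have -> : a = - c z.
    apply/subr0_eq/i0; rewrite opprK linearD cE /= zE bx linearN.
    by rewrite subrr.
  by rewrite linearN -zE -gE /= addNr.
by exists h => a; rewrite -[i a]addr0 -[0](linear0 b) -[LHS]/(h (q (a, 0))) hE /k /= linear0 addr0.
Qed.

Lemma inl_linear X Y : linear (fun x => (x, 0) : (X * Y)%type).
Proof. by move=> a x y; congr pair; rewrite /= ?scaler0 ?addr0. Qed.
Definition inl_lin X Y : {linear X -> (X * Y)%type} := lin (@inl_linear X Y).
Lemma inr_linear X Y : linear (fun y => (0, y) : (X * Y)%type).
Proof. by move=> a x y; congr pair; rewrite /= ?scaler0 ?addr0. Qed.
Definition inr_lin X Y : {linear Y -> (X * Y)%type} := lin (@inr_linear X Y).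

Lemma projective_prod X Y : projective X -> projective Y -> projective (X * Y)%type.
Proof.
move=> Xp Yp U V g f gs.
have [h hE] := Xp U V g (f \o inl_lin X Y) gs.
have [k kE] := Yp U V g (f \o inr_lin X Y) gs.
exists ((h \o fst) \+ (k \o snd)) => -[x y] /=.
by rewrite linearD hE kE /= -linearD /=; congr (f (_, _)); rewrite ?addr0 ?add0r.
Qed.

Section Cone.
Variables (A B D : lmodType R) (i : {linear A -> B}) (p : {linear B -> D}).
Variables (P : resolution A) (Q : resolution B) (phi : forall j, {linear P j -> Q j}).
Hypothesis ip : ses i p.
Hypothesis phi0 : forall x, res_aug Q (phi 0%N x) = i (res_aug P x).
Hypothesis phiS : forall j x, res_diff Q j (phi j.+1 x) = phi j (res_diff P j x).

(** The mapping cone of a lift of [i] resolves the cokernel D, since [i] is injective. It yields the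
    long exact sequence in the first argument. *)
Definition cone_mod (j : nat) : lmodType R :=
  match j with 0%N => Q 0%N | j.+1 => (P j * Q j.+1)%type end.

Lemma cone_diff_linear j : linear (fun x : (P j.+1 * Q j.+2)%type =>
  (- res_diff P j x.1, phi j.+1 x.1 + res_diff Q j.+1 x.2)).
Proof.
move=> a [x1 x2] [y1 y2] /=; congr pair; rewrite /= !linearP ?scalerN //.
by rewrite scalerDr addrACA.
Qed.

Definition cone_diff j : {linear cone_mod j.+1 -> cone_mod j} :=
  match j with
  | 0%N => (phi 0%N \o fst) \+ (res_diff Q 0%N \o snd)
  | j.+1 => lin (@cone_diff_linear j)
  end.

Definition cone_aug : {linear cone_mod 0%N -> D} := p \o res_aug Q.

Lemma cone_aug_surj x : exists y, cone_aug y = x.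
Proof.
have [_ ps _] := ip; have [b <-] := ps x; have [y <-] := res_aug_surj Q b.
by exists y.
Qed.

Lemma cone_exact0 y : cone_aug y = 0 <-> exists z, cone_diff 0 z = y.
Proof.
rewrite /cone_aug /=; split=> [|[[x z] <-]] /=; last first.
  by rewrite linearD phi0 res_augd addr0 (ses_comp0 ip).
have [_ _ ex] := ip => /ex[a ay]; have [x xa] := res_aug_surj P a.
have /res_exact0[z zE] : res_aug Q (y - phi 0%N x) = 0.
  by rewrite linearB phi0 xa ay subrr.
by exists (x, z); rewrite /= zE addrC subrK.
Qed.

Lemma cone_exact j y : cone_diff j y = 0 <-> exists z, cone_diff j.+1 z = y.
Proof.
case: j y => [|j] [x y]; last first.
  split=> /= [[/eqP]|[[u v] [<- <-]]]; last first.
    by rewrite linearN res_dd oppr0 linearN linearD phiS res_dd addr0 addNr oppr0.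
  rewrite oppr_eq0 => /eqP/res_exact[u <-]; rewrite -phiS -linearD.
  move=> /res_exact[v vE]; exists (- u, v); congr pair; rewrite /= linearN ?opprK //.
  by rewrite vE addKr.
split=> /= [xy|[[u v] [<- <-]]]; last first.
  by rewrite linearN linearD phiS res_dd addr0 addNr.
have [i0 _ _] := ip.
have /res_exact0[u uE] : res_aug P x = 0.
  by apply: i0; rewrite -phi0 -[phi 0%N x](addrK (res_diff Q 0%N y)) xy linearB res_augd linear0 subr0.
have : res_diff Q 0%N (phi 1%N u + y) = 0 by rewrite linearD phiS uE.
move=> /res_exact[v vE]; exists (- u, v); congr pair; rewrite /= linearN ?opprK //.
by rewrite vE addKr.
Qed.

Definition cone : resolution D :=
  Resolution cone_aug_surj cone_exact0 cone_exact.

Lemma cone_projective :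
  projective_resolution P -> projective_resolution Q -> projective_resolution cone.
Proof.
move=> Pp Qp [|j]; first exact: Qp.
exact: projective_prod.
Qed.

Lemma cone_cochain N j (f : {linear cone j.+1 -> N}) x y :
  f (x, y) = (f \o inl_lin (P j) (Q j.+1)) x + (f \o inr_lin (P j) (Q j.+1)) y.
Proof. by rewrite /= -linearD /=; congr (f (_, _)); rewrite ?addr0 ?add0r. Qed.

(** The restriction of [f] to the summand from [Q] is a cocycle, bounded by some [g]; what [g] does
    not account for is a cocycle on [P]. *)
Lemma cone_cocycle N j (f : {linear cone j.+1 -> N}) : Ext_van Q N j.+1 -> cocycle f ->
  exists g : {linear Q j -> N}, exists2 e : {linear P j -> N}, cocycle e &
    forall x y, f (x, y) = e x + g (phi j x + res_diff Q j y).
Proof.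
move=> EB fc.
pose fA : {linear P j -> N} := f \o inl_lin (P j) (Q j.+1).
pose fB : {linear Q j.+1 -> N} := f \o inr_lin (P j) (Q j.+1).
have fE x y : f (x, y) = fA x + fB y := cone_cochain f x y.
have [y|g gE] := EB fB.
  rewrite -(fc (0, y)) /fB /=; congr (f (_, _)); first by rewrite linear0 oppr0.
  by rewrite linear0 add0r.
exists g, (fA \- (g \o phi j)) => [x|x y] /=; last first.
  by rewrite linearD addrA subrK -gE; exact: fE.
have := fc (x, 0); rewrite /= linear0 addr0 fE gE phiS linearN.
by move/eqP; rewrite addrC subr_eq0 => /eqP ->; rewrite subrr.
Qed.

(** In degree 1 the remaining cocycle on [P] is a map A -> N, which need not vanish; its extension
    to B absorbs it. *)
Lemma Ext_van_cone1 N : Ext_van Q N 1 ->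
  (forall f : {linear A -> N}, exists g : {linear B -> N}, forall a, g (i a) = f a) ->
  Ext_van cone N 1.
Proof.
move=> EB ext f /(cone_cocycle EB)[g [e ec fE]].
have [|h hE] := lin_quot (f := e) (@res_aug_surj _ _ P).
  by move=> x /res_exact0[z <-].
have [k kE] := ext h.
exists (g \+ (k \o res_aug Q)) => -[x y] /=.
by rewrite fE [res_aug Q _]linearD phi0 res_augd addr0 kE hE addrC.
Qed.

Lemma Ext_van_cone N j : Ext_van P N j.+1 -> Ext_van Q N j.+2 -> Ext_van cone N j.+2.
Proof.
move=> EA EB f /(cone_cocycle EB)[g [e /EA[h hE] fE]].
exists (((\- h) \o fst) \+ (g \o snd) : {linear (P j * Q j.+1)%type -> N}) => -[x y] /=.
by rewrite fE hE linearN opprK.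
Qed.

(** A cocycle of [P] extended by zero is a cocycle of the cone. The part of its bounding cochain on
    [Q] is again a cocycle, and bounding that part corrects the part on [P]. *)
Lemma Ext_van_cone_first N j :
  Ext_van cone N j.+2 -> Ext_van Q N j.+1 -> Ext_van P N j.+1.
Proof.
move=> EC EB f fc.
have [x|G GE] := EC (f \o fst : {linear (P j.+1 * Q j.+2)%type -> N}).
  by case: x => x y /=; rewrite linearN fc oppr0.
pose GA : {linear P j -> N} := G \o inl_lin (P j) (Q j.+1).
pose GB : {linear Q j.+1 -> N} := G \o inr_lin (P j) (Q j.+1).
have [y|h hE] := EB GB.
  have := GE (0, y); rewrite /= linear0 => /esym; apply: etrans.
  by rewrite /GB /=; congr (G (_, _)); rewrite linear0 ?oppr0 ?add0r.
exists ((h \o phi j) \- GA) => x /=.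
have := GE (x, 0); rewrite /= => ->.
rewrite [LHS]cone_cochain -[X in _ + X]/(GB _) hE linear0 addr0 phiS.
by rewrite -[X in X + _]/(GA _) linearN addrC.
Qed.

End Cone.

Lemma Ext_eq0_ses_third A B D (i : {linear A -> B}) (p : {linear B -> D})
    (P : resolution A) (Q : resolution B) N :
  projective_resolution P -> projective_resolution Q -> ses i p ->
  (forall f : {linear A -> N}, exists g : {linear B -> N}, forall a, g (i a) = f a) ->
  (forall j, Ext_van P N j.+1) -> (forall j, Ext_van Q N j.+1) ->
  forall j, Ext_eq0 D N j.+1.
Proof.
move=> Pp Qp ip ext EP EQ j; have [phi [phi0 phiS]] := chain_lift Q i Pp.
exists (cone ip phi0 phiS); split; first exact: cone_projective.
by case: j => [|j]; [apply: Ext_van_cone1 | apply: Ext_van_cone].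
Qed.

Lemma Ext_van_ses_left A B D (i : {linear A -> B}) (p : {linear B -> D})
    (P : resolution A) (Q : resolution B) N :
  projective_resolution P -> projective_resolution Q -> ses i p ->
  (forall j, Ext_eq0 D N j.+1) -> (forall j, Ext_van Q N j.+1) ->
  forall j, Ext_van P N j.+1.
Proof.
move=> Pp Qp ip ED EQ j; have [phi [phi0 phiS]] := chain_lift Q i Pp.
apply: (Ext_van_cone_first (phi := phi) (ip := ip) (phi0 := phi0) (phiS := phiS)) => //.
by apply: Ext_van_of_eq0 => //; apply: cone_projective.
Qed.

End ExtVanishing.

(** * Hom modules and multiples of the identity that factor through free modules *)

Section HomModules.
Variable R : comNzRingType.
Implicit Types A B C D F N X Y Z : lmodType R.

Lemma lin_homset X A (f : {linear X -> A}) : (f : X -> A) \in @homset R X A.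
Proof. by apply/asboolP => a x y; rewrite linearP. Qed.
Definition homL X A (f : {linear X -> A}) : homR X A := HomR (lin_homset f).

Lemma homR_ext X A (f g : homR X A) : (forall x, f x = g x) -> f = g.
Proof. by move=> fg; apply: val_inj; apply: funext. Qed.
Lemma homRD X A (f g : homR X A) x : (f + g) x = f x + g x.
Proof. by []. Qed.
Lemma homRZ X A a (f : homR X A) x : (a *: f) x = a *: f x.
Proof. by []. Qed.
Lemma homR0 X A x : (0 : homR X A) x = 0.
Proof. by []. Qed.
Lemma homR_sum X A I (r : seq I) (F : I -> homR X A) x :
  (\sum_(i <- r) F i) x = \sum_(i <- r) F i x.
Proof. by elim/big_rec2: _ => // i u v _ <-; rewrite homRD. Qed.

Lemma hom_post_linear X A B (u : {linear A -> B}) :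
  linear (fun f : homR X A => homL (u \o f : {linear X -> B})).
Proof. by move=> a f g; apply: homR_ext => x /=; rewrite linearP. Qed.
Definition hom_post X A B (u : {linear A -> B}) : {linear homR X A -> homR X B} :=
  lin (hom_post_linear u).

Lemma hom_pre_linear X Y A (u : {linear X -> Y}) :
  linear (fun f : homR Y A => homL (f \o u : {linear X -> A})).
Proof. by move=> a f g; apply: homR_ext => x. Qed.
Definition hom_pre X Y A (u : {linear X -> Y}) : {linear homR Y A -> homR X A} :=
  lin (hom_pre_linear u).

Definition ev_lin X A (x : X) : {linear homR X A -> A} :=
  lin (f := fun f : homR X A => f x) (fun a f g => erefl).

Lemma ses_hom X A B D (i : {linear A -> B}) (p : {linear B -> D}) : ses i p ->
  (forall f : {linear X -> D}, exists g : {linear X -> B}, forall x, p (g x) = f x) ->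
  ses (hom_post X i) (hom_post X p).
Proof.
move=> ip lft; have [i0 ps ex] := ip; split=> [f f0|f|f].
- apply: homR_ext => x; apply: i0.
  by rewrite -[LHS]/(hom_post X i f x) f0.
- by have [g gE] := lft f; exists (homL g); apply: homR_ext => x; rewrite /= gE.
- split=> [f0|[g <-]]; last by apply: homR_ext => x /=; rewrite (ses_comp0 ip).
  have [|g gE] := lin_factor (f := (f : {linear X -> B})) i0.
    by move=> x; apply/ex; rewrite -[LHS]/(hom_post X p f x) f0.
  by exists (homL g); apply: homR_ext => x; rewrite /= gE.
Qed.

Lemma split_local_hom X (K : set R) C : split_local K C -> split_local K (homR X C).
Proof.
case=> J [D [pr [prs pr0 Ka]]].
exists J, (fun j => homR X (D j)), (fun j => hom_post X (pr j)); split=> [d|c c0|j].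
- have [|||h hE] := lin_rel (S := fun x c => forall j, pr j c = d j x).
  + by move=> x; exact: prs.
  + by move=> x y z yE zE; apply/subr0_eq/pr0 => j; rewrite linearB yE zE subrr.
  + by move=> a x y u v uE vE j; rewrite !linearP uE vE.
  by exists (homL h) => j; apply: homR_ext => x; rewrite /= hE.
- apply: homR_ext => x; apply: pr0 => j.
  by rewrite -[LHS]/(hom_post X (pr j) c x) c0.
- have [a [Kj aI aS]] := Ka j; exists a; split=> // u.
    by move=> au0; apply: homR_ext => x; apply: aI; rewrite -homRZ au0.
  have [k kE] := scal_inv aI aS.
  by exists (hom_post X k u); apply: homR_ext => x; rewrite homRZ /= kE.
Qed.

(** For a = 1 this is the dual basis criterion for finitely generated projective modules, so
    [traced 1 F] serves as the notion of a finite projective F. *)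
Definition traced (a : R) X : Prop :=
  exists n (e : 'I_n -> X) (h : 'I_n -> dual X),
    forall x, a *: x = \sum_i (h i x : R) *: e i.

Lemma lincomb_linear X A n (h : 'I_n -> dual X) (e : 'I_n -> A) :
  linear (fun x => \sum_i (h i x : R) *: e i).
Proof.
move=> a x y; rewrite scaler_sumr -big_split /=; apply: eq_bigr => i _.
by rewrite linearP scalerDl scalerA.
Qed.
Definition lincomb X A n (h : 'I_n -> dual X) (e : 'I_n -> A) : {linear X -> A} :=
  lin (lincomb_linear h e).

Lemma traced_lift a X B D (p : {linear B -> D}) (f : {linear X -> D}) : traced a X ->
  (forall d, exists b, p b = d) ->
  exists g : {linear X -> B}, forall x, p (g x) = a *: f x.
Proof.
case=> n [e [h eh]] ps; have /boolp.choice[c cE] i := ps (f (e i)).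
exists (lincomb h c) => x /=; rewrite -linearZZ eh !linear_sum.
by apply: eq_bigr => i _; rewrite !linearZZ cE.
Qed.

Lemma traced1_projective F : traced 1 F -> projective F.
Proof.
move=> F1 A B g f gs; have [h hE] := traced_lift f F1 gs.
by exists h => x; rewrite hE scale1r.
Qed.

Lemma tracedM a b X : traced a X -> traced (b * a) X.
Proof.
case=> n [e [h eh]]; exists n, (fun i => b *: e i), h => x.
by rewrite -scalerA eh scaler_sumr; apply: eq_bigr => i _; rewrite !scalerA mulrC.
Qed.

Lemma traced_dual a X : traced a X -> traced a (dual X).
Proof.
case=> n [e [h eh]]; exists n, h, (fun i => bidual_map (e i)) => f.
apply: homR_ext => x; rewrite homRZ -linearZZ eh linear_sum homR_sum.
by apply: eq_bigr => i _; rewrite linearZZ homRZ; exact: mulrC.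
Qed.

(** If [s] lifts a * id_X to F, then a * id_F - s p has values in Z and gives r : F -> Z with r i =
    a * id_Z. *)
Lemma traced_ses a Z F X (i : {linear Z -> F}) (p : {linear F -> X}) :
  ses i p -> traced 1 F -> traced a X -> traced a Z.
Proof.
move=> ip [n [e [h eh]]] Xa; have [i0 ps ex] := ip.
have [s sE] := traced_lift (idfun : {linear X -> X}) Xa ps.
have [|r rE] := lin_factor (f := scal a F \- (s \o p)) i0.
  by move=> x; apply/ex; rewrite /scal /= linearB linearZZ sE subrr.
exists n, (fun j => r (e j)), (fun j => hom_pre R^o i (h j)) => z.
have -> : a *: z = r (i z).
  apply/subr0_eq/i0; rewrite linearB linearZZ rE /scal /=.
  by rewrite (ses_comp0 ip) linear0 subr0 subrr.
rewrite -{1}[i z]scale1r eh linear_sum; apply: eq_bigr => j _.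
by rewrite linearZZ.
Qed.

Lemma reflexiveP X : reflexive_module X <->
  (forall x, (forall f : dual X, f x = 0) -> x = 0) /\
  (forall Phi : dual (dual X), exists x, forall f, Phi f = f x).
Proof.
split=> [[g gK Kg]|[inj surj]].
  split=> [x x0|Phi]; last by exists (g Phi) => f; rewrite -{1}(Kg Phi).
  rewrite -(gK x) -(gK 0); congr g; apply: homR_ext => f /=.
  by rewrite x0 linear0.
have /boolp.choice[g gE] := surj; exists g => [x|Phi].
  apply/subr0_eq/inj => f; rewrite linearB; apply/eqP; rewrite subr_eq0; apply/eqP.
  exact/esym/(gE (bidual_map x) f).
by apply: homR_ext => f; exact/esym/gE.
Qed.

Lemma traced_bidual a X (Phi : dual (dual X)) : traced a X ->
  exists x, forall f, a *: Phi f = f x.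
Proof.
case=> n [e [h eh]]; exists (\sum_i (Phi (h i) : R) *: e i) => f.
have -> : a *: Phi f = Phi (\sum_i (f (e i) : R) *: h i).
  rewrite -linearZZ; congr (Phi _); apply: homR_ext => x.
  rewrite homRZ -linearZZ eh linear_sum homR_sum.
  by apply: eq_bigr => i _; rewrite linearZZ homRZ; exact: mulrC.
rewrite !linear_sum; apply: eq_bigr => i _.
by rewrite !linearZZ; exact: mulrC.
Qed.

Lemma traced_separated a X x : traced a X -> (forall f : dual X, f x = 0) -> a *: x = 0.
Proof.
by case=> n [e [h eh]] x0; rewrite eh big1 // => i _; rewrite x0 scale0r.
Qed.

Lemma traced1_reflexive F : traced 1 F -> reflexive_module F.
Proof.
move=> F1; apply/reflexiveP; split=> [x /(traced_separated F1)|Phi].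
  by rewrite scale1r.
by have [x xE] := traced_bidual Phi F1; exists x => f; rewrite -xE scale1r.
Qed.

Lemma Ext_van_traced1 X (P : resolution X) F i :
  traced 1 F -> Ext_van P R^o i -> Ext_van P F i.
Proof.
case=> n [e [h eh]] EP f fc.
have hf j : coboundary (h j \o f : {linear P i -> R^o}).
  by apply: EP => x; rewrite /= fc linear0.
case: i f fc hf {EP} => [|i] f fc hf /=.
  by move=> x; rewrite -[f x]scale1r eh big1 // => j _; rewrite [h j _]hf scale0r.
have /boolp.choice[g gE] := hf.
exists (lincomb (fun j => homL (g j)) e) => x.
by rewrite -[f x]scale1r eh; apply: eq_bigr => j _; rewrite -[_ (f x)]/((h j \o f) x) gE.
Qed.

End HomModules.

(** * Finitely generated modules over Noetherian local rings *)

Section FiniteGeneration.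
Variable R : comNzRingType.
Implicit Types A B X : lmodType R.

(** Recursion on the list allows generators to be removed one at a time, as in the Noetherian and
    Nakayama inductions. *)
Fixpoint spanl A (s : seq A) (x : A) : Prop :=
  if s is v :: s' then exists a, spanl s' (x - a *: v) else x = 0.

Lemma spanl_submodule A (s : seq A) : submodule (spanl s).
Proof.
elim: s => [|v s [IH0 IHL]] /=; first by split=> // a x y -> ->; rewrite scaler0 addr0.
split=> [|a x y [b xb] [c yc]]; first by exists 0; rewrite scale0r subr0.
exists (a * b + c); rewrite scalerDl -scalerA opprD addrACA -scalerBr.
exact: IHL.
Qed.

Lemma spanl_cons A v (s : seq A) x : spanl s x -> spanl (v :: s) x.
Proof. by move=> sx; exists 0; rewrite scale0r subr0. Qed.

Lemma spanl_mem A (s : seq A) v : v \in s -> spanl s v.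
Proof.
elim: s => // w s IH; rewrite inE => /predU1P[->|/IH]; last exact: spanl_cons.
by exists 1; rewrite scale1r subrr; case: (spanl_submodule s).
Qed.

Lemma spanl_min A (s : seq A) (S : set A) : submodule S -> (forall v, v \in s -> S v) ->
  forall x, spanl s x -> S x.
Proof.
move=> Ssub; elim: s => [|v s IH] Sv x /=; first by move=> ->; case: Ssub.
case=> a xa; rewrite -[x](subrK (a *: v)); apply: (submoduleD Ssub).
  by apply: IH => // w ws; apply: Sv; rewrite inE ws orbT.
by apply: submoduleZ => //; apply: Sv; rewrite inE eqxx.
Qed.

Lemma spanl_in_span A (s : seq A) x : in_span [set b | b \in s]%classic x -> spanl s x.
Proof.
case=> r [c [rs ->]]; apply: (submodule_sum (spanl_submodule s)) => b br.
by apply: (submoduleZ (spanl_submodule s)); apply: spanl_mem; exact: rs.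
Qed.

Lemma spanl_coef A (s : seq A) x : spanl s x ->
  exists c : nat -> R, x = \sum_(i < size s) c i *: nth 0 s i.
Proof.
elim: s x => [|v s IH] x /=; first by move=> ->; exists (fun=> 0); rewrite big_ord0.
case=> a /IH[c xE]; exists (fun i => if i is j.+1 then c j else a).
by rewrite big_ord_recl /= -xE addrC subrK.
Qed.

Definition fg A : Prop := exists s : seq A, forall x, spanl s x.

Lemma fg_fin_gen A : fin_gen A -> fg A.
Proof. by case=> s sA; exists s => x; apply: spanl_in_span. Qed.

Lemma spanl_map A B (f : {linear A -> B}) (s : seq A) x :
  spanl s x -> spanl (map f s) (f x).
Proof.
elim: s x => [|v s IH] x /=; first by move=> ->; rewrite linear0.
by case=> c /IH; rewrite linearB linearZZ => h; exists c.
Qed.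

Lemma spanl_sub A (s r : seq A) x : {subset s <= r} -> spanl s x -> spanl r x.
Proof.
move=> sr; apply: spanl_min => [|v /sr]; [exact: spanl_submodule | exact: spanl_mem].
Qed.

Lemma fg_surj A B (f : {linear A -> B}) : (forall b, exists a, f a = b) -> fg A -> fg B.
Proof.
by move=> fs [s sA]; exists (map f s) => b; have [a <-] := fs b; apply: spanl_map.
Qed.

Lemma fg_prod A B : fg A -> fg B -> fg (A * B)%type.
Proof.
move=> [s sA] [r rB]; exists (map (inl_lin A B) s ++ map (inr_lin A B) r) => -[x y].
have -> : (x, y) = inl_lin A B x + inr_lin A B y.
  by congr pair; rewrite /= ?addr0 ?add0r.
apply: (submoduleD (spanl_submodule _)).
  by apply: spanl_sub (spanl_map _ (sA x)) => v; rewrite mem_cat => ->.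
by apply: spanl_sub (spanl_map _ (rB y)) => v; rewrite mem_cat orbC => ->.
Qed.

Lemma rV_linear A n (e : 'I_n -> A) : linear (fun u : 'rV[R]_n => \sum_i u 0 i *: e i).
Proof.
move=> a u v; rewrite scaler_sumr -big_split /=; apply: eq_bigr => i _.
by rewrite !mxE scalerDl scalerA.
Qed.
Definition rV_lin A n (e : 'I_n -> A) : {linear 'rV[R]_n -> A} := lin (rV_linear e).

Lemma fg_cover A : fg A -> exists n, exists f : {linear 'rV[R]_n -> A},
  forall x, exists u, f u = x.
Proof.
case=> s sA; exists (size s), (rV_lin (fun i : 'I_(size s) => nth 0 s i)) => x.
have [c ->] := spanl_coef (sA x); exists (\row_i c i) => /=.
by apply: eq_bigr => i _; rewrite mxE.
Qed.

Lemma coord_linear n (i : 'I_n) : linear (fun u : 'rV[R]_n => u 0 i : R^o).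
Proof. by move=> a u v; rewrite !mxE. Qed.

Lemma traced1_rV n : traced 1 ('rV[R]_n : lmodType R).
Proof.
exists n, (fun i => delta_mx 0 i), (fun i => homL (lin (coord_linear i))) => x.
by rewrite scale1r {1}[x]row_sum_delta.
Qed.

Lemma fg_traced1 A : traced 1 A -> fg A.
Proof.
case=> n [e [h eh]]; exists (map e (enum 'I_n)) => x.
rewrite -[x]scale1r eh; apply: (submodule_sum (spanl_submodule _)) => i _.
by apply: (submoduleZ (spanl_submodule _)); apply/spanl_mem/map_f; rewrite mem_enum.
Qed.

Hypothesis R_noeth : noetherian R.

Lemma noetherian_ideal (I : set R^o) : submodule I ->
  exists s : seq R^o, forall x, I x <-> spanl s x.
Proof.
move=> Isub; have [s sE] := R_noeth (sub_pred_closed Isub); exists s => x; split.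
  by move=> Ix; apply/spanl_in_span/sE/asboolP.
apply: spanl_min => // v vs; apply/asboolP/sE.
exists [:: v], (fun=> 1); split=> [b|]; first by rewrite inE => /eqP ->.
by rewrite big_seq1 scale1r.
Qed.

(** Induction on the generators: the coefficients of [v] in elements of S form an ideal, finitely
    generated by [r]. Lifts of its generators reduce any element of S to one in the span of the
    remaining generators. *)
Lemma noetherian_spanl A (s : seq A) (S : set A) : submodule S ->
  (forall x, S x -> spanl s x) ->
  exists2 ws : seq A, (forall w, w \in ws -> S w) & forall x, S x -> spanl ws x.
Proof.
elim: s S => [|v s IH] S Ssub Ss; first by exists [::].
have [sS0 sSL] := spanl_submodule s.
pose I : set R^o := fun a => exists2 x, spanl s x & S (a *: v + x).
have Isub : submodule I.
  split; first by exists 0; rewrite // scale0r addr0; case: Ssub.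
  move=> a b c [x xs Sx] [y ys Sy]; exists (a *: x + y); first exact: sSL.
  rewrite scalerDl -scalerA addrACA -scalerDr; case: Ssub => _; exact.
have [r rE] := noetherian_ideal Isub.
have [x rx] : exists x : R^o -> A, forall a, a \in r -> spanl s (x a) /\ S (a *: v + x a).
  have /boolp.choice[x xP] a : exists x, a \in r -> spanl s x /\ S (a *: v + x).
    have [ar|] := boolP (a \in r); last by exists 0.
    by have [x xs Sx] := (rE a).2 (spanl_mem ar); exists x.
  by exists x.
pose S' : set A := fun x => S x /\ spanl s x.
have S'sub : submodule S'.
  split=> [|a u w [Su us] [Sw ws]]; first by split => //; case: Ssub.
  by split; [case: Ssub => _; apply | apply: sSL].
have [ws wS' S'w] := IH S' S'sub (fun u (h : S' u) => proj2 h).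
pose t := [seq (a *: v + x a) | a <- r] ++ ws.
have tsub := spanl_submodule t.
exists t => [w|y Sy].
  by rewrite mem_cat => /orP[/mapP[a /rx[_ ?] ->]|/wS'[]].
have [a ya] : spanl (v :: s) y := Ss y Sy.
have Ia : I a by exists (y - a *: v); rewrite // addrC subrK.
(* An element of S generated by [t] with the same coefficient [a] at [v] as [y]; subtracting it from
   [y] leaves an element of [S']. *)
have [z zs [tz]] : exists2 z, spanl s z & spanl t (a *: v + z) /\ S (a *: v + z).
  pose T : set R^o := fun a => exists2 z, spanl s z & spanl t (a *: v + z) /\ S (a *: v + z).
  apply: (@spanl_min _ r T) ((rE a).1 Ia).
    split; first by exists 0 => //; rewrite scale0r addr0; split; [case: tsub | case: Ssub].
    move=> b c d [z zs [tz Sz]] [u us [tu Su]]; exists (b *: z + u); first exact: sSL.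
    rewrite scalerDl -scalerA addrACA -scalerDr.
    by split; [case: tsub => _; apply | case: Ssub => _; apply].
  move=> b br; have [xs Sx] := rx b br; exists (x b) => //; split=> //.
  by apply: spanl_mem; rewrite mem_cat; apply/orP; left; apply/mapP; exists b.
move=> Sz; rewrite -[y](subrK (a *: v + z)); apply: (submoduleD tsub) => //.
have /S'w : S' (y - (a *: v + z)).
  split; first exact: submoduleB.
  by rewrite opprD addrA; apply: submoduleB.
apply: spanl_min tsub _ _ => w ww; apply: spanl_mem.
by rewrite mem_cat ww orbT.
Qed.

Lemma fg_inj A B (i : {linear A -> B}) : (forall a, i a = 0 -> a = 0) -> fg B -> fg A.
Proof.
move=> i0 [s sB].
have [ws wA Aw] := noetherian_spanl (im_submodule i) (fun x _ => sB x).
have /boolp.choice[r rE] w : exists a, w \in ws -> i a = w.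
  by have [/wA[a <-]|] := boolP (w \in ws); [exists a | exists 0].
exists (map r ws) => x; have := Aw (i x) (ex_intro _ x erefl).
elim: ws x rE {wA Aw} => [|w ws IH] x rE /=; first exact: i0.
case=> a aE; exists a; apply: IH => [u uws|]; first by apply: rE; rewrite inE uws orbT.
by rewrite linearB linearZZ rE ?inE ?eqxx.
Qed.

Lemma fg_subm A (S : set A) (Ssub : submodule S) : fg A -> fg (subm Ssub).
Proof. by apply: fg_inj; exact: subm_inc_inj. Qed.

Lemma fg_dual A : fg A -> fg (dual A).
Proof.
move=> Afg; have [n [f fs]] := fg_cover Afg.
apply: (@fg_inj _ _ (hom_pre R^o f)).
  move=> g g0; apply: homR_ext => x; have [u <-] := fs x.
  by rewrite -[LHS]/(hom_pre R^o f g u) g0.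
by apply/fg_traced1/traced_dual/traced1_rV.
Qed.

(** Bundling finite generation makes the syzygy an endofunction, so that it can be iterated. *)
Definition fgmod := {X : lmodType R | fg X}.
Implicit Types M : fgmod.

Definition cover_rank M : nat := sval (cid (fg_cover (svalP M))).
Definition cover_map M : {linear 'rV[R]_(cover_rank M) -> sval M} :=
  sval (cid (svalP (cid (fg_cover (svalP M))))).
Lemma cover_map_surj M x : exists u, cover_map M u = x.
Proof. exact: (svalP (cid (svalP (cid (fg_cover (svalP M)))))). Qed.

Lemma syz1_fg M : fg (subm (ker_submodule (cover_map M))).
Proof. by apply/fg_subm/fg_traced1/traced1_rV. Qed.
Definition syz1 M : fgmod := exist _ _ (syz1_fg M).
Definition syz_inc M : {linear sval (syz1 M) -> 'rV[R]_(cover_rank M)} := subm_inc _.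

Lemma syz_ses M : ses (syz_inc M) (cover_map M).
Proof. exact: (ses_ker (cover_map_surj (M := M))). Qed.

Definition syz M i := iter i syz1 M.

Definition syz_diff M i :
  {linear 'rV[R]_(cover_rank (syz M i.+1)) -> 'rV[R]_(cover_rank (syz M i))} :=
  syz_inc (syz M i) \o cover_map (syz M i.+1).

Lemma syz_exact0 M y : cover_map M y = 0 <-> exists z, syz_diff M 0 z = y.
Proof.
have [_ _ ex] := syz_ses M; split=> [/ex[z <-]|[z <-]]; last by apply/ex; eexists.
by have [u <-] := cover_map_surj z; exists u.
Qed.

Lemma syz_exact M i y : syz_diff M i y = 0 <-> exists z, syz_diff M i.+1 z = y.
Proof.
have [i0 _ _] := syz_ses (syz M i).
rewrite -(syz_exact0 (M := syz M i.+1)); split=> [y0|y0]; first exact: i0.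
by rewrite -[LHS]/(syz_inc (syz M i) (cover_map (syz M i.+1) y)) y0 linear0.
Qed.

Definition syz_res M : resolution (sval M) :=
  @Resolution R (sval M) (fun i => 'rV[R]_(cover_rank (syz M i)))
    (syz_diff M) (cover_map M) (cover_map_surj (M := M)) (@syz_exact0 M) (@syz_exact M).

Lemma syz_res_projective M : projective_resolution (syz_res M).
Proof. by move=> i; apply/traced1_projective/traced1_rV. Qed.

Lemma Ext_van_syz M A i :
  (forall f : {linear sval (syz M i.+1) -> A},
     exists g : {linear 'rV[R]_(cover_rank (syz M i)) -> A},
     forall z, g (syz_inc (syz M i) z) = f z) ->
  Ext_van (syz_res M) A i.+1.
Proof.
move=> ext f fc; have [|f' f'E] := lin_quot (f := f) (cover_map_surj (M := syz M i.+1)).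
  by move=> x /(syz_exact0 (M := syz M i.+1))[z <-]; apply: fc.
by have [g gE] := ext f'; exists g => x; rewrite -f'E -gE.
Qed.

End FiniteGeneration.

(** * Units, associated primes, Nakayama's lemma and socles *)

Section LocalAlgebra.
Variable R : comNzRingType.
Implicit Types A L N : lmodType R.

Definition mk_idealr (S : R -> bool) (Scl : idealr_closed S) : idealr R :=
  HB.pack S (isIdealr.Build R S Scl).

Definition mk_prime_idealr (S : R -> bool) (Scl : idealr_closed S)
    (Spr : prime_idealr_closed S) : prime_idealr R :=
  HB.pack S (isIdealr.Build R S Scl) (isPrimeIdealrClosed.Build R S Spr).

Lemma submodule_idealr_closed (I : set R^o) : submodule I -> ~ I 1 ->
  idealr_closed (fun x : R => `[< I x >]).
Proof.
move=> Isub I1; split; first by apply/asboolP; case: Isub.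
  by apply/asboolP.
by move=> a x y /asboolP Ix /asboolP Iy; apply/asboolP; case: Isub => _; apply.
Qed.

Hypothesis R_noeth : noetherian R.

(** P need not be stable under unions. The union of a chain is finitely generated, its generators
    lie in one member, and that member is already an upper bound. *)
Lemma noetherian_max (P : set R^o -> Prop) (I0 : set R^o) :
  (forall I, P I -> submodule I) -> P I0 ->
  exists I : set R^o, [/\ P I, forall x, I0 x -> I x
    & forall J : set R^o, P J -> (forall x, I x -> J x) -> forall x, J x -> I x].
Proof.
move=> Psub P0; pose T := {I : set R^o | P I /\ forall x, I0 x -> I x}.
pose Rl (I J : T) : bool := `[< forall x, sval I x -> sval J x >].
have t0 : T by exists I0.
have [||F totF|I Imax] := @ZL_preorder T t0 Rl.
- by move=> I; apply/asboolP.
- by move=> J I K /asboolP IJ /asboolP JK; apply/asboolP => x /IJ/JK.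
- have [[I1 FI1]|F0] := pselect (exists I, F I); last first.
    by exists t0 => s Fs; case: F0; exists s.
  pose U : set R^o := fun x => exists2 I, F I & sval I x.
  have sub (I : T) : submodule (sval I) by apply: Psub; case: (svalP I).
  have Usub : submodule U.
    split; first by exists I1 => //; case: (sub I1).
    move=> a x y [I FI Ix] [J FJ Jy].
    have [/asboolP IJ|/asboolP JI] := totF I J FI FJ.
      by exists J => //; case: (sub J) => _; apply=> //; apply: IJ.
    by exists I => //; case: (sub I) => _; apply=> //; apply: JI.
  have [r rE] := noetherian_ideal R_noeth Usub.
  have [I FI Ir] : exists2 I, F I & forall b, b \in r -> sval I b.
    have: forall b, b \in r -> U b by move=> b /spanl_mem/rE.
    elim: (r) => [|b q IH] Uq; first by exists I1.
    have [c cq|I FI Iq] := IH; first by apply: Uq; rewrite inE cq orbT.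
    have [J FJ Jb] := Uq b (mem_head b q).
    have [/asboolP IJ|/asboolP JI] := totF I J FI FJ.
      by exists J => // c /[!inE]/predU1P[-> //|/Iq/IJ].
    by exists I => // c /[!inE]/predU1P[->|/Iq//]; apply: JI.
  exists I => J FJ; apply/asboolP => x Jx.
  by apply: (spanl_min (sub I) Ir); apply/rE; exists J.
case: (svalP I) => PI I0I; exists (sval I); split=> // J PJ IJ.
have J0 : P J /\ forall x, I0 x -> J x by split=> // x /I0I/IJ.
pose J' : T := exist _ J J0.
have IJ' : Rl I J' by apply/asboolP.
by have /asboolP := Imax J' IJ'.
Qed.

Variable m : idealr R.
Hypothesis R_local : local_ring m.

Lemma local_unit u : u \notin m -> exists v, v * u = 1.
Proof.
move=> um; apply: contrapT => u1.
pose P (I : set R^o) := submodule I /\ ~ I 1.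
have P0 : P (spanl [:: (u : R^o)]).
  split; first exact: spanl_submodule.
  by case=> a /= /subr0_eq ua; apply: u1; exists a; rewrite ua.
have [I [[Isub I1] uI Imax]] := noetherian_max (fun I (h : P I) => proj1 h) P0.
pose J := mk_idealr (submodule_idealr_closed Isub I1).
have Jmax : maximal_ideal J.
  move=> K JK x xK; apply/asboolP; apply: (Imax (fun x => x \in K)) xK.
    split; last by rewrite idealr1.
    by split=> [|a y z yK zK]; [exact: rpred0 | rewrite rpredD // idealMr].
  by move=> y Iy; apply: JK; apply/asboolP.
have [_ uniq] := R_local; case/negP: um; rewrite -(uniq J Jmax).
by apply/asboolP/uI/spanl_mem; rewrite inE.
Qed.

Lemma prime_sub_max (I : idealr R) x : x \in I -> x \in m.
Proof.
move=> xI; apply: contraT => /local_unit[v vx].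
by have := idealMr v xI; rewrite vx idealr1.
Qed.

Lemma nonmaximal_prime (p : prime_idealr R) : ~ maximal_ideal p ->
  exists2 z, z \in m & z \notin p.
Proof.
move=> pm; apply: contra_notP pm => mp J pJ x xJ.
have [//|xp] := boolP (x \in p); case: mp.
by exists x => //; exact: prime_sub_max xJ.
Qed.

Definition no_socle A := forall w : A, (forall a, a \in m -> a *: w = 0) -> w = 0.

Definition annih A (w : A) : set R^o := fun a => (a : R) *: w = 0.

Lemma annih_submodule A (w : A) : submodule (annih w).
Proof.
split=> [|a x y xw yw]; first exact: scale0r.
by rewrite /annih scalerDl -scalerA xw yw scaler0 addr0.
Qed.

(** Such annihilators are associated primes of A; primality is [max_annih_prime]. *)
Definition max_annih A (w : A) := w <> 0 /\
  forall w' : A, w' <> 0 -> (forall a, annih w a -> annih w' a) ->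
  forall a, annih w' a -> annih w a.

Lemma max_annih_above A (v : A) : v <> 0 ->
  exists2 w : A, max_annih w & forall a : R, a *: v = 0 -> a *: w = 0.
Proof.
move=> v0; pose P (I : set R^o) := exists2 w : A, w <> 0 & I = annih w.
have [||_ [[w w0 ->] vw wmax]] := @noetherian_max P (annih v); last 1 first.
- by exists w => //; split=> // w' w'0; apply: wmax; exists w'.
- by move=> _ [w _ ->]; exact: annih_submodule.
- by exists v.
Qed.

Lemma max_annih_prime A (w : A) (a b : R) : max_annih w ->
  (a * b) *: w = 0 -> a *: w = 0 \/ b *: w = 0.
Proof.
move=> [w0 wmax] abw; have [bw|bw] := pselect (b *: w = 0); [by right | left].
apply: (wmax (b *: w) bw) => [c cw|]; rewrite /annih scalerA //.
by rewrite mulrC -scalerA cw scaler0.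
Qed.

(* An element annihilated outside every non-maximal prime has an annihilator
   contained in a maximal one, which is then prime and equal to [m]. *)
Lemma no_socle_torsion A (v : A) : no_socle A ->
  (forall p : prime_idealr R, ~ maximal_ideal p -> exists2 s, s \notin p & s *: v = 0) ->
  v = 0.
Proof.
move=> A0 vp; apply: contrapT => v0; have [w wmax vw] := max_annih_above v0.
have [w0 _] := wmax.
have I1 : ~ annih w 1 by rewrite /annih scale1r.
have cl := submodule_idealr_closed (annih_submodule w) I1.
have pr : prime_idealr_closed (fun x : R => `[< annih w x >]).
  move=> a b /asboolP/(max_annih_prime wmax)[aw|bw]; apply/orP; [left|right];
    exact/asboolP.
pose p := mk_prime_idealr cl pr.
have [pm|/vp[s /asboolP sp /vw]] := pselect (maximal_ideal p); last exact: sp.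
apply/w0/A0 => a am; have [_ uniq] := R_local.
have : a \in p by rewrite (uniq p pm).
by move=> /asboolP.
Qed.


(** If [y] avoids the annihilators of [ws] but kills [w], some [z] in m kills all of [ws] but not
    [w], and y + z works. A factor of [z] exists for each [u]: otherwise ann u would lie in ann w,
    and maximality of ann u would give y u = 0. *)
Lemma prime_avoidance A (ws : seq A) :
  (forall w, w \in ws -> max_annih w /\ exists2 a, a \in m & a *: w <> 0) ->
  exists2 y, y \in m & forall w, w \in ws -> y *: w <> 0.
Proof.
elim: ws => [|w ws IH] wsP; first by exists 0; rewrite // rpred0.
have [u uws|y ym yws] := IH; first by apply: wsP; rewrite inE uws orbT.
have [yw|yw] := pselect (y *: w = 0); last first.
  by exists y => // u /[!inE]/predU1P[->|/yws].
have [wmax [z0 z0m z0w]] := wsP w (mem_head w ws).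
have [z [zm zw zws]] : exists z, [/\ z \in m, z *: w <> 0 &
    forall u, u \in ws -> z *: u = 0].
  have: forall u, u \in ws -> max_annih u /\ y *: u <> 0.
    by move=> u uws; split; [case: (wsP u); rewrite // inE uws orbT | exact: yws].
  elim: (ws) => [|u us IHu] usP; first by exists z0.
  have [v vus|z [zm zw zus]] := IHu; first by apply: usP; rewrite inE vus orbT.
  have [umax yu] := usP u (mem_head u us).
  have [c cu cw] : exists2 c : R, c *: u = 0 & c *: w <> 0.
    apply: contrapT => uw; apply: yu; apply: (umax.2 w wmax.1) => // c cu.
    by apply: contrapT => cw; apply: uw; exists c.
  exists (c * z); split; first exact: idealMr.
    by move=> /(max_annih_prime wmax)[].
  move=> v /[!inE]/predU1P[->|/zus zv]; last by rewrite -scalerA zv scaler0.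
  by rewrite mulrC -scalerA cu scaler0.
exists (y + z); first exact: rpredD.
move=> u /[!inE]/predU1P[->|uws]; first by rewrite scalerDl yw add0r.
by rewrite scalerDl zws // addr0; exact: yws.
Qed.

(* The span of the elements with maximal annihilator is finitely generated, so
   these annihilators are finitely many primes and cover the zero divisors. *)
Lemma regular_element A : fg A -> no_socle A ->
  exists2 y, y \in m & forall v : A, y *: v = 0 -> v = 0.
Proof.
move=> [s sA] A0.
pose S : set A := fun x => exists2 ws : seq A,
  (forall w, w \in ws -> max_annih w) & spanl ws x.
have spanl_cat (r t : seq A) x y a : spanl r x -> spanl t y -> spanl (r ++ t) (a *: x + y).
  have [_ rtL] := spanl_submodule (r ++ t); move=> rx ty; apply: rtL.
    by apply: spanl_min rx => [|v vr]; [exact: spanl_submodule | apply: spanl_mem; rewrite mem_cat vr].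
  by apply: spanl_min ty => [|v vr]; [exact: spanl_submodule | apply: spanl_mem; rewrite mem_cat vr orbT].
have Ssub : submodule S.
  split; first by exists [::].
  move=> a x y [r rP xr] [t tP yt]; exists (r ++ t); last exact: spanl_cat.
  by move=> w; rewrite mem_cat => /orP[/rP|/tP].
have [t tS St] := noetherian_spanl R_noeth Ssub (fun x _ => sA x).
have [ws wsP tws] : exists2 ws : seq A, (forall w, w \in ws -> max_annih w) &
    forall x, x \in t -> spanl ws x.
  elim: t tS {St} => [|x t IH] tS; first by exists [::].
  have [u ut|ws wsP tws] := IH; first by apply: tS; rewrite inE ut orbT.
  have [r rP xr] := tS x (mem_head x t).
  exists (r ++ ws) => [w|u].
    by rewrite mem_cat => /orP[/rP|/wsP].
  rewrite inE => /predU1P[->|/tws uws].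
    by rewrite -[x]scale1r -[_ *: _]addr0; apply: spanl_cat; last case: (spanl_submodule ws).
  by rewrite -[u]add0r -[0](scale1r 0); apply: spanl_cat; first case: (spanl_submodule r).
have [w wws|y ym yws] := @prime_avoidance A ws.
  split; first exact: wsP.
  apply: contrapT => mw; apply: (wsP w wws).1; apply: A0 => a am.
  by apply: contrapT => aw; apply: mw; exists a.
exists y => // v yv; apply: contrapT => v0.
have [w wmax vw] := max_annih_above v0; have yw := vw y yv.
have Sw : S w by exists [:: w] => [u|]; [rewrite inE => /eqP -> | apply: spanl_mem; rewrite inE].
have sw : spanl ws w by apply: spanl_min (St w Sw) => //; exact: spanl_submodule.
suff [u uws uw] : exists2 u, u \in ws & forall a : R, a *: u = 0 -> a *: w = 0.
  by apply: (yws u uws); apply: ((wsP u uws).2 w wmax.1 uw).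
(* Otherwise a product of elements, one from each annihilator of a generator,
   kills the span but not [w]. *)
apply: contrapT => no.
have [c cws cw] : exists2 c : R, (forall u, u \in ws -> c *: u = 0) & c *: w <> 0.
  have: forall u, u \in ws -> exists2 a : R, a *: u = 0 & a *: w <> 0.
    move=> u uws; apply: contrapT => ua; apply: no; exists u => // a au.
    by apply: contrapT => aw; apply: ua; exists a.
  elim: (ws) => [|u us IH] usP; first by exists 1; rewrite // scale1r; case: wmax.
  have [z zus|c cus cw] := IH; first by apply: usP; rewrite inE zus orbT.
  have [a au aw] := usP u (mem_head u us).
  exists (a * c); last by move=> /(max_annih_prime wmax)[].
  move=> z /[!inE]/predU1P[->|/cus cv]; last by rewrite -scalerA cv scaler0.
  by rewrite mulrC -scalerA au scaler0.
by apply/cw/(spanl_min (ker_submodule (scal c A)) cws).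
Qed.

(** The submodule mA, described as an intersection: proving that mA lies in a submodule is then mere
    application. *)
Definition mmul A (x : A) : Prop := forall S : set A, submodule S ->
  (forall a y, a \in m -> S (a *: y)) -> S x.

Lemma mmul_submodule A : submodule (@mmul A).
Proof.
split=> [S Ssub _|a x y xm ym S Ssub Sm]; first by case: Ssub.
by case: (Ssub) => _; apply; [exact: xm | exact: ym].
Qed.

Lemma mmulZ A a (x : A) : a \in m -> mmul (a *: x).
Proof. by move=> am S Ssub; apply. Qed.

Lemma spanl_sum_submodule A (S : set A) (s : seq A) : submodule S ->
  submodule (fun x => exists2 y, S y & spanl s (x - y)).
Proof.
move=> Ssub; have [S0 SL] := Ssub; have [s0 sL] := spanl_submodule s.
split=> [|a x x' [y Sy xy] [y' Sy' xy']]; first by exists 0; rewrite // subr0.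
exists (a *: y + y'); first exact: SL.
by rewrite opprD addrACA -scalerBr; apply: sL.
Qed.

Lemma nakayama A (S : set A) : fg A -> submodule S ->
  (forall x, exists2 y, S y & mmul (x - y)) -> forall x, S x.
Proof.
move=> [s sA] Ssub SmA.
have: forall x, exists2 y, S y & spanl s (x - y).
  by move=> x; exists 0; [case: Ssub | exact: sA].
elim: s {sA} => [|v s IH] sA.
  by move=> x; have [y Sy /subr0_eq ->] := sA x.
apply: IH; pose T : set A := fun x => exists2 y, S y & spanl s (x - y).
have Tsub : submodule T := spanl_sum_submodule s Ssub.
have Ts y : spanl s y -> T y by move=> sy; exists 0; rewrite ?subr0 //; case: Ssub.
have TS y : S y -> T y by move=> Sy; exists y => //; rewrite subrr; case: (spanl_submodule s).
suff Tv : T v.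
  move=> x; have [y Sy [a /Ts]] := sA x.
  have xE : x = (x - y - a *: v) + (y + a *: v) by rewrite [y + _]addrC addrA !subrK.
  move=> Txy; change (T x); rewrite xE; apply: (submoduleD Tsub) => //.
  by apply: (submoduleD Tsub); [exact: TS | exact: submoduleZ].
have [y Sy vy] := SmA v.
have [a am Ta] : exists2 a, a \in m & T (v - y - a *: v).
  apply: (vy (fun x => exists2 a, a \in m & T (x - a *: v))).
    split; first by exists 0; rewrite ?rpred0 // scale0r subrr; case: Tsub.
    move=> c x x' [a am Tx] [b bm Tx']; exists (c * a + b); first by rewrite rpredD // idealMr.
    rewrite scalerDl -scalerA opprD addrACA -scalerBr; case: Tsub => _; exact.
  move=> a x am; have [z Sz [b bz]] := sA x; exists (a * b); first by rewrite mulrC idealMr.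
  rewrite -scalerA -scalerBr; apply: submoduleZ => //; exists z => //.
  by rewrite addrAC.
have a1 : (1 - a) \notin m.
  by apply: contraFN (idealr1 m) => h; rewrite -[1](subrK a) rpredD.
have [c ca] := local_unit a1; rewrite -[v]scale1r -ca -scalerA.
apply: (submoduleZ Tsub); rewrite scalerBl scale1r.
have -> : v - a *: v = (v - y - a *: v) + y by rewrite addrAC subrK.
by apply: (submoduleD Tsub) => //; exact: TS.
Qed.

(** A/S is a vector space over R/m, on which [f0] is nonzero. Running through the generators
    enlarges S to a [T] that still misses [f0] and together with [f0] spans A; [g] reads off the
    coefficient of [f0], well defined modulo m. *)
Lemma socle_functional A L (S : set A) (f0 : A) (sg : L) : fg A -> submodule S ->
  (forall x, mmul x -> S x) -> ~ S f0 -> (forall a, a \in m -> a *: sg = 0) ->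
  exists g : {linear A -> L}, g f0 = sg /\ forall x, S x -> g x = 0.
Proof.
move=> [s sA] Ssub Sm Sf0 sgm.
have [T [Tsub ST Tf0 sT]] : exists T : set A, [/\ submodule T, forall x, S x -> T x,
    ~ T f0 & forall v, v \in s -> exists a, T (v - a *: f0)].
  elim: (s) => [|v r [T [Tsub ST Tf0 rT]]]; first by exists S.
  have [Tv|Tv] := pselect (exists a, T (f0 - a *: v)).
    exists T; split=> // w /[!inE]/predU1P[->|/rT //]; case: Tv => a Tv.
    have [am|am] := boolP (a \in m).
      case: Tf0; rewrite -[f0](subrK (a *: v)); apply: (submoduleD Tsub) => //.
      by apply: ST; apply: Sm; exact: mmulZ.
    have [c ca] := local_unit am; exists c.
    have -> : v - c *: f0 = - c *: (f0 - a *: v).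
      by rewrite scalerBr !scaleNr opprK scalerA ca scale1r addrC.
    exact: submoduleZ.
  exists (fun x => exists a, T (x - a *: v)); split=> //.
  - split; first by exists 0; rewrite scale0r subrr; case: Tsub.
    move=> a x y [b Tx] [c Ty]; exists (a * b + c).
    rewrite scalerDl -scalerA opprD addrACA -scalerBr; case: Tsub => _; exact.
  - by move=> x Sx; exists 0; rewrite scale0r subr0; apply: ST.
  - move=> w /[!inE]/predU1P[->|/rT[a Tw]].
      by exists 0, 1; rewrite scale0r scale1r subr0 subrr; case: Tsub.
    by exists a, 0; rewrite scale0r subr0.
have AT x : exists a, T (x - a *: f0).
  apply: (spanl_min _ sT (sA x)); split; first by exists 0; rewrite scale0r subrr; case: Tsub.
  move=> a y z [b Ty] [c Tz]; exists (a * b + c).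
  rewrite scalerDl -scalerA opprD addrACA -scalerBr; case: Tsub => _; exact.
have Ta a b x : T (x - a *: f0) -> T (x - b *: f0) -> a *: sg = b *: sg.
  move=> Txa Txb; apply/subr0_eq; rewrite -scalerBl; apply: sgm.
  apply: contraT => /local_unit[c cab]; case: Tf0.
  rewrite -[f0]scale1r -cab -scalerA; apply: (submoduleZ Tsub).
  have -> : (a - b) *: f0 = (x - b *: f0) - (x - a *: f0).
    by rewrite opprB [RHS]addrC addrA subrK scalerBl.
  exact: submoduleB.
have [|||g gE] := lin_rel (S := fun x l => exists2 a, T (x - a *: f0) & l = a *: sg).
- by move=> x; have [a Tx] := AT x; exists (a *: sg), a.
- by move=> x y z [a Ta' ->] [b Tb ->]; apply: Ta Ta' Tb.
- move=> a x y u v [b Tb ->] [c Tc ->]; exists (a * b + c); last by rewrite scalerDl scalerA.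
  rewrite scalerDl -scalerA opprD addrACA -scalerBr; case: Tsub => _; exact.
exists g; split=> [|x Sx].
  have [a Tfa ->] := gE f0; rewrite -[RHS]scale1r; apply: Ta Tfa _.
  by rewrite scale1r subrr; case: Tsub.
have [a Txa ->] := gE x; rewrite -[RHS](scale0r sg); apply: Ta Txa _.
by rewrite scale0r subr0; apply: ST.
Qed.

End LocalAlgebra.

(** * Depth *)

Section Depth.
Variables (R : comNzRingType) (m : idealr R).
Hypotheses (R_noeth : noetherian R) (R_local : local_ring m).
Implicit Types A B C : lmodType R.

Lemma idealr_submodule : submodule (fun x : R^o => x \in m).
Proof.
split=> [|a x y xm ym]; first exact: rpred0.
by rewrite rpredD //; apply: idealMr.
Qed.

Definition residue : lmodType R := quotm idealr_submodule.

Lemma residue_killed a (x : residue) : a \in m -> a *: x = 0.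
Proof.
move=> am; have [y <-] := qpi_surj x; rewrite -linearZZ; apply/qpi_eq0.
by rewrite -[a *: y]/(a * (y : R)) mulrC; apply: idealMr.
Qed.

Lemma residue_fg : fg residue.
Proof.
apply: (fg_surj (qpi_surj (Ssub := idealr_submodule))); exists [:: (1 : R^o)] => x.
by exists x; rewrite /= [x *: _]mulr1 subrr.
Qed.

Definition residue_res : resolution residue :=
  syz_res R_noeth (exist _ residue residue_fg).

Lemma residue_res_projective : projective_resolution residue_res.
Proof. exact: syz_res_projective. Qed.

Definition Ext_res_van A i := Ext_van residue_res A i.

Lemma socle_map A (w : A) : (forall a, a \in m -> a *: w = 0) ->
  exists g : {linear residue -> A}, exists2 y, g y = w & forall u, exists a, u = a *: y.
Proof.
move=> mw; have wL : linear (fun a : R^o => (a : R) *: w).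
  by move=> a x y; rewrite scalerDl scalerA.
have [|g gE] := lin_quot (f := lin wL) (qpi_surj (Ssub := idealr_submodule)).
  by move=> a /qpi_eq0 am; apply: mw.
exists g, (qpi idealr_submodule 1) => [|u]; first by rewrite gE /= scale1r.
have [x <-] := qpi_surj u; exists x; rewrite -linearZZ.
by rewrite [x *: _]mulr1.
Qed.

Lemma Ext_res_van0 A : Ext_res_van A 0 <-> no_socle m A.
Proof.
split=> [EA w mw|A0 f fc x].
  have [g [y <- _]] := socle_map mw; have [x <-] := res_aug_surj residue_res y.
  have := EA (g \o res_aug residue_res); rewrite /cocycle /=; apply=> {}x.
  by rewrite (res_augd (P := residue_res)) linear0.
apply: A0 => a am; rewrite -linearZZ.
have /res_exact0[z <-] : res_aug residue_res (a *: x) = 0.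
  by rewrite linearZZ residue_killed.
exact: fc.
Qed.

Lemma Ext_res_van_split (K : set R) C i : split_local K C ->
  (forall a, K a -> a \in m) -> Ext_res_van C i.
Proof.
move=> CK Km; apply: (Ext_van_split0 residue_res_projective CK) => a Ka x.
exact/residue_killed/Km.
Qed.

Lemma in_seq_mul_submodule A (s : seq R) : submodule (@in_seq_mul R A s).
Proof.
split=> [|a x y [u ->] [v ->]].
  by exists (fun=> 0); rewrite big1 // => i _; rewrite scaler0.
exists (fun i => a *: u i + v i); rewrite scaler_sumr -big_split /=.
by apply: eq_bigr => i _; rewrite scalerDr !scalerA mulrC.
Qed.

Lemma in_seq_mul_rcons A (s : seq R) (x : R) (v : A) :
  in_seq_mul (rcons s x) v <-> exists w, in_seq_mul s (v - x *: w).
Proof.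
split=> [[w ->]|[u [w vE]]].
  exists (w (size s)), w; rewrite size_rcons big_nat_recr //= nth_rcons ltnn eqxx addrK.
  by apply: eq_big_nat => i /andP[_ ils]; rewrite nth_rcons ils.
exists (fun i => if (i < size s)%N then w i else u).
rewrite size_rcons big_nat_recr //= nth_rcons ltnn eqxx -[v](subrK (x *: u)) vE.
congr (_ + _); apply: eq_big_nat => i /andP[_ ils].
by rewrite nth_rcons ils.
Qed.

Definition seq_quot A (s : seq R) : lmodType R := quotm (in_seq_mul_submodule A s).

Lemma ses_seq_quot A (s : seq R) (x : R) :
  (forall v : A, in_seq_mul s (x *: v) -> in_seq_mul s v) ->
  exists p : {linear seq_quot A s -> seq_quot A (rcons s x)},
    ses (scal x (seq_quot A s)) p.
Proof.
move=> xreg; have S0 : in_seq_mul s (0 : A) by case: (in_seq_mul_submodule A s).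
have [v /qpi_eq0 sv|p pE] := lin_quot
    (f := qpi (in_seq_mul_submodule A (rcons s x)))
    (qpi_surj (Ssub := in_seq_mul_submodule A s)).
  apply/qpi_eq0; apply/in_seq_mul_rcons; exists 0.
  by rewrite scaler0 subr0.
exists p; split=> [u|u|u].
- have [v <-] := qpi_surj u; rewrite scalE -linearZZ.
  by move/qpi_eq0/xreg => sv; apply/(qpi_eq0 (in_seq_mul_submodule A s)).
- have [v <-] := qpi_surj u; exists (qpi _ v); exact: pE.
- have [v <-] := qpi_surj u; rewrite pE qpi_eq0 in_seq_mul_rcons; split=> [[w vw]|[w0]].
    exists (qpi _ w); rewrite scalE -linearZZ.
    apply/subr0_eq; rewrite -linearB; apply/qpi_eq0.
    by rewrite -opprB; apply: (submoduleN (in_seq_mul_submodule A s)).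
  have [w <-] := qpi_surj w0; rewrite scalE -linearZZ => wv.
  exists w; apply/(qpi_eq0 (in_seq_mul_submodule A s)).
  by rewrite linearB wv subrr.
Qed.

Lemma seq_quot_nil A i :
  Ext_res_van (seq_quot A [::]) i <-> Ext_res_van A i.
Proof.
have nil0 (v : A) : in_seq_mul [::] v -> v = 0 by case=> w ->; rewrite big_nil.
split; first apply: (Ext_van_iso (i := qpi _)) => [a /qpi_eq0/nil0|b] //; first exact: qpi_surj.
have [v /qpi_eq0/nil0//|p pE] := lin_quot (f := (idfun : {linear A -> A}))
  (qpi_surj (Ssub := in_seq_mul_submodule A [::])).
apply: (Ext_van_iso (i := p)) => [u|b]; last by exists (qpi _ b); exact: pE.
have [v <-] := qpi_surj u; rewrite pE => v0; have -> : v = 0 := v0.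
exact: linear0.
Qed.

Section RegularSequence.
Variables (A : lmodType R) (s : seq R).
Hypothesis s_reg : regular_seq m A s.

Lemma regular_seq_ses j : (j < size s)%N ->
  exists p : {linear seq_quot A (take j s) -> seq_quot A (take j.+1 s)},
    ses (scal s`_j (seq_quot A (take j s))) p.
Proof.
by move=> js; rewrite (take_nth 0 js); apply: ses_seq_quot; case: s_reg => _ /(_ j js).
Qed.

(** Descent along the sequence: each quotient is reached from the next one by [Ext_van_regular],
    because the members of [s] kill R/m. *)
Lemma regular_seq_quot_van k j : (j + k <= size s)%N ->
  forall i, (i < k)%N -> Ext_res_van (seq_quot A (take j s)) i.
Proof.
elim: k j => // k IH j jk i ik.
have js : (j < size s)%N by apply: leq_trans jk; rewrite addnS ltnS leq_addr.
have [p pses] := regular_seq_ses js.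
apply: (Ext_van_regular (d := k) residue_res_projective _ pses) => // [x|].
  by apply: residue_killed; case: s_reg => sm _ _; apply/sm/mem_nth.
by apply: IH; rewrite addSnnS.
Qed.

Lemma seq_quot_van k : (forall i, (i <= k)%N -> Ext_res_van A i) -> forall j,
  (j <= k)%N -> (j <= size s)%N ->
  forall i, (i <= k - j)%N -> Ext_res_van (seq_quot A (take j s)) i.
Proof.
move=> EA; elim=> [|j IH] jk js i ij.
  by rewrite take0; apply/seq_quot_nil/EA; rewrite subn0 in ij.
have [p pses] := regular_seq_ses js.
have kj : (k - j)%N = (k - j.+1).+1 by rewrite subnSK.
by apply: (Ext_van_ses_third residue_res_projective pses); apply: IH;
  rewrite ?(ltnW jk) ?(ltnW js) ?kj // ltnW // ltnS.
Qed.

End RegularSequence.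

Lemma depth_ge_van A n : depth_ge m A n -> forall i, (i < n)%N -> Ext_res_van A i.
Proof.
case=> [A0 i _ f fc|[s [sreg ns]] i ni].
  by case: i f fc => [|i] f fc; [move=> x; apply: A0 | exists (lin0 _ _) => x; apply: A0].
apply/seq_quot_nil; rewrite -(take0 s).
by apply: (regular_seq_quot_van sreg (k := n)).
Qed.

(** If Ext^n(R/m, R) vanished too, the quotient of R by the first [n] members of a regular sequence
    would have no socle, hence a regular element in m, and the sequence could be prolonged to length
    n + 1. *)
Lemma depth_eq_van n : depth_eq m R^o n -> ~ Ext_res_van R^o n.
Proof.
case=> ge_n not_ge En; have En' i : (i <= n)%N -> Ext_res_van R^o i.
  by rewrite leq_eqVlt => /predU1P[->|/(depth_ge_van ge_n)].
case: (ge_n) => [R0|[s [sreg ns]]]; first by move/eqP: (R0 1); rewrite oner_eq0.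
have /Ext_res_van0 := seq_quot_van sreg En' (leqnn n) ns (leq0n _).
have qfg : fg (seq_quot R^o (take n s)).
  apply: (fg_surj (qpi_surj (Ssub := in_seq_mul_submodule R^o (take n s)))).
  exists [:: (1 : R^o)] => x.
  by exists x; rewrite /= [x *: _]mulr1 subrr.
move=> /(regular_element R_noeth qfg)[y ym yreg].
have size_t : size (take n s) = n by rewrite size_takel.
apply: not_ge; right; exists (rcons (take n s) y); rewrite size_rcons size_t.
split=> //; have [sm si _] := sreg; have mem_m x : x \in rcons (take n s) y -> x \in m.
  by rewrite mem_rcons inE => /predU1P[->//|/mem_take/sm].
split=> // [i|].
  rewrite size_rcons size_t ltnS leq_eqVlt => /predU1P[->|ilt] v.
    rewrite -cats1 take_size_cat // nth_cat size_t ltnn subnn /= => yv.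
    apply/(qpi_eq0 (in_seq_mul_submodule R^o (take n s))); apply: yreg.
    by rewrite -linearZZ; apply/qpi_eq0.
  rewrite -cats1 takel_cat ?size_t 1?ltnW // nth_cat size_t ilt nth_take //.
  rewrite take_takel 1?ltnW //; apply: si.
  exact: leq_trans ilt ns.
exists 1 => -[w /esym e].
have : (1 : R) \in m; last by rewrite idealr1.
rewrite -e; elim/big_ind: _ => [|a b am bm|i _]; [exact: rpred0 | exact: rpredD|].
have [ilt|ige] := ltnP i (size (rcons (take n s) y)); last first.
  by rewrite nth_default // scale0r; exact: rpred0.
rewrite /GRing.scale /= mulrC; apply: idealMr; apply: mem_m.
exact: mem_nth.
Qed.

End Depth.

(** * Finite G-dimension *)

Section DualSequences.
Variable R : comNzRingType.
Implicit Types A B D F N T X Z : lmodType R.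

Lemma ses_hom_pre A B D N (i : {linear A -> B}) (p : {linear B -> D}) : ses i p ->
  (forall f : {linear A -> N}, exists g : {linear B -> N}, forall a, g (i a) = f a) ->
  ses (hom_pre N p) (hom_pre N i).
Proof.
move=> ip ext; have [i0 ps ex] := ip; split=> [f f0|f|f].
- apply: homR_ext => d; have [b <-] := ps d.
  by rewrite -[LHS]/(hom_pre N p f b) f0.
- by have [g gE] := ext f; exists (homL g); apply: homR_ext => a; exact: gE.
- split=> [f0|[g <-]]; last by apply: homR_ext => a /=; rewrite (ses_comp0 ip) linear0.
  have [|g gE] := lin_quot (f := (f : {linear B -> N})) ps.
    by move=> b /ex[a <-]; rewrite -[LHS]/(hom_pre N i f a) f0.
  by exists (homL g); apply: homR_ext => b; exact: gE.
Qed.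

Lemma traced_split a X (P : resolution X) : traced a X ->
  exists s : {linear X -> P 0%N}, forall x, res_aug P (s x) = a *: x.
Proof.
by move=> Xa; apply: (traced_lift (idfun : {linear X -> X}) Xa); exact: res_aug_surj.
Qed.

Lemma Ext_van_traced X (P : resolution X) (K : set R) C i : projective_resolution P ->
  (forall a, K a -> traced a X) -> split_local K C -> Ext_van P C i.+1.
Proof.
by move=> Pp KX CK; apply: (Ext_van_split Pp CK) => a /KX; apply: traced_split.
Qed.

Lemma Ext_van_traced1_src X (P : resolution X) A i : projective_resolution P ->
  traced 1 X -> Ext_van P A i.+1.
Proof.
move=> Pp /(traced_split P)[s sE] f fc; have [sg [_ sgS]] := htpy_scal Pp sE.
by exists (f \o sg i) => x; rewrite -[x in LHS]scale1r sgS linearD fc add0r.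
Qed.

Lemma bidual_linear X : linear (@bidual_map R X).
Proof. by move=> a x y; apply: homR_ext => f; rewrite homRD homRZ /= linearP. Qed.
Definition bidual_lin X : {linear X -> dual (dual X)} := lin (@bidual_linear X).

Lemma bidual_lin_inj X : reflexive_module X -> forall x, bidual_lin X x = 0 -> x = 0.
Proof.
move=> /reflexiveP[inj _] x x0; apply: inj => f.
by rewrite -[LHS]/(bidual_lin X x f) x0.
Qed.

Lemma bidual_lin_surj X : reflexive_module X -> forall Phi, exists x, bidual_lin X x = Phi.
Proof.
move=> /reflexiveP[_ surj] Phi; have [x xE] := surj Phi; exists x.
by apply: homR_ext => f; rewrite xE.
Qed.

(** Dualizing twice keeps the sequence exact: [ext] serves the first time, Ext^1(dual T, R) = 0 the
    second. Comparison with the original sequence is then a diagram chase. *)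
Lemma reflexive_quotient T F Z (i : {linear T -> F}) (p : {linear F -> Z})
    (P : resolution (dual T)) : projective_resolution P -> ses i p ->
  (forall f : {linear T -> R^o}, exists g : {linear F -> R^o}, forall a, g (i a) = f a) ->
  Ext_van P R^o 1 -> reflexive_module T -> reflexive_module F -> reflexive_module Z.
Proof.
move=> Pp ip ext ET /reflexiveP[_ surjT] /reflexiveP[injF surjF].
have dses := ses_hom_pre ip ext; have [_ ps ex] := ip; have [_ dps dex] := dses.
apply/reflexiveP; split=> [z z0|Phi].
  have [y yz] := ps z.
  have [|Psi PsiE] := lin_quot (f := ev_lin R^o y) dps.
    by move=> f /dex[g <-]; rewrite /= yz z0.
  have [x xE] := surjT (homL Psi).
  rewrite -yz; apply/ex; exists x; apply/subr0_eq/injF => f.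
  have fE : f (i x) = f y by rewrite -[f (i x)]/(hom_pre R^o i f x) -xE; exact: PsiE.
  by rewrite linearB; apply/eqP; rewrite subr_eq0; apply/eqP.
pose Phi' : homR (dual Z) R^o := Phi.
have [G GE] := Ext1_extend Pp dses ET Phi'.
have [y yE] := surjF (homL G); exists (p y) => f.
by rewrite -[Phi f]/(Phi' f) -GE -[f (p y)]/(hom_pre R^o p f y) -yE.
Qed.

End DualSequences.

(** * The tower of cosyzygies and the extension of functionals *)

Section Tower.
Variables (R : comNzRingType) (m : idealr R).
Hypotheses (R_noeth : noetherian R) (R_local : local_ring m).
Variable K : set R.
Hypothesis K_max : forall a, K a -> a \in m.
Hypothesis K_primes :
  forall p : prime_idealr R, ~ maximal_ideal p -> exists2 a, K a & a \notin p.
Implicit Types A B C X : lmodType R.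

(* The cosyzygies of R along the embeddings A -> punctm A; [tower n] plays the role of
   the local cohomology module H^n_m(R) as long as n <= depth R. *)
Fixpoint tower n : lmodType R :=
  if n is k.+1 then quotm (im_submodule (punct_inc (tower k))) else R^o.

Definition tower_pr n : {linear punctm (tower n) -> tower n.+1} :=
  qpi (im_submodule (punct_inc (tower n))).

Lemma punct_inc_inj A : no_socle m A -> forall x, punct_inc A x = 0 -> x = 0.
Proof. by move=> A0 x /punct_inc_eq0; apply: (no_socle_torsion R_noeth R_local). Qed.

Lemma punctm_split A : split_local K (punctm A).
Proof. exact: split_local_punctm. Qed.

Local Notation Ek := (Ext_res_van m R_noeth).
Let kres_proj := residue_res_projective (m := m) (R_noeth := R_noeth).

Lemma Ext_res_van_punctm A i : Ek (punctm A) i.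
Proof. exact: (Ext_res_van_split (punctm_split A)). Qed.

Variable t : nat.
Hypothesis R_van : forall i, (i < t)%N -> Ek R^o i.
Hypothesis R_nvan : ~ Ek R^o t.

Lemma tower_ses_aux n : Ek (tower n) 0 -> ses (punct_inc (tower n)) (tower_pr n).
Proof. by move=> /Ext_res_van0 Ln; apply: ses_coker; exact: punct_inc_inj. Qed.

(** Each level lowers the degree by one since Ext(R/m, -) vanishes on C_n. Exactness at level [n],
    which the shift requires, is degree 0 of the induction hypothesis. *)
Lemma tower_van n i : (i + n < t)%N -> Ek (tower n) i.
Proof.
elim: n i => [|n IH] i ; first by rewrite addn0; exact: R_van.
rewrite addnS => int; have nses : ses (punct_inc (tower n)) (tower_pr n).
  by apply/tower_ses_aux/IH; rewrite add0n; apply: leq_trans int; rewrite ltnS leqW // leq_addl.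
apply: (Ext_van_ses_third kres_proj nses (@Ext_res_van_punctm _ _)).
by apply: IH; rewrite addSn.
Qed.

Lemma tower_ses n : (n < t)%N -> ses (punct_inc (tower n)) (tower_pr n).
Proof. by move=> nt; apply/tower_ses_aux/tower_van. Qed.

Lemma tower_top : exists2 sg : tower t, sg <> 0 & forall a, a \in m -> a *: sg = 0.
Proof.
suff L0 : ~ Ek (tower t) 0.
  apply: contrapT => no; apply: L0; apply/Ext_res_van0 => w mw.
  by apply: contrapT => w0; apply: no; exists w.
move=> L0; apply: R_nvan.
have: forall n, (n <= t)%N -> Ek (tower (t - n)) n; last first.
  by move=> /(_ t (leqnn t)); rewrite subnn.
elim=> [|n IH] nt; first by rewrite subn0.
have tn : (t - n)%N = (t - n.+1).+1 by rewrite subnSK.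
have nses := @tower_ses (t - n.+1) _.
apply: (Ext_van_ses_first kres_proj (nses _)).
- by rewrite -tn leq_subr.
- by change (Ek (tower (t - n.+1).+1) n); rewrite -tn; apply: IH; exact: ltnW.
- exact: Ext_res_van_punctm.
Qed.

Lemma tower_lift X (P : resolution X) n : projective_resolution P ->
  (forall a, K a -> traced a X) -> (n < t)%N -> Ext_van P R^o n.+1 ->
  forall f : {linear X -> tower n.+1},
    exists g : {linear X -> punctm (tower n)}, forall x, tower_pr n (g x) = f x.
Proof.
move=> Pp KX nt ER.
suff: forall i, (i <= n)%N -> Ext_van P (tower i) (n - i).+1.
  move=> /(_ n (leqnn n)); rewrite subnn => En.
  exact: (Ext1_lift Pp (tower_ses nt) En).
elim=> [|i IH] ni; first by rewrite subn0.
apply: (Ext_van_ses_third Pp (tower_ses (ltn_trans ni nt))).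
  exact: (Ext_van_traced Pp KX (punctm_split _)).
by rewrite subnSK //; apply: IH; exact: ltnW.
Qed.

Section Extension.
Variables (T F Z : lmodType R) (i : {linear T -> F}) (p : {linear F -> Z}).
Hypotheses (ip : ses i p) (F_proj : traced 1 F) (t_gt0 : (0 < t)%N).
Hypotheses (T_fg : fg T) (T_refl : reflexive_module T).
Hypothesis T_traced : forall a, K a -> traced a T.
Hypothesis T_ext : forall j, Ext_eq0 (dual T) R^o j.+1.
Hypothesis Z_van : forall j, (j < t)%N -> Ek Z j.

Let Q : resolution (dual T) := syz_res R_noeth (exist _ (dual T) (fg_dual R_noeth T_fg)).
Let Q_proj : projective_resolution Q. Proof. exact: syz_res_projective. Qed.
Let Q_van j : Ext_van Q R^o j.+1. Proof. exact: Ext_van_of_eq0. Qed.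

Let di : {linear dual F -> dual T} := hom_pre R^o i.

(** Injectivity of Ext^j(R/m, Hom(dual T, L_n)) -> Ext^j(R/m, Hom(dual F, L_n)). For n = 0 the two
    Hom modules are T and F by reflexivity; the target is n = t, j = 0, where socles are
    compared. *)
Let inj_at n j := forall f : {linear residue_res m R_noeth j -> homR (dual T) (tower n)},
  cocycle f -> coboundary (hom_pre (tower n) di \o f :
    {linear residue_res m R_noeth j -> homR (dual F) (tower n)}) -> coboundary f.

Let inj_base : inj_at 0 t.
Proof.
have [k tk] : exists k, t = k.+1 by case: (t) t_gt0 => // k; exists k.
rewrite tk => f fc [h hE].
have F_refl := traced1_reflexive F_proj.
have [f' f'E] := lin_factor (i := bidual_lin T) (f := f) (bidual_lin_inj T_refl)
  (fun x => bidual_lin_surj T_refl (f x)).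
have [h' h'E] := lin_factor (i := bidual_lin F) (f := h) (bidual_lin_inj F_refl)
  (fun x => bidual_lin_surj F_refl (h x)).
have [||g gE] := @ses_coboundary R _ (residue_res m R_noeth) T F Z i p k f'
    kres_proj ip _ _.
- by apply: Z_van; rewrite tk.
- exists h' => x; apply/subr0_eq/(bidual_lin_inj F_refl); rewrite linearB h'E -hE.
  have E : bidual_lin F (i (f' x)) = hom_pre (tower 0) di (f x).
    by rewrite -f'E; apply: homR_ext.
  by apply/eqP; rewrite subr_eq0; apply/eqP.
- by exists (bidual_lin T \o g) => x; rewrite -f'E gE.
Qed.

(** Hom(dual T, -) is exact on the tower because Ext(dual T, R) vanishes in positive degrees, and
    Hom(dual F, -) because dual F is projective. *)
Let inj_shift n j : (n < t)%N -> inj_at n j.+1 -> inj_at n.+1 j.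
Proof.
move=> nt inj; apply: (@coboundary_shift R _ (residue_res m R_noeth)
  (homR (dual T) (tower n)) (homR (dual T) (punctm (tower n))) (homR (dual T) (tower n.+1))
  (homR (dual F) (tower n)) (homR (dual F) (punctm (tower n))) (homR (dual F) (tower n.+1))
  (hom_post _ (punct_inc (tower n))) (hom_post _ (tower_pr n))
  (hom_post _ (punct_inc (tower n))) (hom_post _ (tower_pr n))
  (hom_pre _ di) (hom_pre _ di) (hom_pre _ di) j) => //.
- apply: ses_hom; first exact: tower_ses.
  by apply: (tower_lift Q_proj) => // a /T_traced; exact: traced_dual.
- apply: ses_hom; first exact: tower_ses.
  move=> f; apply: (traced1_projective (traced_dual F_proj)).
  by case: (tower_ses nt).
- by move=> f; apply: homR_ext.
- by move=> f; apply: homR_ext.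
- by apply: (Ext_res_van_split (K := K)) => //; apply/split_local_hom/punctm_split.
Qed.

Lemma dual_extension (f : {linear T -> R^o}) :
  exists g : {linear F -> R^o}, forall a, g (i a) = f a.
Proof.
pose S (x : dual T) := exists2 y, (exists g, di g = y) & mmul m (x - y).
have Ssub : submodule S.
  have [m0 mL] := mmul_submodule m (dual T); have [d0 dL] := im_submodule di.
  split=> [|a x x' [y yd xy] [y' y'd x'y']].
    by exists 0; rewrite ?subr0.
  exists (a *: y + y'); first exact: dL.
  by rewrite opprD addrACA -scalerBr; apply: mL.
suff [g gE] : exists g, di g = homL f.
  by exists g => a; rewrite -[LHS]/(di g a) gE.
apply: (nakayama R_noeth R_local (fg_dual R_noeth T_fg) (im_submodule di)) => f0.
apply: contrapT => Sf0; have [sg sg0 msg] := tower_top.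
have [|th [thf0 thS]] := socle_functional R_noeth R_local (fg_dual R_noeth T_fg) Ssub _ Sf0 msg.
  by move=> x xm; exists 0; rewrite ?subr0 //; exists 0; rewrite linear0.
(* m kills [th], so [th] is a value of a map [w] from R/m. As [th] vanishes on the image of [di],
   [w] dies in Hom(dual F, L_t), and injectivity in degree 0 gives w = 0. *)
have [|w [y wy yu]] := @socle_map R m (homR (dual T) (tower t)) (homL th).
  move=> a am; apply: homR_ext => x; rewrite homRZ -linearZZ; apply: thS.
  by exists 0; [exists 0; rewrite linear0 | rewrite subr0; exact: mmulZ].
have inj_top : inj_at t 0.
  suff: forall n, (n <= t)%N -> inj_at n (t - n) by move=> /(_ t (leqnn t)); rewrite subnn.
  elim=> [|n IH] nt; first by rewrite subn0.
  by apply: inj_shift => //; rewrite subnSK //; apply: IH; exact: ltnW.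
have w0 u : w u = 0.
  have [x <-] := res_aug_surj (residue_res m R_noeth) u.
  apply: (inj_top (w \o res_aug _)) => [v|v].
    by rewrite /= (res_augd (P := residue_res m R_noeth)) linear0.
  rewrite -[LHS]/(hom_pre (tower t) di (w (res_aug (residue_res m R_noeth) v))).
  have [a ->] := yu (res_aug (residue_res m R_noeth) v); apply: homR_ext => g.
  rewrite !linearZZ wy -[LHS]/(a *: th (di g)) thS ?scaler0 //.
  exists (di g); first by exists g.
  by rewrite subrr; case: (mmul_submodule m (dual T)).
by apply: sg0; rewrite -thf0 -[LHS]/(homL th f0) -wy w0.
Qed.

Hypothesis F_fg : fg F.

Lemma dual_kernel_ext (P : resolution (dual Z)) j :
  projective_resolution P -> Ext_van P R^o j.+1.
Proof.
move=> Pp; have dses := ses_hom_pre ip dual_extension.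
pose QF : resolution (dual F) := syz_res R_noeth (exist _ (dual F) (fg_dual R_noeth F_fg)).
have QFp : projective_resolution QF by exact: syz_res_projective.
apply: (Ext_van_ses_left Pp QFp dses) => // k.
exact: (Ext_van_traced1_src QFp (traced_dual F_proj)).
Qed.

Lemma quotient_reflexive : reflexive_module Z.
Proof.
apply: (reflexive_quotient Q_proj ip dual_extension (@Q_van 0) T_refl).
exact: traced1_reflexive.
Qed.

End Extension.
End Tower.

(** * Totally reflexive modules and their syzygies *)

Section TotallyReflexive.
Variable R : comNzRingType.
Hypothesis R_noeth : noetherian R.
Implicit Types A B D F G N T X Y Z : lmodType R.

Section AddProjective.
Variables (X F Y : lmodType R) (e : {linear (X * F)%type -> Y}) (P : resolution X).
Hypotheses (e_inj : forall x, e x = 0 -> x = 0) (e_surj : forall y, exists x, e x = y).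

(** Adding F in degree 0 leaves positive cohomology unchanged. The isomorphism [e] is kept general
    because the dual of a product is only isomorphic to the product of duals. *)
Definition addp_mod i : lmodType R := if i is j.+1 then P j.+1 else (P 0%N * F)%type.

Definition addp_diff i : {linear addp_mod i.+1 -> addp_mod i} :=
  match i with
  | 0%N => inl_lin (P 0%N) F \o res_diff P 0%N
  | j.+1 => res_diff P j.+1
  end.

Definition addp_aug : {linear addp_mod 0%N -> Y} :=
  e \o ((inl_lin X F \o (res_aug P \o fst)) \+ (inr_lin X F \o snd)).

Lemma addp_augE x f : addp_aug (x, f) = e (res_aug P x, f).
Proof. by rewrite /addp_aug /=; congr (e (_, _)); rewrite ?addr0 ?add0r. Qed.

Lemma addp_surj y : exists x, addp_aug x = y.
Proof.
have [[x f] <-] := e_surj y; have [u <-] := res_aug_surj P x.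
by exists (u, f); rewrite addp_augE.
Qed.

Lemma addp_exact0 y : addp_aug y = 0 <-> exists z, addp_diff 0%N z = y.
Proof.
case: y => x f; split=> [|[z [<- <-]]]; last by rewrite addp_augE res_augd; exact: linear0.
by rewrite addp_augE => /e_inj[/res_exact0[z <-] ->]; exists z.
Qed.

Lemma addp_exact i y : addp_diff i y = 0 <-> exists z, addp_diff i.+1 z = y.
Proof.
case: i y => [|i] y; last exact: res_exact.
rewrite -[exists z, _]/(exists z, res_diff P 1%N z = y) -res_exact /=.
by split=> [[]|->].
Qed.

Definition addp : resolution Y := Resolution addp_surj addp_exact0 addp_exact.

Lemma addp_projective : projective F -> projective_resolution P -> projective_resolution addp.
Proof. by move=> Fp Pp [|i]; [apply: projective_prod | apply: Pp]. Qed.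

Lemma Ext_van_addp A i : Ext_van P A i.+1 -> Ext_van addp A i.+1.
Proof.
case: i => [|i] EP f fc.
  by have [g gE] := EP f fc; exists (g \o fst) => x; rewrite gE.
exact: EP f fc.
Qed.

End AddProjective.

Lemma Ext_eq0_addp X F Y (e : {linear (X * F)%type -> Y}) A i : projective F ->
  (forall x, e x = 0 -> x = 0) -> (forall y, exists x, e x = y) ->
  Ext_eq0 X A i.+1 -> Ext_eq0 Y A i.+1.
Proof.
move=> Fp e0 es [P [Pp EP]]; exists (addp P e0 es); split; first exact: addp_projective.
exact: Ext_van_addp.
Qed.

Definition TR G : Prop :=
  [/\ fg G, reflexive_module G, forall j, Ext_eq0 G R^o j.+1
    & forall j, Ext_eq0 (dual G) R^o j.+1].

Lemma totally_reflexive_TR G : totally_reflexive G -> TR G.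
Proof. by case=> /fg_fin_gen Gfg Gr G1 G2; split=> // j; [apply: G1 | apply: G2]. Qed.

Lemma Ext_eq0_traced1 F A j : traced 1 F -> Ext_eq0 F A j.+1.
Proof.
move=> F1; exists (syz_res R_noeth (exist _ F (fg_traced1 F1))).
have Pp := syz_res_projective (R_noeth := R_noeth) (M := exist _ F (fg_traced1 F1)).
by split=> //; apply: Ext_van_traced1_src.
Qed.

Lemma TR_traced1 F : traced 1 F -> TR F.
Proof.
move=> F1; split=> [||j|j]; [exact: fg_traced1 | exact: traced1_reflexive |
  exact: Ext_eq0_traced1 | exact/Ext_eq0_traced1/traced_dual].
Qed.

Lemma traced1_zero F : (forall x : F, x = 0) -> traced 1 F.
Proof.
move=> F0; exists 0%N, (fun=> 0), (fun=> 0) => x.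
by rewrite big_ord0.
Qed.

Lemma dual_prod_linear G F : linear (fun x : (dual G * dual F)%type =>
  hom_pre R^o (fst : {linear (G * F)%type -> G}) x.1 +
  hom_pre R^o (snd : {linear (G * F)%type -> F}) x.2).
Proof.
move=> a x y; rewrite -[(a *: x + y).1]/(a *: x.1 + y.1).
by rewrite -[(a *: x + y).2]/(a *: x.2 + y.2) 2!linearP scalerDr addrACA.
Qed.

Definition dual_prod G F : {linear (dual G * dual F)%type -> dual (G * F)%type} :=
  lin (@dual_prod_linear G F).

Lemma dual_prodE G F f g x y :
  dual_prod G F (f, g) (x, y) = (f : homR G R^o) x + (g : homR F R^o) y.
Proof. by []. Qed.

Lemma dual_prod_inj G F x : dual_prod G F x = 0 -> x = 0.
Proof.
case: x => f g fg0; have h x y : (f : homR G R^o) x + (g : homR F R^o) y = 0.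
  by rewrite -dual_prodE fg0.
congr pair; apply: homR_ext => x.
  by rewrite -[LHS]addr0 -[in LHS](linear0 (g : homR F R^o)) h.
by rewrite -[LHS]add0r -[in LHS](linear0 (f : homR G R^o)) h.
Qed.

Lemma dual_prod_surj G F h : exists x, dual_prod G F x = h.
Proof.
exists (hom_pre R^o (inl_lin G F) h, hom_pre R^o (inr_lin G F) h).
apply: homR_ext => -[x y]; rewrite dual_prodE /= -linearD /=.
by congr (h (_, _)); rewrite ?addr0 ?add0r.
Qed.

Lemma TR_prod G F : TR G -> traced 1 F -> TR (G * F)%type.
Proof.
move=> [Gfg /reflexiveP[injG surjG] G1 G2] F1.
have [injF surjF] := (reflexiveP F).1 (traced1_reflexive F1).
have F_proj := traced1_projective F1.
split=> [||j|j].
- exact: fg_prod (fg_traced1 F1).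
- apply/reflexiveP; split=> [[x y] xy0|Phi].
    congr pair; [apply: injG => f | apply: injF => f].
      by have := xy0 (dual_prod G F (f, 0)); rewrite dual_prodE homR0 addr0.
    by have := xy0 (dual_prod G F (0, f)); rewrite dual_prodE homR0 add0r.
  pose Phi' : homR (dual (G * F)%type) R^o := Phi.
  have [x xE] := surjG (homL (Phi' \o (dual_prod G F \o inl_lin _ _))).
  have [y yE] := surjF (homL (Phi' \o (dual_prod G F \o inr_lin _ _))).
  exists (x, y) => h; have [[f g] <-] := dual_prod_surj h.
  have fgE : (f, g) = inl_lin _ _ f + inr_lin _ _ g.
    by congr pair; rewrite /= ?addr0 ?add0r.
  by rewrite dual_prodE -xE -yE -[Phi _]/(Phi' _) fgE (linearD (dual_prod G F)) (linearD Phi').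
- by apply: (Ext_eq0_addp (e := (idfun : {linear (G * F)%type -> _}))) => // y; exists y.
- apply: (Ext_eq0_addp (e := dual_prod G F) _ (@dual_prod_inj G F) (@dual_prod_surj G F)) => //.
  exact/traced1_projective/traced_dual.
Qed.

(** Ext^1(D, R) = 0 makes the dual sequence exact, so A is handled by dualizing once more and dual A
    as a cokernel of duals. *)
Lemma TR_ker A B D (i : {linear A -> B}) (p : {linear B -> D}) :
  ses i p -> TR B -> TR D -> TR A.
Proof.
move=> ip [Bfg Br B1 B2] [Dfg Dr D1 D2].
have [i0 ps ex] := ip; have Afg : fg A := fg_inj R_noeth i0 Bfg.
pose res (X : lmodType R) (Xfg : fg X) := syz_res R_noeth (exist _ X Xfg).
have res_proj (X : lmodType R) (Xfg : fg X) : projective_resolution (res X Xfg).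
  exact: syz_res_projective.
have Dp := res_proj D Dfg; have Ap := res_proj A Afg; have Bp := res_proj B Bfg.
have ext (f : {linear A -> R^o}) : exists g : {linear B -> R^o}, forall a, g (i a) = f a.
  exact: (Ext1_extend Dp ip (Ext_van_of_eq0 Dp (D1 0%N))).
have dses := ses_hom_pre ip ext; have [_ dps _] := dses.
have [injA' surjB] := (reflexiveP B).1 Br; have [injD surjD] := (reflexiveP D).1 Dr.
split=> // [|j|j].
- apply/reflexiveP; split=> [a a0|Phi].
    apply/i0/injA' => f; exact: (a0 (hom_pre R^o i f)).
  pose Phi' : homR (dual A) R^o := Phi.
  have [b bE] := surjB (homL (Phi' \o hom_pre R^o i)).
  have [a ab] : exists a, i a = b.
    apply/ex/injD => h.
    rewrite -[h (p b)]/(hom_pre R^o p h b) -bE /=.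
    by rewrite -[homL _]/(hom_pre R^o i (hom_pre R^o p h)) (ses_comp0 dses) linear0.
  exists a => f; have [g <-] := dps f.
  by rewrite -[RHS]/(g (i a)) ab -bE.
- exists (res A Afg); split=> //.
  apply: (Ext_van_ses_left Ap Bp ip D1) => k.
  exact: (Ext_van_of_eq0 Bp (B1 k)).
- have rp X Xfg k : Ext_eq0 X R^o k -> Ext_van (res X Xfg) R^o k.
    exact: (Ext_van_of_eq0 (res_proj X Xfg)).
  apply: (Ext_eq0_ses_third (res_proj _ (fg_dual R_noeth Dfg)) (res_proj _ (fg_dual R_noeth Bfg)) dses).
  (* By reflexivity of D the functional [f] is evaluation at some [d]; evaluation at a preimage of
     [d] in B extends it. *)
  + move=> f; have [d dE] := surjD (homL f); have [b bd] := ps d.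
    exists (ev_lin R^o b) => h; rewrite -[f h]/(homL f h) dE -bd.
    by [].
  + by move=> k; apply: rp.
  + by move=> k; apply: rp.
Qed.

Section SyzygyResolution.
Variables (Z F X : lmodType R) (inc : {linear Z -> F}) (pr : {linear F -> X}).
Variable G : resolution X.
Hypotheses (ipr : ses inc pr) (F_proj : traced 1 F) (G_TR : forall i, TR (G i)).

(** The pullback Y of G_1 and F over G_0 replaces both: its projection to F maps onto Z with kernel
    the image of G_2, and Y is totally reflexive as the kernel of G_1 + F -> G_0. The resolution
    becomes one step shorter. *)
Lemma syzygy_TR_resolution : exists G' : resolution Z, (forall i, TR (G' i)) /\
  forall i, (forall x : G i.+2, x = 0) -> forall x : G' i.+1, x = 0.
Proof.
have [inc0 prs ex] := ipr.
have F_p : projective F := traced1_projective F_proj.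
have [al alE] := F_p _ _ (res_aug G) pr (@res_aug_surj _ _ G).
pose q : {linear (G 1%N * F)%type -> G 0%N} := (res_diff G 0%N \o fst) \- (al \o snd).
have qs y : exists x, q x = y.
  have [f fE] := prs (res_aug G y).
  have /res_exact0[g gE] : res_aug G (y - al f) = 0 by rewrite linearB alE fE subrr.
  by exists (g, - f); rewrite /q /= gE linearN opprK subrK.
have qses := ses_ker qs; pose Y : lmodType R := subm (ker_submodule q).
pose j : {linear Y -> (G 1%N * F)%type} := subm_inc (ker_submodule q).
have j0 y : j y = 0 -> y = 0 by exact: subm_inc_inj.
have jP y : res_diff G 0%N (j y).1 = al (j y).2.
  by apply: subr0_eq; exact: (subm_incP (Ssub := ker_submodule q) y).
have Yj g f : res_diff G 0%N g = al f -> exists y, j y = (g, f).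
  move=> gf; apply/(subm_incS (ker_submodule q)); rewrite /q /= gf.
  exact: subrr.
have Y_TR : TR Y by apply: (TR_ker qses) => //; exact: TR_prod.
have [|aug augE] := lin_factor (f := snd \o j : {linear Y -> F}) inc0.
  by move=> y; apply/ex; rewrite /= -alE -jP res_augd.
have [|d0 d0E] := lin_factor (f := inl_lin _ _ \o res_diff G 1%N : {linear G 2%N -> (G 1%N * F)%type}) j0.
  by move=> x; apply: Yj; rewrite res_dd linear0.
have {}augE y : inc (aug y) = (j y).2 := augE y.
have {}d0E z : j (d0 z) = (res_diff G 1%N z, 0) := d0E z.
pose md i : lmodType R := if i is k.+1 then G k.+2 else Y.
pose df i : {linear md i.+1 -> md i} :=
  match i with 0%N => d0 | k.+1 => res_diff G k.+2 end.
have aug_s z : exists y : md 0%N, aug y = z.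
  have /res_exact0[g gE] : res_aug G (al (inc z)) = 0 by rewrite alE (ses_comp0 ipr).
  have [y yE] := Yj _ _ gE; exists y; apply/subr0_eq/inc0.
  by rewrite linearB augE yE subrr.
have ex0 (y : md 0%N) : aug y = 0 <-> exists z : md 1%N, df 0%N z = y.
  split=> [y0|[z <-]]; last by apply: inc0; rewrite augE d0E.
  have jy2 : (j y).2 = 0 by rewrite -augE y0 linear0.
  have /res_exact[z zE] : res_diff G 0%N (j y).1 = 0 by rewrite jP jy2 linear0.
  exists z; apply/subr0_eq/j0; rewrite linearB d0E.
  by rewrite zE -jy2 -surjective_pairing subrr.
have exS i (y : md i.+1) : df i y = 0 <-> exists z : md i.+2, df i.+1 z = y.
  case: i y => [|i] y; last exact: res_exact.
  rewrite -[exists z, _]/(exists z, res_diff G 2%N z = y) -res_exact.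
  split=> [y0|y0]; last by apply: j0; rewrite d0E y0.
  by have := d0E y; rewrite -[d0 y]/(df 0%N y) y0 linear0 => -[<-].
by exists (Resolution aug_s ex0 exS); split=> [[|i]|i] //=; exact: G_TR.
Qed.

End SyzygyResolution.

Lemma syz_TR (N : fgmod R) n : Gdim_le (sval N) n ->
  forall i, (n <= i)%N -> TR (sval (syz R_noeth N i)).
Proof.
case=> G [G_TR G0] i ni.
(* Each syzygy shortens the resolution by one, but degree 0 always survives, hence the condition 0 <
   k. For i >= n only degree 0 is left. *)
suff [G' [G'_TR G'0]] : exists G' : resolution (sval (syz R_noeth N i)),
    (forall k, TR (G' k)) /\ forall k, (n < k + i)%N -> (0 < k)%N -> forall x : G' k, x = 0.
  pose zero : lmodType R := 'rV[R]_0.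
  have zero0 (x : zero) : x = 0 by apply/rowP => -[].
  have a0 y : res_aug G' y = 0 -> y = 0.
    move=> /res_exact0[z <-]; have ni1 : (n < 1 + i)%N by rewrite add1n ltnS.
    by rewrite (G'0 1%N ni1 isT z) linear0.
  have [k kE] := lin_factor (f := idfun) a0 (@res_aug_surj _ _ G').
  (* The isomorphism with G'_0 is read as a kernel of G'_0 -> 0, which transports [TR]. *)
  apply: (@TR_ker _ _ _ k (lin0 (G' 0%N) zero)) (G'_TR 0%N) _; last exact/TR_traced1/traced1_zero.
  split=> [x x0|d|b].
  - by rewrite -[x]kE x0 linear0.
  - by exists 0; rewrite [RHS]zero0.
  - by split=> // _; exists (res_aug G' b); apply/subr0_eq/a0; rewrite linearB kE subrr.
elim: i {ni} => [|i [G' [G'_TR G'0]]].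
  exists G; split=> [k|k]; last by rewrite addn0 => nk _; apply: G0.
  have [kn|nk] := leqP k n; first exact/totally_reflexive_TR/G_TR.
  exact/TR_traced1/traced1_zero/G0.
have [|G2 [G2_TR G20]] := syzygy_TR_resolution (syz_ses R_noeth (syz R_noeth N i)) _ G'_TR.
  exact: traced1_rV.
exists G2; split=> // -[//|k] nk _; apply: G20; apply: G'0 => //.
by rewrite addSn -addnS.
Qed.

End TotallyReflexive.

(** * Freeness *)

Section LocallyFree.
Variables (R : comNzRingType) (p : prime_idealr R).
Hypothesis R_noeth : noetherian R.
Implicit Types A B M : lmodType R.

Lemma prod_notin (I : finType) (P : pred I) (a : I -> R) :
  (forall i, a i \notin p) -> \prod_(i | P i) a i \notin p.
Proof.
move=> ap; elim/big_ind: _ => [|x y xp yp|i _]; [by rewrite idealr1 | | exact: ap].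
by rewrite prime_idealrM negb_or xp.
Qed.

Lemma common_annihilator A B (f : {linear A -> B}) : fg A ->
  (forall x, exists2 s : R, s \notin p & s *: f x = 0) ->
  exists2 s : R, s \notin p & forall x, s *: f x = 0.
Proof.
move=> [r rA] f0; suff [s sp sr] : exists2 s : R, s \notin p & forall v, v \in r -> s *: f v = 0.
  exists s => // x; apply: (spanl_min (S := fun x => s *: f x = 0) _ sr (rA x)).
  exact: (ker_submodule (s \*: f)).
elim: r {rA} => [|v r [s sp sr]]; first by exists 1; rewrite ?idealr1.
have [u up uv] := f0 v; exists (u * s); first by rewrite prime_idealrM negb_or up.
move=> w /[!inE]/predU1P[->|/sr sw]; first by rewrite mulrC -scalerA uv scaler0.
by rewrite -scalerA sw scaler0.
Qed.

Lemma common_denominator A n (u : 'I_n -> locm p A) :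
  exists2 s : R, s \notin p & forall i, exists x, s *: u i = locm_inc p A x.
Proof.
have /boolp.choice[s sP] i : exists s : R, s \notin p /\ exists x, s *: u i = locm_inc p A x.
  by have [s sp [x sx]] := locm_num (u i); exists s; split=> //; exists x.
exists (\prod_i s i); first by apply: prod_notin => i; case: (sP i).
move=> i; have [_ [x sx]] := sP i.
have -> : \prod_j s j = (\prod_(j < n | j != i) s j) * s i by rewrite (bigD1 i) //= mulrC.
by exists ((\prod_(j < n | j != i) s j) *: x); rewrite -scalerA sx linearZZ.
Qed.

(** Hom commutes with localization for finitely presented modules: values on generators get a common
    denominator [s], and finitely many relations, which hold only after localizing, are killed by a
    common [w]. *)
Lemma locm_functional_lift M (l : {linear M -> locm p R^o}) : fg M ->
  exists2 s : R, s \notin p & exists g : dual M,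
    forall x, locm_inc p R^o (g x) = s *: l x.
Proof.
move=> Mfg; have [n [f fs]] := fg_cover Mfg.
have [s sp sl] := common_denominator (fun i => l (f (delta_mx 0 i))).
have /boolp.choice[r rE] := sl.
have rVE (u : 'rV[R]_n) : locm_inc p R^o (rV_lin r u) = s *: l (f u).
  rewrite {2}[u]row_sum_delta -[rV_lin r u]/(\sum_i u 0 i *: r i) 
    (linear_sum (locm_inc p R^o)) (linear_sum f) (linear_sum l) scaler_sumr.
  apply: eq_bigr => i _; rewrite (linearZZ (locm_inc p R^o)) -rE (linearZZ f) (linearZZ l).
  by rewrite !scalerA mulrC.
have [x|w wp wr] := @common_annihilator _ _ (rV_lin r \o subm_inc (ker_submodule f))
  (fg_subm R_noeth (ker_submodule f) (fg_traced1 (traced1_rV R n))).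
  apply/locm_inc_eq0.
  change (locm_inc p R^o (rV_lin r (subm_inc (ker_submodule f) x)) = 0).
  by rewrite rVE (subm_incP x) linear0 scaler0.
have [u u0|g gE] := lin_quot (f := w \*: rV_lin r) fs.
  by have [z <-] := (subm_incS (ker_submodule f) u).1 u0; exact: wr.
exists (w * s); first by rewrite prime_idealrM negb_or wp.
exists (homL g) => x; have [u <-] := fs x.
by rewrite -[homL g _]/(g (f u)) gE -scalerA -rVE -(linearZZ (locm_inc p R^o)).
Qed.

(** Spanning lists may repeat vectors while independence is stated for duplicate-free lists, so
    coefficients of repeated vectors have to be accumulated. *)
Lemma span_extend M (s r : seq (loc p M)) (c : loc p M -> locR p) : uniq s ->
  {subset r <= s} -> exists c', \sum_(b <- r) c b *: b = \sum_(b <- s) c' b *: b.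
Proof.
move=> us; elim: r => [|v r IH] rs.
  by exists (fun=> 0); rewrite big_nil big1 // => b _; rewrite scale0r.
have [w wr|c' c'E] := IH; first by apply: rs; rewrite inE wr orbT.
exists (fun b => c' b + (b == v)%:R * c v); rewrite big_cons c'E addrC.
rewrite [RHS](eq_bigr (fun b => c' b *: b + ((b == v)%:R * c v) *: b)); last first.
  by move=> b _; rewrite scalerDl.
rewrite big_split /=; congr (_ + _).
rewrite (bigD1_seq v) ?rs ?mem_head //= eqxx mul1r big1 ?addr0 // => b /negPf ->.
by rewrite mul0r scale0r.
Qed.

(** The scalar action of the local ring, on the copies of the localizations that carry R-module
    structures. *)
Definition loc_act M (l : locm p R^o) (b : locm p M) : locm p M :=
  loc_scale (l : locR p) (b : loc p M).

Lemma loc_actZl M (a : R) l (b : locm p M) : a *: loc_act l b = loc_act (a *: l) b.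
Proof. exact: loc_scaleA. Qed.

Lemma loc_actZr M (a : R) l (b : locm p M) : a *: loc_act l b = loc_act l (a *: b).
Proof.
rewrite loc_actZl; transitivity (loc_scale (loc_scale l (\pi_(loc p R^o) (a : R^o, denom1 p) : locR p) : locR p) b).
  by congr (loc_scale _ _); exact: locR_mulC.
by rewrite -loc_scaleA.
Qed.

Lemma loc_act_inc M (r : R^o) (b : locm p M) : loc_act (locm_inc p R^o r) b = (r : R) *: b.
Proof. by []. Qed.

(** Finitely many basis vectors span the image of M. Their coordinate functions lift to functionals
    on M after clearing denominators, and the resulting identity holds in M after one further
    multiplication. *)
Lemma free_at_traced M : fg M -> free_at M p -> exists2 a : R, a \notin p & traced a M.
Proof.
move=> Mfg [B [Bind Bspan]].
pose spanned (s : seq (loc p M)) (x : M) := exists c : loc p M -> locR p,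
  locm_inc p M x = \sum_(b <- s) c b *: b :> loc p M.
have [s [us sB sM]] : exists s : seq (loc p M),
    [/\ uniq s, forall b, b \in s -> B b & forall x, spanned s x].
  have [r rM] := Mfg.
  have [s [us sB sr]] : exists s : seq (loc p M),
      [/\ uniq s, forall b, b \in s -> B b & forall x, x \in r -> spanned s x].
    elim: r {rM} => [|v r [s [us sB sr]]]; first by exists [::].
    have [s0 [c [s0B cE]]] := Bspan (locm_inc p M v).
    exists (undup (s0 ++ s)); split; first exact: undup_uniq.
      by move=> b; rewrite mem_undup mem_cat => /orP[/s0B|/sB].
    have ext x (q : seq (loc p M)) d : {subset q <= s0 ++ s} ->
        locm_inc p M x = \sum_(b <- q) d b *: b :> loc p M -> spanned (undup (s0 ++ s)) x.
      move=> qs xE; have [|d' d'E] := @span_extend M (undup (s0 ++ s)) q d (undup_uniq _).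
        by move=> b /qs; rewrite mem_undup.
      by exists d'; rewrite xE.
    move=> w /[!inE]/predU1P[->|/sr[d dE]].
      by apply: ext cE => b bs; rewrite mem_cat bs.
    by apply: ext dE => b bs; rewrite mem_cat bs orbT.
  exists s; split=> // x; apply: (spanl_min _ sr (rM x)); split.
    by exists (fun=> 0); rewrite linear0 big1 // => b _; rewrite scale0r.
  move=> a y z [c cE] [d dE].
  exists (fun b => (\pi_(loc p R^o) (a : R^o, denom1 p) : locR p) * c b + d b).
  rewrite linearP -[a *: _]/((\pi_(loc p R^o) (a : R^o, denom1 p) : locR p) *: (locm_inc p M y : loc p M)).
  rewrite cE dE scaler_sumr -big_split /=; apply: eq_bigr => b _.
  by rewrite scalerDl scalerA.
have coord (i : 'I_(size s)) : exists l : {linear M -> locm p R^o}, forall x c,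
    locm_inc p M x = \sum_(b <- s) c b *: b :> loc p M -> l x = c (nth 0 s i) :> locR p.
  pose S x (y : locm p R^o) := exists c : loc p M -> locR p,
    locm_inc p M x = \sum_(b <- s) c b *: b :> loc p M /\ y = c (nth 0 s i) :> locR p.
  have uniqS x c d : locm_inc p M x = \sum_(b <- s) c b *: b :> loc p M ->
      locm_inc p M x = \sum_(b <- s) d b *: b :> loc p M ->
      c (nth 0 s i) = d (nth 0 s i) :> locR p.
    move=> cE dE; apply/subr0_eq.
    apply: (Bind s (fun b => c b - d b) us sB _ (nth 0 s i) (mem_nth _ (ltn_ord i))).
    rewrite (eq_bigr (fun b => c b *: b - d b *: b)) => [|b _]; last by rewrite scalerBl.
    by rewrite big_split sumrN /= -cE -dE subrr.
  have [|||l lE] := lin_rel (S := S).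
  - by move=> x; have [c cE] := sM x; exists (c (nth 0 s i)), c.
  - by move=> x y z [c [cE ->]] [d [dE ->]]; exact: uniqS cE dE.
  - move=> a x y u v [c [cE ->]] [d [dE ->]].
    exists (fun b => (\pi_(loc p R^o) (a : R^o, denom1 p) : locR p) * c b + d b); split=> //.
    rewrite linearP -[a *: _]/((\pi_(loc p R^o) (a : R^o, denom1 p) : locR p) *: (locm_inc p M x : loc p M)).
    rewrite cE dE scaler_sumr -big_split /=; apply: eq_bigr => b _.
    by rewrite scalerDl scalerA.
  exists l => x c cE; have [d [dE ->]] := lE x.
  exact: uniqS dE cE.
have /boolp.choice[l lE] := coord.
have incE x : locm_inc p M x = \sum_(i < size s) loc_act (l i x) (nth 0 s i).
  have [c cE] := sM x; rewrite [LHS]cE (big_nth 0) big_mkord.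
  by apply: eq_bigr => i _; rewrite (lE i x c cE).
have /boolp.choice[e eP] i : exists e : R * dual M * M, e.1.1 \notin p /\ forall x,
    e.1.1 *: loc_act (l i x) (nth 0 s i) = locm_inc p M ((e.1.2 x : R) *: e.2).
  have [u up [g gE]] := locm_functional_lift (l i) Mfg.
  have [d dp [b bE]] := locm_num (nth 0 s i : locm p M).
  exists (u * d, g, b); split=> /= [|x]; first by rewrite prime_idealrM negb_or up.
  by rewrite -scalerA loc_actZr bE loc_actZl -gE loc_act_inc -(linearZZ (locm_inc p M)).
(* [W] is the common denominator and [V i] the cofactor that brings the [i]-th term to it. *)
pose W := \prod_i (e i).1.1; pose V i := \prod_(j | j != i) (e j).1.1.
have WE i : W = V i * (e i).1.1 by rewrite /W (bigD1 i) //= mulrC.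
pose D : {linear M -> M} := (W \*: idfun) \- lincomb (fun i => (e i).1.2) (fun i => V i *: (e i).2).
have DE x : D x = W *: x - \sum_i ((e i).1.2 x : R) *: (V i *: (e i).2) by [].
have D0 x : locm_inc p M (D x) = 0.
  rewrite DE (linearB (locm_inc p M)) (linearZZ (locm_inc p M)) incE.
  rewrite scaler_sumr (linear_sum (locm_inc p M)); apply/eqP; rewrite subr_eq0; apply/eqP.
  apply: eq_bigr => i _; rewrite (WE i) -scalerA (eP i).2 -(linearZZ (locm_inc p M)).
  by congr (locm_inc p M _); rewrite !scalerA mulrC.
have [x|w wp wD] := common_annihilator (f := D) Mfg; first exact/locm_inc_eq0/D0.
exists (w * W); first by rewrite prime_idealrM negb_or wp prod_notin // => i; case: (eP i).
exists (size s), (fun i => w *: (V i *: (e i).2)), (fun i => (e i).1.2) => x.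
rewrite -scalerA; have := wD x; rewrite DE scalerBr => /subr0_eq ->.
by rewrite scaler_sumr; apply: eq_bigr => i _; rewrite !scalerA; congr (_ *: _); ring.
Qed.

End LocallyFree.

(** * Freeness criteria over a local ring *)

Section LocalFreeness.
Variables (R : comNzRingType) (m : idealr R).
Hypotheses (R_noeth : noetherian R) (R_local : local_ring m).
Implicit Types A B N M : lmodType R.

Definition has_basis N : Prop := exists n (e : 'I_n -> N) (h : 'I_n -> dual N),
  (forall i j, h i (e j) = (i == j)%:R) /\ forall x, x = \sum_i (h i x : R) *: e i.

Lemma mmul_lin A B (f : {linear A -> B}) x : mmul m x -> mmul m (f x).
Proof.
move=> xm; apply: (xm (fun y => mmul m (f y))).
  have [B0 BL] := mmul_submodule m B; split=> [|a y z]; first by rewrite linear0.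
  by rewrite linearP; apply: BL.
by move=> a y am; rewrite linearZZ; apply: mmulZ.
Qed.

Lemma local_free_seq n N (s : seq N) : size s = n -> (forall x, spanl s x) ->
  (forall f, ~ mmul m f -> exists h : dual N, h f \notin m) -> has_basis N.
Proof.
elim: n N s => [|n IH] N [|v s] //= => [_|[sn]] sN Nh.
  by exists 0%N, (fun=> 0), (fun=> 0); split=> [[]|x] //; rewrite big_ord0; exact: sN.
have [vm|/Nh[h hv]] := pselect (mmul m v).
  apply: (IH N s) => // x; apply: (nakayama R_noeth R_local _ (spanl_submodule s)).
    by exists (v :: s).
  move=> {}x; have [a sx] := sN x; exists (x - a *: v) => //.
  by rewrite opprB addrC subrK; apply: (submoduleZ (mmul_submodule m N)).
have [d dh] := local_unit R_noeth R_local hv.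
pose k : homR N R^o := d *: h; have kv : k v = 1 by exact: dh.
pose i := subm_inc (ker_submodule k).
have i0 y : i y = 0 -> y = 0 by exact: subm_inc_inj.
have ki y : k (i y) = 0 by exact: (subm_incP y).
pose pr : {linear N -> N} := idfun \- lincomb (fun _ : 'I_1 => k) (fun=> v).
have prE x : pr x = x - (k x : R) *: v by rewrite /pr /= big_ord1.
have [x|r rE] := lin_factor (f := pr) i0.
  apply/(subm_incS (ker_submodule k)).
  have kcv (c : R) : k (c *: v) = c.
    by apply: etrans (linearZZ k c v) _; rewrite -[RHS]mulr1 -kv.
  by rewrite prE linearB; apply/eqP; rewrite subr_eq0 [X in _ == X]kcv.
have rv : r v = 0 by apply: i0; rewrite rE prE kv scale1r subrr.
have ri y : r (i y) = y by apply/subr0_eq/i0; rewrite linearB rE prE ki scale0r subr0 subrr.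
have [|y|f fm|N' [e [h' [he hE]]]] := IH (subm (ker_submodule k)) (map r s).
- by rewrite size_map.
- rewrite -(ri y); have [a sa] := sN (i y); have := spanl_map r sa.
  by rewrite linearB linearZZ rv scaler0 subr0.
- have [|h2 h2f] := Nh (i f); last by exists (hom_pre R^o i h2).
  by apply: contra_not fm => /(mmul_lin r); rewrite ri.
pose E (j : 'I_N'.+1) : N := if unlift ord0 j is Some j' then i (e j') else v.
pose H (j : 'I_N'.+1) : dual N :=
  if unlift ord0 j is Some j' then hom_pre R^o r (h' j') else k.
have E0 : E ord0 = v by rewrite /E unlift_none.
have ES j : E (lift ord0 j) = i (e j) by rewrite /E liftK.
have H0 : H ord0 = k by rewrite /H unlift_none.
have HS j : H (lift ord0 j) = hom_pre R^o r (h' j) by rewrite /H liftK.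
exists N'.+1, E, H; split=> [a b|x].
  case: (unliftP ord0 a) => [a'|] ->; case: (unliftP ord0 b) => [b'|] ->.
  - by rewrite HS ES (inj_eq lift_inj) -he -[LHS]/(h' a' (r (i (e b')))) ri.
  - by rewrite HS E0 eq_sym (negPf (neq_lift _ _)) -[LHS]/(h' a' (r v)) rv linear0.
  - by rewrite H0 ES (negPf (neq_lift _ _)) ki.
  - by rewrite H0 E0 eqxx.
rewrite big_ord_recl H0 E0.
have -> : \sum_(j < N') (H (lift ord0 j) x : R) *: E (lift ord0 j) = i (r x).
  rewrite {1}[r x]hE linear_sum; apply: eq_bigr => j _.
  by rewrite HS ES linearZZ.
by rewrite rE prE addrC subrK.
Qed.

Lemma local_free N : fg N ->
  (forall f, ~ mmul m f -> exists h : dual N, h f \notin m) -> has_basis N.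
Proof. by case=> s sN; apply: local_free_seq sN. Qed.

Lemma has_basis_free N : has_basis N -> free_module N.
Proof.
case=> n [e [h [he hE]]]; have e_inj : injective e.
  move=> i j eij; apply/eqP; have := he i j; rewrite -eij he eqxx.
  by case: eqP => // _ /esym/eqP; rewrite eq_sym oner_eq0.
exists [set x | exists i, x = e i]%classic; split=> [s c us sB sc0 b bs|x].
  have [i bE] := sB b bs; have := congr1 (h i) sc0.
  rewrite linear0 linear_sum (bigD1_seq b) //= big1_seq ?addr0 => [|d /andP[db ds]].
    by rewrite linearZZ /= bE he eqxx => cb; rewrite -[LHS]mulr1.
  have [j dE] := sB d ds; rewrite linearZZ /= dE he; case: eqP => [ij|_].
    by case/eqP: db; rewrite dE bE ij.
  exact: mulr0.
exists (map e (enum 'I_n)), (fun b => \sum_i (b == e i)%:R * (h i x : R)).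
split=> [b /mapP[i _ ->]|]; first by exists i.
rewrite big_map big_enum /= {1}[x]hE; apply: eq_bigr => i _; congr (_ *: _).
rewrite (bigD1 i) //= eqxx mul1r big1 ?addr0 // => j ji.
by rewrite (inj_eq e_inj) eq_sym (negPf ji) mul0r.
Qed.

(** Reflexivity turns the functionals dual to a basis of dual M into evaluations at elements of M,
    and the roles are exchanged. *)
Lemma has_basis_dual M : reflexive_module M -> has_basis (dual M) -> has_basis M.
Proof.
move=> /reflexiveP[inj surj] [n [e [h [he hE]]]].
have /boolp.choice[x xE] i := surj (h i).
exists n, x, e; split=> [i j|y].
  by rewrite -xE he eq_sym.
apply/subr0_eq/inj => f.
have fE z : f z = \sum_i (h i f : R) * (e i z : R) by rewrite {1}[f]hE homR_sum.
have e_lin (j : 'I_n) : e j (y - \sum_i (e i y : R) *: x i) = 0.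
  rewrite linearB; apply/eqP; rewrite subr_eq0 linear_sum (bigD1 j) //=.
  rewrite big1 ?addr0 => [|i ij].
    by rewrite linearZZ /= -xE he eqxx; apply/eqP/esym/mulr1.
  by rewrite linearZZ /= -xE he (negPf ij); exact: mulr0.
by rewrite fE; apply: big1 => i _; rewrite e_lin mulr0.
Qed.

End LocalFreeness.

(** * Traces and the main argument *)

Section Traces.
Variable R : comNzRingType.
Implicit Types A C M : lmodType R.

(** On a factor where [a] is invertible the only candidate is T(a) / a; the symmetry condition makes
    it work for every [b]. *)
Lemma split_local_glue (K : set R) C (T : R -> C) : split_local K C ->
  (forall a b, K a -> K b -> a *: T b = b *: T a) ->
  exists c, forall b, K b -> b *: c = T b.
Proof.
case=> J [D [pr [prs pr0 Ka]]] TC.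
pose a j := sval (cid (Ka j)); have aP j := svalP (cid (Ka j)).
have aD j : exists u, a j *: u = pr j (T (a j)) by case: (aP j) => _ _; apply.
have [c cE] := prs (fun j => sval (cid (aD j))).
exists c => b Kb; apply/subr0_eq/pr0 => j; have [Kaj aI _] := aP j.
apply: aI; rewrite linearB linearZZ scalerBr cE scalerA mulrC -scalerA.
by rewrite (svalP (cid (aD j))) -!linearZZ (TC _ _ Kaj Kb) subrr.
Qed.

Lemma split_local_separated (K : set R) C (c : C) : split_local K C ->
  (forall b, K b -> b *: c = 0) -> c = 0.
Proof.
case=> J [D [pr [prs pr0 Ka]]] c0; apply: pr0 => j; have [a [Kaj aI _]] := Ka j.
by apply: aI; rewrite -linearZZ c0 // linear0.
Qed.

Lemma traced_dualE M (a : R) n (e : 'I_n -> M) (h : 'I_n -> dual M) (f : dual M) :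
  (forall x, a *: x = \sum_i (h i x : R) *: e i) ->
  a *: f = \sum_i (f (e i) : R) *: h i.
Proof.
move=> eh; apply: homR_ext => x; rewrite homRZ -linearZZ eh linear_sum homR_sum.
by apply: eq_bigr => i _; rewrite linearZZ homRZ; exact: mulrC.
Qed.

(* For a * id_M = sum_i h_i(-) e_i, the element sum_i beta(e_i)(h_i) plays the role of
   a times the trace of beta. *)
Lemma trace_swap M A (beta : {linear M -> homR (dual M) A}) (a b : R)
    n (e : 'I_n -> M) (h : 'I_n -> dual M) k (e' : 'I_k -> M) (h' : 'I_k -> dual M) :
  (forall x, a *: x = \sum_i (h i x : R) *: e i) ->
  (forall x, b *: x = \sum_i (h' i x : R) *: e' i) ->
  b *: (\sum_i beta (e i) (h i)) = a *: (\sum_j beta (e' j) (h' j)).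
Proof.
move=> eh eh'; rewrite !scaler_sumr.
transitivity (\sum_i \sum_j (h' j (e i) : R) *: beta (e' j) (h i)).
  apply: eq_bigr => i _; rewrite -homRZ -(linearZZ beta) eh' (linear_sum beta) homR_sum.
  by apply: eq_bigr => j _; rewrite (linearZZ beta) homRZ.
rewrite exchange_big /=; apply: eq_bigr => j _.
rewrite -(linearZZ (beta (e' j))) (traced_dualE (h' j) eh) (linear_sum (beta (e' j))).
by apply: eq_bigr => i _; rewrite (linearZZ (beta (e' j))).
Qed.

End Traces.

(** * Depth of biduals, syzygies and Hom modules *)

Section LocallyFreeDepth.
Variables (R : comNzRingType) (m : idealr R).
Hypotheses (R_noeth : noetherian R) (R_local : local_ring m).
Variable K : set R.
Hypothesis K_max : forall a, K a -> a \in m.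
Hypothesis K_primes :
  forall p : prime_idealr R, ~ maximal_ideal p -> exists2 a, K a & a \notin p.
Implicit Types A X Z F : lmodType R.
Local Notation Ek := (Ext_res_van m R_noeth).
Let kres_proj := residue_res_projective (m := m) (R_noeth := R_noeth).

Lemma no_socle_killed A (x : A) : no_socle m A -> (forall a, K a -> a *: x = 0) -> x = 0.
Proof.
move=> A0 Kx; apply: (no_socle_torsion R_noeth R_local A0) => p pm.
by have [a Ka ap] := K_primes pm; exists a; last exact: Kx.
Qed.

Lemma no_socle_hom X A : no_socle m A -> no_socle m (homR X A).
Proof.
move=> A0 f mf; apply: homR_ext => x; apply: A0 => a am.
by rewrite -homRZ mf.
Qed.

Lemma Ext_res_van_hom0 X A : Ek A 0 -> Ek (homR X A) 0.
Proof. by move=> /Ext_res_van0 A0; apply/Ext_res_van0/no_socle_hom. Qed.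

(** The cokernel of X -> dual (dual X) is killed by K, since [a] times any functional on dual X is
    an evaluation. The depth assumptions leave it without socle, so it is zero. *)
Lemma traced_reflexive X : (forall a, K a -> traced a X) -> Ek R^o 0 -> Ek X 0 -> Ek X 1 ->
  reflexive_module X.
Proof.
move=> KX R0 /Ext_res_van0 X0 X1.
have inj x : (forall f : dual X, f x = 0) -> x = 0.
  by move=> x0; apply: (no_socle_killed X0) => a Ka; apply: traced_separated x0; apply: KX.
apply/reflexiveP; split=> // Phi.
have bses : ses (bidual_lin X) (qpi (im_submodule (bidual_lin X))).
  by apply: ses_coker => x x0; apply: inj => f; rewrite -[LHS]/(bidual_lin X x f) x0.
have /Ext_res_van0 Q0 := Ext_van_ses_third kres_proj bses
  (Ext_res_van_hom0 (X := dual X) R0) X1.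
have /qpi_eq0[x xE] : qpi (im_submodule (bidual_lin X)) Phi = 0.
  apply: (no_socle_killed Q0) => a Ka; rewrite -linearZZ; apply/qpi_eq0.
  have [x xE] := traced_bidual Phi (KX a Ka); exists x.
  by apply: homR_ext => f; rewrite homRZ xE.
by exists x => f; rewrite -xE.
Qed.

(** The cokernel of the embedding of dual X into a free module has no socle: values on relations of
    a functional that m sends into dual X are killed by m, hence zero in R. *)
Lemma dual_van1 X : fg X -> Ek R^o 0 -> Ek R^o 1 -> Ek (dual X) 1.
Proof.
move=> Xfg /Ext_res_van0 R0 R1; have [n [f fs]] := fg_cover Xfg.
pose i : {linear dual X -> dual 'rV[R]_n} := hom_pre R^o f.
have i0 g : i g = 0 -> g = 0.
  move=> g0; apply: homR_ext => x; have [u <-] := fs x.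
  by rewrite -[LHS]/(i g u) g0.
apply: (Ext_van_ses_first kres_proj (ses_coker i0)); last first.
  exact: (Ext_van_traced1 (traced_dual (traced1_rV R n)) R1).
apply/Ext_res_van0 => w mw; have [h hw] := qpi_surj w; rewrite -hw.
pose h' : homR 'rV[R]_n R^o := h.
have [u fu|g gE] := lin_quot (f := h') fs.
  apply: R0 => a am; have /qpi_eq0[g gE] : qpi (im_submodule i) (a *: h) = 0.
    by rewrite linearZZ hw mw.
  by rewrite -[LHS]/((a *: h') u) -[a *: h']gE -[LHS]/(g (f u)) fu linear0.
by apply/qpi_eq0; exists (homL g); apply: homR_ext => u; exact: gE.
Qed.

(** Each syzygy gains one degree of vanishing, up to [t], starting from the two degrees known for
    N. *)
Lemma syz_van (N : fgmod R) t j : (forall i, (i < t)%N -> Ek R^o i) ->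
  Ek (sval N) 0 -> Ek (sval N) 1 ->
  forall i, (i < t)%N -> (i <= j.+1)%N -> Ek (sval (syz R_noeth N j)) i.
Proof.
move=> Rv N0 N1; elim: j => [|j IH] i it ij.
  by case: i it ij => [|[|]].
have Pv k : (k < t)%N -> Ek 'rV[R]_(cover_rank (syz R_noeth N j)) k.
  by move=> /Rv; apply: Ext_van_traced1; exact: traced1_rV.
have sses := syz_ses R_noeth (syz R_noeth N j).
case: i it ij => [|i] it ij.
  by case: sses => i0 _ _; apply: (Ext_van0_sub i0); apply: Pv.
by apply: (Ext_van_ses_first kres_proj sses); [apply: IH => //; exact: ltnW | exact: Pv].
Qed.

Lemma syz_traced (N : fgmod R) j a : traced a (sval N) ->
  traced a (sval (syz R_noeth N j)).
Proof.
move=> Na; elim: j => // j; apply: (traced_ses (syz_ses R_noeth (syz R_noeth N j))).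
exact: traced1_rV.
Qed.

Variable t : nat.
Hypothesis R_van : forall i, (i < t)%N -> Ek R^o i.
Hypothesis R_nvan : ~ Ek R^o t.
Local Notation L := (tower R).

(** When Ext^1(X, C_n) = 0 this amounts to Ext^1(X, L_n) = 0, in a form that needs no resolution of
    X. *)
Definition tower_liftable X n : Prop := forall f : {linear X -> L n.+1},
  exists g : {linear X -> punctm (L n)}, forall x, tower_pr R n (g x) = f x.

(** The cokernel of Hom(X, C_n) -> Hom(X, L_(n+1)) is killed by K, because [a] times any map lifts.
    Vanishing of Ext^2(R/m, Hom(X, L_n)) passes to Ext^1 of the image [Y] and leaves the cokernel
    without socle. *)
Lemma tower_liftable_hom X n : (forall a, K a -> traced a X) -> (n.+1 < t)%N ->
  Ek (homR X (L n)) 2 -> tower_liftable X n.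
Proof.
move=> KX nt E2 f; have nses := tower_ses R_local K_max K_primes R_van (ltnW nt).
have [inc0 prs ex] := nses.
pose q : {linear homR X (punctm (L n)) -> homR X (L n.+1)} := hom_post X (tower_pr R n).
pose Y : lmodType R := subm (im_submodule q).
pose j : {linear Y -> homR X (L n.+1)} := subm_inc (im_submodule q).
have j0 : forall y, j y = 0 -> y = 0 by exact: subm_inc_inj.
have [|q' q'E] := lin_factor (f := q) j0.
  by move=> u; apply/(subm_incS (im_submodule q)); exists u.
have qses : ses (hom_post X (punct_inc (L n))) q'.
  split=> [u u0|y|u].
  - by apply: homR_ext => x; apply: inc0; rewrite -[LHS]/(hom_post X (punct_inc (L n)) u x) u0.
  - have [u uE] := subm_incP y; exists u; apply/subr0_eq/j0.
    by rewrite linearB q'E uE subrr.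
  - split=> [u0|[v <-]].
      have qu x : tower_pr R n (u x) = 0 by rewrite -[LHS]/(q u x) -q'E u0 linear0.
      have [|v vE] := lin_factor (f := (u : homR X (punctm (L n)))) inc0.
        by move=> x; apply/ex; exact: qu.
      by exists (homL v); apply: homR_ext => x; exact: vE.
    apply: j0; rewrite q'E; apply: homR_ext => x; exact: (ses_comp0 nses).
have Y1 : Ek Y 1.
  apply: (Ext_van_ses_third kres_proj qses) E2.
  by apply: (Ext_res_van_split (K := K)) => //; apply/split_local_hom/punctm_split.
have Ln : Ek (L n.+1) 0 by apply: (tower_van R_local K_max K_primes R_van).
have /Ext_res_van0 Q0 := Ext_van_ses_third kres_proj (ses_qpi (im_submodule q))
  (Ext_res_van_hom0 (X := X) Ln) Y1.
have /qpi_eq0[g gE] : qpi (im_submodule q) (homL f) = 0.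
  apply: (no_socle_killed Q0) => a Ka; rewrite -linearZZ; apply/qpi_eq0.
  have [g gE] := traced_lift f (KX a Ka) prs.
  by exists (homL g); apply: homR_ext => x; rewrite homRZ; exact: gE.
by exists g => x; rewrite -[LHS]/(q g x) gE.
Qed.

Lemma hom_tower_ses X n : (n < t)%N -> tower_liftable X n ->
  ses (hom_post X (punct_inc (L n))) (hom_post X (tower_pr R n)).
Proof. by move=> nt lft; apply: ses_hom lft; apply: (tower_ses R_local K_max K_primes R_van). Qed.

(** Vanishing at level n gives liftability there, hence exactness of Hom(X, -) on that step of the
    tower, hence vanishing at level n + 1 with one degree fewer. *)
Lemma hom_tower_van X n : (forall a, K a -> traced a X) ->
  (forall i, (i < t)%N -> Ek (homR X R^o) i) -> (n.+1 < t)%N ->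
  forall i, (i + n < t)%N -> Ek (homR X (L n)) i.
Proof.
move=> KX H0; elim: n => [|n IH] nt i; first by rewrite addn0; exact: H0.
rewrite addnS => int; have nt' : (n.+1 < t)%N by exact: ltnW.
have lft : tower_liftable X n.
  by apply: tower_liftable_hom => //; apply: IH; rewrite ?add2n.
apply: (Ext_van_ses_third kres_proj (hom_tower_ses (ltnW nt') lft)).
  by apply: (Ext_res_van_split (K := K)) => //; apply/split_local_hom/punctm_split.
by apply: IH; rewrite ?addSn.
Qed.

End LocallyFreeDepth.

(** * The argument in depth at least two *)

Section Main.
Variables (R : comNzRingType) (m : idealr R).
Hypotheses (R_noeth : noetherian R) (R_local : local_ring m).
Variable M : lmodType R.
Hypothesis M_fg : fg M.

Let K : set R := fun a => a \in m /\ traced a M.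
Hypothesis K_primes :
  forall p : prime_idealr R, ~ maximal_ideal p -> exists2 a, K a & a \notin p.

Variable r : nat.
Local Notation t := r.+2.
Local Notation Ek := (Ext_res_van m R_noeth).
Local Notation L := (tower R).
Hypothesis R_van : forall i, (i < t)%N -> Ek R^o i.
Hypothesis R_nvan : ~ Ek R^o t.
Hypothesis M_van : forall i, (i < t)%N -> Ek M i.
Hypothesis M_Gdim : Gdim_finite (dual M).
Hypothesis M_ext : Ext_eq0 M M r.+1.

Let K_max a : K a -> a \in m. Proof. by case. Qed.
Let KM a : K a -> traced a M. Proof. by case. Qed.
Let KN a : K a -> traced a (dual M). Proof. by move=> [_]; exact: traced_dual. Qed.

Let N : fgmod R := exist _ (dual M) (fg_dual R_noeth M_fg).
Local Notation Z := (syz R_noeth N).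

Let M_refl : reflexive_module M.
Proof.
by apply: (traced_reflexive R_local K_primes KM); [exact: R_van | exact: M_van | exact: M_van].
Qed.

(** Identifies Hom(N, L_0), the double dual of M, with M. *)
Let bidual_inv : exists k : {linear dual (dual M) -> M},
  (forall Phi, k Phi = 0 -> Phi = 0) /\ forall x, exists Phi, k Phi = x.
Proof.
have [k kE] := lin_factor (f := idfun) (bidual_lin_inj M_refl) (bidual_lin_surj M_refl).
exists k; split=> [Phi k0|x]; first by rewrite -[Phi]kE k0 linear0.
exists (bidual_lin M x); apply/subr0_eq/(bidual_lin_inj M_refl).
by rewrite linearB kE subrr.
Qed.

Let Z_van j : (r <= j)%N -> forall i, (i < t)%N -> Ek (sval (Z j)) i.
Proof.
move=> rj i it; apply: (syz_van (t := t)) => //.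
- by apply: Ext_res_van_hom0; exact: R_van.
- by apply: dual_van1 => //; exact: R_van.
- by rewrite -ltnS; apply: leq_trans it _; rewrite !ltnS.
Qed.

Let Z_ses j := syz_ses R_noeth (Z j).
Let Z_traced j a : K a -> traced a (sval (Z j)).
Proof. by move=> Ka; apply/syz_traced/KN. Qed.

Let Z_refl j : (r <= j)%N -> reflexive_module (sval (Z j)) /\
  forall k, Ext_eq0 (dual (sval (Z j))) R^o k.+1.
Proof.
have [n Gn] := M_Gdim.
(* Descending induction on [j] from the index [n] of total reflexivity, run on the distance [d]. It
   stays at r <= j, where the depth bound [Z_van] is available. *)
suff: forall d j, (r <= j)%N -> (n <= j + d)%N -> reflexive_module (sval (Z j)) /\
    forall k, Ext_eq0 (dual (sval (Z j))) R^o k.+1.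
  by move=> h rj; apply: (h n) => //; apply: leq_addl.
elim=> [|d IH] {}j rj nj.
  by rewrite addn0 in nj; have [_ ? _ ?] := @syz_TR R R_noeth N n Gn j nj.
have [||Tr Te] := IH j.+1; first exact: leqW.
  by rewrite addSnnS.
split.
  exact: (quotient_reflexive R_local K_max K_primes R_van R_nvan (Z_ses j)
    (traced1_rV R _) isT (svalP (Z j.+1)) Tr (@Z_traced j.+1) Te (Z_van rj)).
move=> k; pose Y : fgmod R := exist _ (dual (sval (Z j))) (fg_dual R_noeth (svalP (Z j))).
have Yp : projective_resolution (syz_res R_noeth Y) by exact: syz_res_projective.
exists (syz_res R_noeth Y); split=> //.
exact: (dual_kernel_ext R_local K_max K_primes R_van R_nvan (Z_ses j)
  (traced1_rV R _) isT (svalP (Z j.+1)) Tr (@Z_traced j.+1) Te (Z_van rj)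
  (fg_traced1 (traced1_rV R _)) Yp).
Qed.

Let N_ext j : (r <= j)%N -> Ext_van (syz_res R_noeth N) R^o j.+1.
Proof.
move=> rj; apply: Ext_van_syz => f; have [Tr Te] := Z_refl (leqW rj).
exact: (dual_extension R_local K_max K_primes R_van R_nvan (Z_ses j)
  (traced1_rV R _) isT (svalP (Z j.+1)) Tr (@Z_traced j.+1) Te (Z_van rj)).
Qed.

Let N_lift j : (j < t)%N -> tower_liftable (dual M) j.
Proof.
(* For j >= r the lift comes from Ext^(j+1)(N, R) = 0, hence from the G-dimension; for j < r it
   comes from the depth of Hom(N, R), which is M. *)
move=> jt; have [rj|jr] := leqP r j.
  apply: (tower_lift R_local K_max K_primes R_van
    (syz_res_projective (R_noeth := R_noeth) (M := N)) KN jt (N_ext rj)).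
apply: (tower_liftable_hom R_local K_max K_primes R_van KN) => //; first by rewrite ltnS ltnW // ltnS.
apply: (hom_tower_van R_local K_max K_primes R_van KN) => //.
- have [k [k0 ks]] := bidual_inv => i it.
  by apply: (Ext_van_iso k0 ks); exact: M_van.
- by rewrite ltnS ltnW // ltnS.
Qed.

Let hom_ses j (jt : (j < t)%N) := hom_tower_ses R_local K_max K_primes R_van jt (N_lift jt).

(** Here the shift is in the coefficients: Hom(N, -) is exact on the tower by [hom_ses], and Hom(N,
    C_i) is again split local. *)
Let M_lift (B : {linear M -> homR (dual M) (L r.+1)}) :
  exists B' : {linear M -> homR (dual M) (punctm (L r))},
    forall y, hom_post (dual M) (tower_pr R r) (B' y) = B y.
Proof.
have [P [Pp EP]] := M_ext; have [k [k0 ks]] := bidual_inv.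
suff: forall i, (i <= r)%N -> Ext_van P (homR (dual M) (L i)) (r - i).+1.
  move=> /(_ r (leqnn r)); rewrite subnn => E1.
  exact: (Ext1_lift Pp (hom_ses (leqnSn r.+1)) E1).
elim=> [|i IH] ir; first by rewrite subn0; exact: (Ext_van_iso k0 ks).
have it : (i < t)%N by apply: leq_trans ir _; rewrite leqW.
apply: (Ext_van_ses_third Pp (hom_ses it)).
  by apply: (Ext_van_traced Pp KM); apply/split_local_hom/punctm_split.
by rewrite subnSK //; apply: IH; exact: ltnW.
Qed.

Lemma dual_has_basis : has_basis (dual M).
Proof.
apply: (local_free R_noeth R_local (fg_dual R_noeth M_fg)) => f0 f0m.
(* Evaluation at [y] is a functional on N, so a unit value of [f0] would contradict [hf]. *)
apply: contrapT => hf; have f0M y : f0 y \in m.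
  by apply: contraT => f0y; case: hf; exists (bidual_map y).
have [sg sg0 msg] := tower_top R_local K_max K_primes R_van R_nvan.
have [gam [gam0 gamm]] := socle_functional R_noeth R_local (fg_dual R_noeth M_fg)
  (mmul_submodule m (dual M)) (fun _ h => h) f0m msg.
have [gl glE] := N_lift (leqnn t) gam.
have sses := tower_ses R_local K_max K_primes R_van (leqnn t).
have [s0 _ sex] := sses.
have [|||B BE] := @lin_rel R M (homR (dual M) (L r.+1))
  (fun y b => forall f, punct_inc (L r.+1) (b f) = (f0 y : R) *: gl f).
- move=> y; have [f|b bE] := lin_factor (f := (f0 y : R) \*: gl) s0; last by exists (homL b).
  apply/sex; change (tower_pr R r.+1 ((f0 y : R) *: gl f) = 0).
  rewrite linearZZ glE -linearZZ.
  by apply: gamm; exact: mmulZ.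
- move=> y b b' bE b'E; apply: homR_ext => f; apply/subr0_eq/s0.
  by rewrite linearB bE b'E subrr.
- move=> a y z b c bE cE f.
  by rewrite homRD homRZ linearP bE cE linearP scalerDl scalerA.
have [B' B'E] := M_lift B.
(* A choice of e_i and h_i for every [a] at once, empty outside K. *)
have /boolp.choice[T TP] a : exists T : {n : nat & (('I_n -> M) * ('I_n -> dual M))%type},
    K a -> forall x, a *: x = \sum_i ((projT2 T).2 i x : R) *: (projT2 T).1 i.
  have [[_ [n [e [h eh]]]]|nK] := pselect (K a); first by exists (existT _ n (e, h)).
  by exists (existT _ 0%N (fun=> 0, fun=> 0)).
pose tr A (b : {linear M -> homR (dual M) A}) a : A :=
  \sum_i b ((projT2 (T a)).1 i) ((projT2 (T a)).2 i).
have [a b Ka Kb|tau tauE] := split_local_glue (T := tr _ B') (punctm_split K_primes (L r)).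
  exact: (trace_swap B' (TP b Kb) (TP a Ka)).
(* Checked after multiplication by each b in K: the image of b * tau is sum_i f0(e_i) gl(h_i), and
   this is gl(b f0). *)
have glf0 : gl f0 = punct_inc (L r.+1) (tower_pr R r tau).
  apply/subr0_eq/(split_local_separated (punctm_split K_primes (L r.+1))) => b Kb.
  rewrite scalerBr; apply/eqP; rewrite subr_eq0; apply/eqP.
  rewrite -!linearZZ tauE // (traced_dualE f0 (TP b Kb)) /tr !linear_sum.
  apply: eq_bigr => i _; rewrite linearZZ -BE; congr (punct_inc _ _).
  by rewrite -B'E.
apply: sg0; rewrite -gam0 -glE glf0; exact: (ses_comp0 sses).
Qed.

Lemma locally_free_basis : has_basis M.
Proof. exact: has_basis_dual M_refl dual_has_basis. Qed.

End Main.

Theorem theorem1p6 (R : comNzRingType) (m : idealr R)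
    (R_noetherian : noetherian R) (R_local : local_ring m)
    (t : nat) (t_ge1 : (1 <= t)%N) (depth_R : depth_eq m R^o t)
    (M : lmodType R) (M_fg : fin_gen M)
    (Gdim_dual : Gdim_finite (dual M))
    (M_locally_free : punctured_free M)
    (depth_M : depth_ge m M t)
    (Ext_MM : Ext_eq0 M M t.-1) :
  free_module M.
Proof.
have Mfg := fg_fin_gen M_fg; apply: has_basis_free.
case: t t_ge1 depth_R depth_M Ext_MM => [//|[|r]] _ depth_R depth_M Ext_MM.
  (* Case t = 1: the augmentation is a cocycle of degree 0 with values in M, hence zero, and it is
     onto. *)
  have M0 (x : M) : x = 0.
    have [P [Pp EP]] := Ext_MM; have [y <-] := res_aug_surj P x.
    exact: (EP (res_aug P) (@res_augd _ _ P)).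
  exists 0%N, (fun=> 0), (fun=> 0); split=> [[]|x] //.
  by rewrite big_ord0 [LHS]M0.
apply: (@locally_free_basis R m R_noetherian R_local M Mfg _ r) => // [p pm|i it||i it].
- have [a ap Ma] := free_at_traced R_noetherian Mfg (M_locally_free p pm).
  (* K also requires membership in m, so the element from local freeness is multiplied by one of m
     outside [p]. *)
  have [z zm zp] := nonmaximal_prime R_noetherian R_local pm.
  exists (z * a); last by rewrite prime_idealrM negb_or zp.
  by split; [rewrite mulrC; apply: idealMr | apply: tracedM].
- by case: depth_R => dR _; apply: (depth_ge_van dR).
- by apply: depth_eq_van.
- by apply: (depth_ge_van depth_M).
Qed.
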